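(* Let $R$ be the exponential map for $\mathcal{M}$. Suppose that the loss $L$ satisfies: for every $y\in\mathcal{S}_y=\{y:(x,y)\in\mathcal{S}\}$, $L(\cdot,y)$ is smooth, $\mu$-strongly convex, with $\kappa_L$-Lipschitz gradient and $\kappa_H$-Lipschitz Hessian, i.e. $$\mu I\preceq\nabla^2_{zz}L(z,y)\preceq\kappa_LI,\qquad \|\nabla^2_{zz}L(z,y)-\nabla^2_{zz}L(x,y)\|\le\kappa_H\|z-x\|,\quad\forall z,x\in\mathbb{R}^q,$$ and $F_L(x,\theta)=\nabla^2_{zz}L(z,y)|_{z=f(x,\theta)}=:H_L(f(x,\theta))$. Suppose also that the following Riemannian Jacobian stability condition holds: with $\sigma_0:=\sqrt{\lambda_{\min}(J^R(\theta^0)J^R(\theta^0)^\top)}>0$, for every $\theta$ with $\|\theta-\theta^0\|\le4\kappa_L(\mu\sigma_0)^{-1}\|u^0-y\|$, $$\|J^R(\theta)-J^R(\theta^0)\|\le\min\left\{\tfrac12,\tfrac{\mu}{6\kappa_L}\right\}\sigma_0.$$ Let $\{\theta^k\}$ be generated, with fixed step size $t>0$, by $$d^k=(F^R(\theta^k))^\dagger J^R(\theta^k)^\top\nabla L(u^k,y),\qquad\theta^{k+1}=R_{\theta^k}(-td^k),$$ and let $u^k=u(\theta^k)$. (a) There exists a constant $\kappa_R>0$ such that if $\|u^0-y\|<\frac{\mu}{3\kappa_H}$ and $t\le\min\left\{1,\left(\frac{1}{6\|u^0-y\|}-\frac{\kappa_H}{2\mu}\right)\cdot\frac{3\mu^2\sigma_0}{8\kappa_R\kappa_L^2}\right\}$,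 then for all $k\ge0$, $$\|u^{k+1}-y\|\le\left(1-\frac t2\right)\|u^k-y\|.$$ (b) Suppose further (in addition to the hypotheses of (a)) that $J^R$ is $\kappa_J$-Lipschitz continuous with respect to $\theta$, i.e. $\|J^R(\theta)-J^R(\nu)\|\le\kappa_J\|\theta-\nu\|$ for all $\theta,\nu$. Then the rate of convergence is quadratic when $t=1$, namely there is a constant $\kappa_q>0$ such that for all $k\ge0$, $$\|u^{k+1}-y\|\le\kappa_q\|u^k-y\|^2.$$
   Context: $\mathcal{M}\subseteq\mathbb{R}^{m\times n}$ is an embedded Riemannian manifold with the metric induced by the Euclidean inner product; $\Theta\in\mathcal{M}$ is identified with $\theta=\mathrm{vec}(\Theta)\in\mathbb{R}^r$, $r=mn$. $\mathcal{S}=\{(x_i,y_i)\}_{i=1}^N$ is a finite data set, $f(x,\theta)=[f_1(x,\theta),\dots,f_q(x,\theta)]^\top\in\mathbb{R}^q$ is the input-output map, and $L(z,y):=-\log p(y|z)$ where $p(y|z)$ is a conditional density; $P_{y|x}(\theta)$ is the distribution with density $p(\cdot|f(x,\theta))$. $\|\cdot\|$ is the Euclidean norm of vectors and the Frobenius norm of matrices. $F_L(x,\theta):=\mathbb{E}_{P_{y|x}(\theta)}[\nabla_z\log p(y|z)\nabla_z\log p(y|z)^\top]|_{z=f(x,\theta)}$. $J^R(x,\theta):=[\mathrm{grad}f_1(x,\theta),\dots,\mathrm{grad}f_q(x,\theta)]^\top\in\mathbb{R}^{q\times r}$ is the Riemannian Jacobian of $f(x,\cdot)$ at $\theta$ ($\mathrm{grad}$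 = Riemannian gradient in $\theta$). $J^R(\theta)\in\mathbb{R}^{Nq\times r}$ is obtained by stacking $J^R(x_1,\theta),\dots,J^R(x_N,\theta)$. $u(\theta)\in\mathbb{R}^{Nq}$ is the stacking of $f(x_1,\theta),\dots,f(x_N,\theta)$; $y\in\mathbb{R}^{Nq}$ is the stacking of $y_1,\dots,y_N$; $\nabla L(u,y)\in\mathbb{R}^{Nq}$ is the stacking of $\nabla_zL(u_i,y_i)$, $i=1,\dots,N$. $H_L(u(\theta))=\mathrm{blkdiag}(H_L(f(x_1,\theta)),\dots,H_L(f(x_N,\theta)))$. The Riemannian Fisher information matrix is taken as $F^R(\theta)=J^R(\theta)^\top H_L(u(\theta))J^R(\theta)$, and, when $J^R(\theta)J^R(\theta)^\top$ is invertible, its pseudo-inverse is $$F^R(\theta)^\dagger=J^R(\theta)^\top(J^R(\theta)J^R(\theta)^\top)^{-1}H_L(u(\theta))^{-1}(J^R(\theta)J^R(\theta)^\top)^{-1}J^R(\theta).$$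
   Formalization: The formal theorem adds that ∇_z L(y_i,y_i)=0 for each label (y_i minimises L(·,y_i)); without it the claim fails, e.g. f(x,θ)=θ, p(·|z)=N(2z,1), y=1, θ⁰=1/2. It also takes f(x_i,·) to be C¹ on M and the exponential map to be defined on the whole tangent bundle. *)

(* Defs.v *)
From HB Require Import structures.
From mathcomp Require Import all_boot all_order all_algebra.
From mathcomp Require Import all_classical all_reals all_analysis.
Import Order.TTheory GRing.Theory Num.Theory numFieldNormedType.Exports.

Set Implicit Arguments.
Unset Strict Implicit.
Unset Printing Implicit Defensive.

Local Open Scope classical_set_scope.
Local Open Scope ring_scope.

(** * Matrices *)

Definition mxdot (R : realType) (m n : nat) (A B : 'M[R]_(m, n)) : R :=
  \sum_(i < m) \sum_(j < n) A i j * B i j.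

(* The library norm of a matrix is the max norm (it gives the same topology);
   quantitative statements use the Frobenius norm, which on 'cV_n is the
   Euclidean norm. *)
Definition frob (R : realType) (m n : nat) (A : 'M[R]_(m, n)) : R :=
  Num.sqrt (mxdot A A).

Definition loewner_le (R : realType) (n : nat) (A B : 'M[R]_n) : Prop :=
  forall v : 'cV[R]_n, 0 <= (v^T *m (B - A) *m v) 0 0.

(* Meaningful for symmetric A of positive size; it is 0 for the empty matrix. *)
Definition lambda_min (R : realType) (n : nat) (A : 'M[R]_n) : R :=
  inf [set a | eigenvalue A a].

(* Moore-Penrose inverse over the reals. *)
Definition is_pinv (R : realType) (m n : nat)
    (A : 'M[R]_(m, n)) (B : 'M[R]_(n, m)) : Prop :=
  [/\ A *m B *m A = A, B *m A *m B = B,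
      (A *m B)^T = A *m B & (B *m A)^T = B *m A].

Definition pinv (R : realType) (m n : nat) (A : 'M[R]_(m, n)) : 'M[R]_(n, m) :=
  xget 0 [set B | is_pinv A B].

Lemma is_pinv_unique (R : realType) (m n : nat) (A : 'M[R]_(m, n)) B C :
  is_pinv A B -> is_pinv A C -> B = C.
Proof.
move=> [AB1 AB2 AB3 AB4] [AC1 AC2 AC3 AC4].
have ABC : A *m B = A *m C.
  have -> : A *m C = A *m B *m (A *m C) by rewrite mulmxA AB1.
  rewrite -{2}AB3 -AC3 -trmx_mul.
  by rewrite mulmxA AC1.
have BCA : B *m A = C *m A.
  have -> : C *m A = C *m A *m (B *m A) by rewrite -mulmxA (mulmxA A) AB1.
  rewrite -AB4 -AC4 -trmx_mul.
  by rewrite -mulmxA (mulmxA A) AC1.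
by rewrite -AB2 BCA -mulmxA ABC mulmxA AC2.
Qed.

Lemma pinv_gram (R : realType) (m n : nat) (J : 'M[R]_(m, n)) (H : 'M[R]_m) :
  J *m J^T \in unitmx -> H \in unitmx ->
  pinv (J^T *m H *m J) =
  J^T *m invmx (J *m J^T) *m invmx H *m invmx (J *m J^T) *m J.
Proof.
move=> uJ uH; set G := invmx (J *m J^T).
set B := RHS; set A := J^T *m H *m J.
have GT : G^T = G by rewrite /G trmx_inv trmx_mul trmxK.
have AB : A *m B = J^T *m G *m J.
  rewrite /A /B -!mulmxA (mulmxA J J^T) (mulmxA (J *m J^T)) mulmxV // mul1mx.
  by rewrite (mulmxA H) mulmxV // mul1mx.
have BA : B *m A = J^T *m G *m J.
  rewrite /A /B -!mulmxA (mulmxA J J^T) (mulmxA G (J *m J^T)) mulVmx // mul1mx.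
  by rewrite (mulmxA (invmx H)) mulVmx // mul1mx.
have PT : (J^T *m G *m J)^T = J^T *m G *m J.
  by rewrite !trmx_mul trmxK GT mulmxA.
have piB : is_pinv A B.
  split; rewrite ?AB ?BA ?PT //.
    by rewrite /A -!mulmxA (mulmxA J J^T) (mulmxA G) mulVmx // mul1mx.
  by rewrite /B -!mulmxA (mulmxA J J^T) (mulmxA G (J *m J^T)) mulVmx // mul1mx.
apply: (is_pinv_unique _ piB).
by apply: (@xgetPex _ 0 [set C | is_pinv A C]); exists B.
Qed.

(* Column-stacking vectorisation of an m x n matrix, and its inverse. *)
Definition vec (R : realType) (m n : nat) (A : 'M[R]_(m, n)) : 'cV[R]_(n * m) :=
  (mxvec A^T)^T.

Definition unvec (R : realType) (m n : nat) (w : 'cV[R]_(n * m)) :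
  'M[R]_(m, n) := (vec_mx w^T)^T.

(** * Smooth maps, gradients and Hessians *)

(* Class C^k on an open set: in finite dimension it is enough to iterate
   directional derivatives in fixed directions. *)
Fixpoint Ck (R : realType) (V W : normedModType R) (k : nat) (U : set V)
    (g : V -> W) : Prop :=
  match k with
  | 0 => forall z, U z -> {for z, continuous g}
  | k'.+1 => (forall z, U z -> differentiable g z) /\
             (forall v : V, Ck k' U ('D_v g))
  end.

Definition smooth_on (R : realType) (V W : normedModType R) (U : set V)
    (g : V -> W) : Prop := forall k, Ck k U g.

Definition gradient (R : realType) (q : nat) (g : 'cV[R]_q -> R)
    (z : 'cV[R]_q) : 'cV[R]_q :=
  \col_(a < q) 'D_(delta_mx a 0) g z.

Definition hessian (R : realType) (q : nat) (g : 'cV[R]_q -> R)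
    (z : 'cV[R]_q) : 'M[R]_q :=
  \matrix_(a < q, b < q) 'D_(delta_mx a 0) ('D_(delta_mx b 0) g) z.

(** * Embedded submanifolds of 'M_(m, n) with the induced metric *)

(* Slice charts: around each point a diffeomorphism phi : U -> V of open sets
   of the ambient space, with inverse psi, sends M to a d-dimensional linear
   subspace. *)
Definition embedded_submanifold (R : realType) (m n d : nat)
    (M : set 'M[R]_(m, n)) : Prop :=
  forall th, M th ->
  exists (U V : set 'M[R]_(m, n)) (phi psi : 'M[R]_(m, n) -> 'M[R]_(m, n))
         (S : {vspace 'M[R]_(m, n)}),
    [/\ open U, open V & U th] /\
    [/\ smooth_on U phi, smooth_on V psi,
        (forall z, U z -> V (phi z) /\ psi (phi z) = z) &
        (forall w, V w -> U (psi w) /\ phi (psi w) = w)] /\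
    \dim S = d /\
    (forall z, U z -> (M z <-> phi z \in S)).

Definition curve_at (R : realType) (m n : nat) (M : set 'M[R]_(m, n))
    (th : 'M[R]_(m, n)) (c : R -> 'M[R]_(m, n)) : Prop :=
  exists I : set R, [/\ open I, I 0, smooth_on I c,
    (forall s, I s -> M (c s)) & c 0 = th].

Definition tangent (R : realType) (m n : nat) (M : set 'M[R]_(m, n))
    (th : 'M[R]_(m, n)) : set 'M[R]_(m, n) :=
  [set v | exists2 c, curve_at M th c & derive1 c 0 = v].

(* The gradient of g at th is the tangent vector G representing the
   differential: (g o c)'(0) = <G, c'(0)> along every curve c through th. *)
Definition is_rgrad (R : realType) (m n : nat) (M : set 'M[R]_(m, n))
    (g : 'M[R]_(m, n) -> R) (th G : 'M[R]_(m, n)) : Prop :=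
  tangent M th G /\
  forall c : R -> 'M[R]_(m, n), curve_at M th c ->
    is_derive (0 : R) (1 : R) (g \o c) (mxdot G (derive1 c 0)).

Definition rgrad (R : realType) (m n : nat) (M : set 'M[R]_(m, n))
    (g : 'M[R]_(m, n) -> R) (th : 'M[R]_(m, n)) : 'M[R]_(m, n) :=
  xget 0 [set G | is_rgrad M g th G].

Definition C1_on_manifold (R : realType) (m n : nat) (M : set 'M[R]_(m, n))
    (g : 'M[R]_(m, n) -> R) : Prop :=
  (forall th, M th -> is_rgrad M g th (rgrad M g th)) /\
  {within M, continuous (rgrad M g)}.

(* For the induced metric, zero covariant acceleration means that the ambient
   acceleration is normal to M. *)
Definition geodesic (R : realType) (m n : nat) (M : set 'M[R]_(m, n))
    (c : R -> 'M[R]_(m, n)) : Prop :=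
  [/\ smooth_on setT c, (forall s, M (c s)) &
      forall s v, tangent M (c s) v -> mxdot (derive1n 2 c s) v = 0].

(* E is defined on the whole tangent bundle (its values elsewhere are
   irrelevant). *)
Definition exponential_map (R : realType) (m n : nat) (M : set 'M[R]_(m, n))
    (E : 'M[R]_(m, n) -> 'M[R]_(m, n) -> 'M[R]_(m, n)) : Prop :=
  forall th v, M th -> tangent M th v ->
  exists c, [/\ geodesic M c, c 0 = th, derive1 c 0 = v & E th v = c 1].

(** * Loss and Fisher information *)

(* R^q with its Borel sigma-algebra *)
Definition labels (R : realType) (q : nat) :=
  g_sigma_algebraType (@open 'cV[R]_q).

(* p y z is the density p(y|z) with respect to a reference measure nu. *)
Definition conditional_density (R : realType) (q : nat)
    (nu : {measure set (labels R q) -> \bar R})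
    (p : labels R q -> 'cV[R]_q -> R) : Prop :=
  forall z, [/\ measurable_fun setT (fun y => p y z),
                (forall y, 0 <= p y z) &
                (\int[nu]_y (p y z)%:E = 1)%E].

Definition loss (R : realType) (q : nat) (p : labels R q -> 'cV[R]_q -> R)
    (z : 'cV[R]_q) (y : labels R q) : R := - ln (p y z).

Definition score (R : realType) (q : nat) (p : labels R q -> 'cV[R]_q -> R)
    (z : 'cV[R]_q) (y : labels R q) : 'cV[R]_q :=
  gradient (fun z' => ln (p y z')) z.

Definition fisher_entry (R : realType) (q : nat)
    (p : labels R q -> 'cV[R]_q -> R) (z : 'cV[R]_q) (a b : 'I_q)
    (y : labels R q) : R :=
  p y z * (score p z y *m (score p z y)^T) a b.

(* The expectation defining the Fisher matrix makes sense. *)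
Definition fisher_defined (R : realType) (q : nat)
    (nu : {measure set (labels R q) -> \bar R})
    (p : labels R q -> 'cV[R]_q -> R) (z : 'cV[R]_q) : Prop :=
  {ae nu, forall y, 0 < p y z -> differentiable (fun z' => ln (p y z')) z} /\
  forall a b, nu.-integrable setT (fun y => (fisher_entry p z a b y)%:E).

Definition fisher (R : realType) (q : nat)
    (nu : {measure set (labels R q) -> \bar R})
    (p : labels R q -> 'cV[R]_q -> R) (z : 'cV[R]_q) : 'M[R]_q :=
  \matrix_(a < q, b < q) Rintegral nu setT (fisher_entry p z a b).

(** * Stacked quantities and the Riemannian natural gradient iteration *)

Definition RJac1 (R : realType) (m n q : nat) (M : set 'M[R]_(m, n))
    (g : 'M[R]_(m, n) -> 'cV[R]_q) (th : 'M[R]_(m, n)) : 'M[R]_(q, n * m) :=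
  \matrix_(a < q) (vec (rgrad M (fun th' => g th' a 0) th))^T.

Definition RJac (R : realType) (X : Type) (m n q N : nat)
    (M : set 'M[R]_(m, n)) (f : X -> 'M[R]_(m, n) -> 'cV[R]_q)
    (x : 'I_N -> X) (th : 'M[R]_(m, n)) : 'M[R]_(\sum_(i < N) q, n * m) :=
  \mxcol_(i < N) RJac1 M (f (x i)) th.

Definition outputs (R : realType) (X : Type) (m n q N : nat)
    (f : X -> 'M[R]_(m, n) -> 'cV[R]_q) (x : 'I_N -> X) (th : 'M[R]_(m, n)) :
    'cV[R]_(\sum_(i < N) q) :=
  \mxcol_(i < N) f (x i) th.

Definition residual (R : realType) (X : Type) (m n q N : nat)
    (f : X -> 'M[R]_(m, n) -> 'cV[R]_q) (x : 'I_N -> X)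
    (y : 'I_N -> 'cV[R]_q) (th : 'M[R]_(m, n)) : R :=
  frob (outputs f x th - \mxcol_(i < N) y i).

Definition grad_loss (R : realType) (X : Type) (m n q N : nat)
    (p : labels R q -> 'cV[R]_q -> R) (f : X -> 'M[R]_(m, n) -> 'cV[R]_q)
    (x : 'I_N -> X) (y : 'I_N -> 'cV[R]_q) (th : 'M[R]_(m, n)) :
    'cV[R]_(\sum_(i < N) q) :=
  \mxcol_(i < N) gradient (fun z => loss p z (y i)) (f (x i) th).

Definition RFisher (R : realType) (X : Type) (m n q N : nat)
    (M : set 'M[R]_(m, n)) (H_L : 'cV[R]_q -> 'M[R]_q)
    (f : X -> 'M[R]_(m, n) -> 'cV[R]_q) (x : 'I_N -> X) (th : 'M[R]_(m, n)) :
    'M[R]_(n * m) :=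
  (RJac M f x th)^T *m (\mxdiag_(i < N) H_L (f (x i) th)) *m RJac M f x th.

Definition RNG_direction (R : realType) (X : Type) (m n q N : nat)
    (M : set 'M[R]_(m, n)) (p : labels R q -> 'cV[R]_q -> R)
    (H_L : 'cV[R]_q -> 'M[R]_q) (f : X -> 'M[R]_(m, n) -> 'cV[R]_q)
    (x : 'I_N -> X) (y : 'I_N -> 'cV[R]_q) (th : 'M[R]_(m, n)) :
    'M[R]_(m, n) :=
  unvec (pinv (RFisher M H_L f x th) *m (RJac M f x th)^T
         *m grad_loss p f x y th).

Definition RNG_iterates (R : realType) (X : Type) (m n q N : nat)
    (M : set 'M[R]_(m, n)) (E : 'M[R]_(m, n) -> 'M[R]_(m, n) -> 'M[R]_(m, n))
    (p : labels R q -> 'cV[R]_q -> R)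
    (H_L : 'cV[R]_q -> 'M[R]_q) (f : X -> 'M[R]_(m, n) -> 'cV[R]_q)
    (x : 'I_N -> X) (y : 'I_N -> 'cV[R]_q) (t : R) (th0 : 'M[R]_(m, n))
    (th : nat -> 'M[R]_(m, n)) : Prop :=
  th 0%N = th0 /\
  forall k, th k.+1 = E (th k) (- (t *: RNG_direction M p H_L f x y (th k))).

Definition sigma0 (R : realType) (X : Type) (m n q N : nat)
    (M : set 'M[R]_(m, n)) (f : X -> 'M[R]_(m, n) -> 'cV[R]_q)
    (x : 'I_N -> X) (th0 : 'M[R]_(m, n)) : R :=
  Num.sqrt (lambda_min (RJac M f x th0 *m (RJac M f x th0)^T)).

(* e is the initial residual; 1 / (6 e) is read as +oo when e = 0. *)
Definition step_bound (R : realType) (mu kL kH kR s0 e : R) : R :=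
  if e == 0 then 1 else
  Num.min 1 ((1 / (6 * e) - kH / (2 * mu))
             * ((3 * mu ^+ 2 * s0) / (8 * kR * kL ^+ 2))).

Definition linear_rate (R : realType) (X : Type) (m n q N : nat)
    (M : set 'M[R]_(m, n)) (E : 'M[R]_(m, n) -> 'M[R]_(m, n) -> 'M[R]_(m, n))
    (p : labels R q -> 'cV[R]_q -> R)
    (H_L : 'cV[R]_q -> 'M[R]_q) (f : X -> 'M[R]_(m, n) -> 'cV[R]_q)
    (x : 'I_N -> X) (y : 'I_N -> 'cV[R]_q) (mu kL kH : R)
    (th0 : 'M[R]_(m, n)) (kR : R) : Prop :=
  residual f x y th0 < mu / (3 * kH) ->
  forall (t : R) (th : nat -> 'M[R]_(m, n)),
    0 < t ->
    t <= step_bound mu kL kH kR (sigma0 M f x th0) (residual f x y th0) ->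
    RNG_iterates M E p H_L f x y t th0 th ->
    forall k : nat,
      residual f x y (th k.+1) <= (1 - t / 2) * residual f x y (th k).

(* Main.v *)
(** Write [e] for the error [u - y] and [J] for the Riemannian Jacobian. Since the
  Hessian is Lipschitz and the gradient of the loss vanishes at the label, the
  natural gradient direction [d] satisfies [|J d - e| <= kH / mu |e|^2], and the
  stability of [J] gives [|d| <= 8 / (5 sigma0) |e|]. Along the geodesic
  [c] with [c' 0 = - t d] the error changes by the integral of [J (c s) (c' s)],
  whence [|e(c 1)| <= (1 - t) |e| + t kH / mu |e|^2 + B], where [B] measures the
  variation of [J (c s) (c' s)] over [0 <= s <= 1]. The contraction of the error
  bounds the total length of the iteration, so all geodesics involved stay in a
  fixed set of points reachable from [theta0] by paths of bounded length.

  The constants must be uniform on that set, so its closure has to be a compact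
  subset of [M]. This is the Hopf-Rinow theorem, the exponential map being defined
  on all of the tangent bundle. Chains of points of [M] minimising the energy are
  discrete geodesics: their second differences are normal to [M]. Writing [M]
  locally as the zero set of a map [F] with [ker dF] tangent to [M], the second
  difference [w] of a sequence in [M] has [dF w] controlled by squares of its
  increments, so two sequences with normal second differences satisfy a discrete
  Gronwall inequality. Hence fine discrete geodesics are close to the genuine
  geodesic with the same start, which does not leave [M]. On the compact set the
  accelerations of geodesics are at most a constant times the squared speed and [J]
  is uniformly continuous (or Lipschitz), which makes [B] a small multiple of
  [t |e|] for short steps (or of order [|e|^2]). *)
Require Import Defs.
From HB Require Import structures.
From mathcomp Require Import all_boot all_order all_algebra.
From mathcomp Require Import all_classical all_reals all_analysis.
From mathcomp Require Import ring lra.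
Import Order.TTheory GRing.Theory Num.Theory numFieldNormedType.Exports.
Local Open Scope classical_set_scope.
Local Open Scope ring_scope.
Set Implicit Arguments.
Unset Strict Implicit.
Unset Printing Implicit Defensive.

Local Ltac mx_ring := by apply/matrixP => ? ?; rewrite !mxE; ring.

(** * Frobenius geometry *)

Lemma le_of_sqr_le_mul {R : realDomainType} (a x : R) :
  0 <= a -> x ^+ 2 <= a * x -> x <= a.
Proof.
move=> a0; case: (leP x a) => // ax.
by rewrite expr2 ler_pM2r ?(le_lt_trans a0)// leNgt ax.
Qed.

Section frobenius.
Context {R : realType} {m n : nat}.
Implicit Types A B C : 'M[R]_(m, n).

Lemma mxdotC A B : mxdot A B = mxdot B A.
Proof.
by apply: eq_bigr => i _; apply: eq_bigr => j _; rewrite mulrC.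
Qed.

Lemma mxdotDl A B C : mxdot (A + B) C = mxdot A C + mxdot B C.
Proof.
rewrite /mxdot -big_split; apply: eq_bigr => i _ /=; rewrite -big_split.
by apply: eq_bigr => j _ /=; rewrite mxE mulrDl.
Qed.

Lemma mxdotZl k A B : mxdot (k *: A) B = k * mxdot A B.
Proof.
rewrite /mxdot mulr_sumr; apply: eq_bigr => i _; rewrite mulr_sumr.
by apply: eq_bigr => j _ /=; rewrite mxE mulrA.
Qed.

Lemma mxdotNl A B : mxdot (- A) B = - mxdot A B.
Proof. by rewrite -scaleN1r mxdotZl mulN1r. Qed.

Lemma mxdotBl A B C : mxdot (A - B) C = mxdot A C - mxdot B C.
Proof. by rewrite mxdotDl mxdotNl. Qed.

Lemma mxdotDr A B C : mxdot A (B + C) = mxdot A B + mxdot A C.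
Proof. by rewrite mxdotC mxdotDl mxdotC (mxdotC C). Qed.

Lemma mxdotZr k A B : mxdot A (k *: B) = k * mxdot A B.
Proof. by rewrite mxdotC mxdotZl mxdotC. Qed.

Lemma mxdotNr A B : mxdot A (- B) = - mxdot A B.
Proof. by rewrite mxdotC mxdotNl mxdotC. Qed.

Lemma mxdotBr A B C : mxdot A (B - C) = mxdot A B - mxdot A C.
Proof. by rewrite mxdotDr mxdotNr. Qed.

Lemma mxdot0l A : mxdot 0 A = 0.
Proof. by rewrite -(scale0r (0 : 'M[R]_(m, n))) mxdotZl mul0r. Qed.

Lemma mxdot0r A : mxdot A 0 = 0.
Proof. by rewrite mxdotC mxdot0l. Qed.

Lemma mxdot_ge0 A : 0 <= mxdot A A.
Proof.
by apply: sumr_ge0 => i _; apply: sumr_ge0 => j _; rewrite -expr2 sqr_ge0.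
Qed.

Lemma sqr_frob A : frob A ^+ 2 = mxdot A A.
Proof. by rewrite /frob sqr_sqrtr// mxdot_ge0. Qed.

Lemma frob_ge0 A : 0 <= frob A.
Proof. exact: sqrtr_ge0. Qed.

Lemma coord_le_frob A i j : `|A i j| <= frob A.
Proof.
rewrite -sqrtr_sqr; apply: ler_wsqrtr; rewrite /mxdot (bigD1 i)//=.
rewrite (bigD1 j)//= -expr2 -addrA lerDl addr_ge0//.
  by apply: sumr_ge0 => k _; rewrite -expr2 sqr_ge0.
by apply: sumr_ge0 => k _; apply: sumr_ge0 => l _; rewrite -expr2 sqr_ge0.
Qed.

Lemma frob0 : frob (0 : 'M[R]_(m, n)) = 0.
Proof. by rewrite /frob mxdot0l sqrtr0. Qed.

Lemma frob_eq0 A : (frob A == 0) = (A == 0).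
Proof.
apply/eqP/eqP => [A0|->]; last exact: frob0.
apply/matrixP => i j; rewrite mxE; apply/eqP.
by rewrite -normr_le0 -A0 coord_le_frob.
Qed.

Lemma frob_gt0 A : (0 < frob A) = (A != 0).
Proof. by rewrite lt_def frob_ge0 frob_eq0 andbT. Qed.

Lemma frob_small_eq0 A : (forall e : R, 0 < e -> frob A <= e) -> A = 0.
Proof.
move=> Ae; apply/eqP; rewrite -frob_eq0 eq_le frob_ge0 andbT.
by apply/ler_addgt0Pr => e e0; rewrite add0r Ae.
Qed.

Lemma frobZ k A : frob (k *: A) = `|k| * frob A.
Proof.
by rewrite /frob mxdotZl mxdotZr mulrA -expr2 sqrtrM ?sqr_ge0// sqrtr_sqr.
Qed.

Lemma frobN A : frob (- A) = frob A.
Proof. by rewrite -scaleN1r frobZ normrN1 mul1r. Qed.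

Lemma frob_distC A B : frob (A - B) = frob (B - A).
Proof. by rewrite -frobN opprB. Qed.

Lemma mxdot_le A B : mxdot A B <= frob A * frob B.
Proof.
have [->|B0] := eqVneq B 0; first by rewrite mxdot0r frob0 mulr0.
have b0 : 0 < mxdot B B by rewrite -sqr_frob exprn_gt0// frob_gt0.
have := mxdot_ge0 (mxdot B B *: A - mxdot A B *: B).
rewrite mxdotBl !mxdotBr !mxdotZl !mxdotZr (mxdotC B A).
set a := mxdot A A; set b := mxdot B B in b0 *; set s := mxdot A B => disc_ge0.
have sab : s ^+ 2 <= a * b.
  by rewrite -(@ler_pM2l _ b)// -subr_ge0; move: disc_ge0; congr (_ <= _); ring.
apply: le_trans (ler_norm _) _.
by rewrite -sqrtr_sqr /frob -sqrtrM ?mxdot_ge0// ler_wsqrtr.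
Qed.

Lemma normr_mxdot_le A B : `|mxdot A B| <= frob A * frob B.
Proof.
by rewrite ler_norml mxdot_le andbT lerNl -mxdotNl -(frobN A) mxdot_le.
Qed.

Lemma frob_le_mxdot A (K : R) : 0 <= K -> mxdot A A <= K * frob A -> frob A <= K.
Proof. by rewrite -sqr_frob; exact: le_of_sqr_le_mul. Qed.

Lemma frobD A B : frob (A + B) <= frob A + frob B.
Proof.
rewrite -(@ler_pXn2r _ 2%N)// ?nnegrE ?addr_ge0 ?frob_ge0//.
rewrite sqr_frob mxdotDl !mxdotDr -!sqr_frob (mxdotC B A).
have := mxdot_le A B; lra.
Qed.

Lemma frobB A B : frob (A - B) <= frob A + frob B.
Proof. by rewrite -(frobN B) frobD. Qed.

Lemma frob_dist_triangle B A C : frob (A - C) <= frob (A - B) + frob (B - C).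
Proof. by have := frobD (A - B) (B - C); rewrite subrKA. Qed.

Lemma frob_le_distD A B : frob A <= frob B + frob (A - B).
Proof. by rewrite -{1}(subrKC B A) frobD. Qed.

Lemma frob_dist_dist A B : `|frob A - frob B| <= frob (A - B).
Proof.
rewrite ler_norml lerBlDl frob_le_distD andbT lerNl opprB lerBlDl.
by rewrite frob_distC frob_le_distD.
Qed.

Lemma mxdot_tr A B : mxdot A^T B^T = mxdot A B.
Proof.
rewrite /mxdot exchange_big; apply: eq_bigr => i _.
by apply: eq_bigr => j _; rewrite !mxE.
Qed.

Lemma frob_tr A : frob A^T = frob A.
Proof. by rewrite /frob mxdot_tr. Qed.

Lemma frob_sum_le I (r : seq I) (F : I -> 'M[R]_(m, n)) :
  frob (\sum_(i <- r) F i) <= \sum_(i <- r) frob (F i).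
Proof.
elim/big_ind2 : _ => //; first by rewrite frob0.
by move=> x a y b xa yb; apply: le_trans (frobD _ _) (lerD xa yb).
Qed.

Lemma frob_delta_mx i j : frob (delta_mx i j : 'M[R]_(m, n)) = 1.
Proof.
rewrite /frob /mxdot (bigD1 i)//= (bigD1 j)//= mxE !eqxx mulr1.
rewrite big1 ?addr0 => [|k kj]; last by rewrite mxE (negbTE kj) andbF mul0r.
rewrite big1 ?addr0 ?sqrtr1// => k ki.
by rewrite big1// => l _; rewrite mxE (negbTE ki) mul0r.
Qed.

Lemma mx_norm_le_frob A : `|A| <= frob A.
Proof.
rewrite [leLHS]/Num.Def.normr/= mx_normrE; apply: bigmax_le; first exact: frob_ge0.
by move=> i _; exact: coord_le_frob.
Qed.

End frobenius.

Lemma frob_linear_le {R : realType} {m n k l : nat}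
    (L : {linear 'M[R]_(m, n) -> 'M[R]_(k, l)}) (C : R) :
  (forall i j, frob (L (delta_mx i j)) <= C) ->
  forall v, frob (L v) <= (m * n)%:R * C * frob v.
Proof.
move=> LC v; rewrite {1}(matrix_sum_delta v) linear_sum.
apply: le_trans (frob_sum_le _ _) _.
rewrite natrM -!mulrA -[m in m%:R]card_ord -sumr_const mulr_suml.
apply: ler_sum => i _; rewrite linear_sum; apply: le_trans (frob_sum_le _ _) _.
rewrite mul1r -[n in n%:R]card_ord -sumr_const mulr_suml.
apply: ler_sum => j _; rewrite linearZ/= mul1r frobZ mulrC.
by rewrite ler_pM ?frob_ge0 ?coord_le_frob.
Qed.

Lemma frob_linearB_le {R : realType} {m n k l : nat}
    (L L' : {linear 'M[R]_(m, n) -> 'M[R]_(k, l)}) (C : R) :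
  (forall i j, frob (L (delta_mx i j) - L' (delta_mx i j)) <= C) ->
  forall v, frob (L v - L' v) <= (m * n)%:R * C * frob v.
Proof. exact: (@frob_linear_le _ _ _ _ _ (L \- L')). Qed.

Lemma frob_mulmx {R : realType} {m n p : nat}
    (A : 'M[R]_(m, n)) (B : 'M[R]_(n, p)) :
  frob (A *m B) <= frob A * frob B.
Proof.
rewrite -(@ler_pXn2r _ 2%N)// ?nnegrE ?mulr_ge0 ?frob_ge0//.
rewrite exprMn !sqr_frob {1 2}/mxdot mulr_suml; apply: ler_sum => i _.
have -> : (\sum_(j < n) A i j * A i j) = mxdot (row i A) (row i A).
  by rewrite /mxdot big_ord1; apply: eq_bigr => j _; rewrite mxE.
have -> : mxdot B B = \sum_(k < p) mxdot (col k B)^T (col k B)^T.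
  rewrite /mxdot exchange_big; apply: eq_bigr => k _.
  by rewrite big_ord1; apply: eq_bigr => j _; rewrite !mxE.
rewrite mulr_sumr; apply: ler_sum => k _; rewrite -!sqr_frob -exprMn.
have -> : (A *m B) i k = mxdot (row i A) (col k B)^T.
  by rewrite mxE /mxdot big_ord1; apply: eq_bigr => j _; rewrite !mxE.
rewrite -expr2 -real_normK ?num_real//.
by rewrite ler_pXn2r ?nnegrE ?mulr_ge0 ?frob_ge0// normr_mxdot_le.
Qed.

Lemma near_continuous {T U : topologicalType} (f : T -> U) x (P : set U) :
  {for x, continuous f} -> nbhs (f x) P -> \forall y \near x, P (f y).
Proof. by move=> fc; exact: fc. Qed.

Section frobenius_topology.
Context {R : realType} {m n : nat}.
Implicit Types (x y z : 'M[R]_(m, n)) (P : set 'M[R]_(m, n)).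

Definition fball z (r : R) : set 'M[R]_(m, n) := [set x | frob (x - z) < r].

Lemma fball_center z (r : R) : 0 < r -> fball z r z.
Proof. by rewrite /fball/= subrr frob0. Qed.

Lemma fball_segment z x a (r s : R) : fball z r x -> fball z r (x + a) ->
  0 <= s <= 1 -> fball z r (x + s *: a).
Proof.
rewrite /fball/= => xz xaz /andP[s0 s1].
have -> : x + s *: a - z = (1 - s) *: (x - z) + s *: (x + a - z) by mx_ring.
apply: le_lt_trans (frobD _ _) _; rewrite !frobZ !ger0_norm ?subr_ge0//.
have [->|s_neq0] := eqVneq s 0; first by rewrite subr0 mul1r mul0r addr0.
have {s0 s_neq0} s0 : 0 < s by rewrite lt_def s_neq0.
rewrite [ltRHS](_ : r = (1 - s) * r + s * r); last by ring.
by rewrite ler_ltD// ?ltr_pM2l// ler_wpM2l ?subr_ge0// ltW.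
Qed.

Lemma frob_le_mx_norm x : frob x <= (m * n)%:R * `|x|.
Proof.
rewrite {1}(matrix_sum_delta x); apply: le_trans (frob_sum_le _ _) _.
rewrite natrM -mulrA -[m in m%:R]card_ord -sumr_const mulr_suml.
apply: ler_sum => i _; apply: le_trans (frob_sum_le _ _) _.
rewrite mul1r -[n in n%:R]card_ord -sumr_const mulr_suml.
apply: ler_sum => j _; rewrite mul1r frobZ frob_delta_mx mulr1.
rewrite [leRHS]/Num.Def.normr/= mx_normrE.
by apply/bigmax_geP; right; exists (i, j).
Qed.

Lemma nbhs_fballP z P : nbhs z P <-> exists2 r : R, 0 < r & fball z r `<=` P.
Proof.
split=> [/nbhs_normP[r /= r0 rP]|[r r0 rP]].
  exists r => // x xz; apply: rP => /=; rewrite distrC.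
  exact: le_lt_trans (mx_norm_le_frob _) xz.
apply/(nbhs_normP z P); have k0 : 0 < (m * n)%:R + 1 :> R by rewrite ltr_wpDl.
exists (r / ((m * n)%:R + 1)); first by rewrite /= divr_gt0.
move=> x /=; rewrite distrC ltr_pdivlMr// => xz; apply: rP.
apply: le_lt_trans (frob_le_mx_norm _) _; apply: le_lt_trans xz.
by rewrite mulrC ler_wpM2l// lerDl.
Qed.

Lemma fball_open z (r : R) : open (fball z r).
Proof.
rewrite openE => x xz; apply/nbhs_fballP; exists (r - frob (x - z)) => [|y].
  by rewrite subr_gt0.
by rewrite /fball/= ltrBrDr; exact: le_lt_trans (frob_dist_triangle _ _ _).
Qed.

Lemma nbhs_fball z (r : R) : 0 < r -> nbhs z (fball z r).
Proof. by move=> r0; apply/nbhs_fballP; exists r. Qed.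

Lemma near_fball z P : nbhs z P -> \forall r \near 0^'+, fball z r `<=` P.
Proof.
move=> /nbhs_fballP[r r0 rP]; near=> s => x xz; apply: rP.
by apply: lt_le_trans xz _; near: s; exact: nbhs_right_le.
Unshelve. all: by end_near. Qed.

Lemma continuous_fballP {T : topologicalType} (f : T -> 'M[R]_(m, n)) t :
  {for t, continuous f} <->
  forall e : R, 0 < e -> \forall s \near t, fball (f t) e (f s).
Proof.
split=> [fc e e0|fe P /nbhs_fballP[r r0 rP]]; first exact: fc (nbhs_fball _ e0).
by apply: filterS (fe r r0) => s; exact: rP.
Qed.

Lemma frob_continuous : continuous (@frob R m n).
Proof.
move=> x P /nbhs_normP[e /= e0 eP]; apply/nbhs_fballP; exists e => // y yx.
by apply: eP; rewrite /= distrC; exact: le_lt_trans (frob_dist_dist _ _) yx.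
Qed.

Lemma closed_frob_le (B : R) : closed [set x : 'M[R]_(m, n) | frob x <= B].
Proof.
have frob_preimage := @preimage_closed 'M[R]_(m, n) R (@frob R m n) [set b | b <= B].
apply: frob_preimage; last exact: closed_le.
by move=> x _; exact: frob_continuous.
Qed.

End frobenius_topology.

Lemma lipschitz_continuous {R : realType} {m n k l : nat}
    (f : 'M[R]_(m, n) -> 'M[R]_(k, l)) (K : R) :
  (forall x y, frob (f x - f y) <= K * frob (x - y)) -> continuous f.
Proof.
move=> fK x; apply/continuous_fballP => e e0.
have K0 : 0 < `|K| + 1 by rewrite ltr_wpDl.
apply/nbhs_fballP; exists (e / (`|K| + 1)) => [|y]; first by rewrite divr_gt0.
rewrite /fball/= => yx.
apply: le_lt_trans (fK _ _) _; apply: (@le_lt_trans _ _ ((`|K| + 1) * frob (y - x))).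
  by rewrite ler_wpM2r ?frob_ge0// ler_wpDr// ler_norm.
by rewrite mulrC -ltr_pdivlMr.
Qed.

Lemma linear_mx_continuous {R : realType} {m n k l : nat}
    (L : {linear 'M[R]_(m, n) -> 'M[R]_(k, l)}) : continuous L.
Proof.
pose C := \sum_i \sum_j frob (L (delta_mx i j)).
apply: (@lipschitz_continuous _ _ _ _ _ _ ((m * n)%:R * C)) => x y.
rewrite -linearB; apply: frob_linear_le => i j.
have row_ge0 i' : 0 <= \sum_j' frob (L (delta_mx i' j')).
  by apply: sumr_ge0 => j' _; exact: frob_ge0.
apply: le_trans (_ : \sum_j' frob (L (delta_mx i j')) <= _).
  by rewrite (bigD1 j)//= lerDl sumr_ge0// => j' _; exact: frob_ge0.
by rewrite /C (bigD1 i)//= lerDl sumr_ge0.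
Qed.

(** * Calculus along curves *)

Section calculus.
Context {R : realType} {V : normedModType R} {m n : nat}.
Implicit Types (f g : V -> 'M[R]_(m, n)).

Lemma is_derive_mxP f x v df :
  is_derive x v f df <-> forall i j, is_derive x v (fun y => f y i j) (df i j).
Proof.
split=> [[fD fv] i j|fD].
  split; first by move/derivable_mxP : fD; exact.
  by rewrite -fv derive_mx// mxE.
have dvf : derivable f x v by apply/derivable_mxP => i j; case: (fD i j).
split=> //; rewrite derive_mx//; apply/matrixP => i j; rewrite mxE.
by case: (fD i j).
Qed.

Lemma is_derive_mxdot f g x v df dg :
  is_derive x v f df -> is_derive x v g dg ->
  is_derive x v (fun y => mxdot (f y) (g y)) (mxdot df (g x) + mxdot (f x) dg).
Proof.
move=> /is_derive_mxP fD /is_derive_mxP gD.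
have -> : (fun y => mxdot (f y) (g y)) =
    \sum_(i < m) \sum_(j < n) ((fun y => f y i j) * (fun y => g y i j)).
  by apply/funext => y; rewrite fct_sumE; apply: eq_bigr => i _; rewrite fct_sumE.
have fgD i j := is_deriveM (fD i j) (gD i j).
have := is_derive_sum (fun i => is_derive_sum (fgD i)).
move=> /is_derive_eq; apply.
rewrite addrC /mxdot -big_split; apply: eq_bigr => i _ /=.
rewrite -big_split; apply: eq_bigr => j _ /=.
by congr (_ + _); rewrite /GRing.scale/= mulrC.
Qed.

End calculus.

(* Reduces to the scalar mean value theorem for [s |-> <g s, g b - g a>]. *)
Lemma frob_mean_value {R : realType} {m n : nat} (g dg : R -> 'M[R]_(m, n))
    (a b K : R) : a <= b ->
  (forall s, a <= s <= b -> is_derive s 1 g (dg s)) ->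
  (forall s, a <= s <= b -> frob (dg s) <= K) ->
  frob (g b - g a) <= K * (b - a).
Proof.
move=> ab gD dgK; pose u := g b - g a.
have guD s : a <= s <= b ->
    is_derive s 1 (fun s => mxdot (g s) u) (mxdot (dg s) u).
  move=> /gD gs; have := is_derive_mxdot gs (is_derive_cst u s 1).
  by rewrite mxdot0r addr0.
have [c cab guE] : exists2 c, c \in `[a, b]%R &
    mxdot (g b) u - mxdot (g a) u = mxdot (dg c) u * (b - a).
  apply: (@MVT_segment R (fun s => mxdot (g s) u) (fun s => mxdot (dg s) u)) => //.
    by move=> s; rewrite in_itv/= => /andP[/ltW ? /ltW ?]; apply: guD; apply/andP.
  apply: derivable_within_continuous => s; rewrite in_itv/= => sab.
  by case: (guD s sab).
have K0 : 0 <= K by apply: le_trans (frob_ge0 _) (dgK a _); rewrite lexx.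
apply: frob_le_mxdot; first by rewrite mulr_ge0 ?subr_ge0.
rewrite -/u {1}/u mxdotBl guE mulrAC ler_wpM2r ?subr_ge0//.
apply: le_trans (mxdot_le _ _) _; rewrite ler_wpM2r ?frob_ge0//.
by apply: dgK; rewrite in_itv in cab.
Qed.

Lemma is_derive_frob_le {R : realType} {m n : nat} (g : R -> 'M[R]_(m, n)) (s : R) dg (K : R) :
  is_derive s (1 : R) g dg ->
  (\forall t \near s, frob (g t - g s) <= K * `|t - s|) -> frob dg <= K.
Proof.
move=> [gd gE] gK.
have {gd gE} quotient : h^-1 *: ((g \o shift s) (h *: (1 : R)) - g s) @[h --> 0^'] --> dg.
  by rewrite -gE; exact: gd.
apply: (closed_cvg _ (@closed_frob_le R m n K) _ _ quotient).
have gK0 : \forall h \near (0:R), frob (g (h + s) - g s) <= K * `|h|.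
  move: gK; rewrite (near_shift 0 s) subr0; apply: filterS => h /=.
  by rewrite addrK.
near=> h.
have h0 : h != 0 by near: h; exact: nbhs_dnbhs_neq.
rewrite /GRing.scale/= mulr1 frobZ normfV ler_pdivrMl ?normr_gt0// mulrC.
near: h; exact: nbhs_dnbhs.
Unshelve. all: by end_near. Qed.

Lemma frob_mean_value01 {R : realType} {m n : nat} (g dg : R -> 'M[R]_(m, n)) (K : R) :
  (forall s : R, 0 <= s <= 1 -> is_derive s 1 g (dg s)) ->
  (forall s, 0 <= s <= 1 -> frob (dg s) <= K) -> frob (g 1 - g 0) <= K.
Proof. by move=> gD /(frob_mean_value ler01 gD); rewrite subr0 mulr1. Qed.

Section smooth_maps.
Context {R : realType} {V W : normedModType R}.
Implicit Types (g h : V -> W) (U : set V).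

Lemma smooth_on_differentiable U h x :
  smooth_on U h -> U x -> differentiable h x.
Proof. by move=> /(_ 1%N)[hU _]; exact: hU. Qed.

Lemma smooth_on_derive U h v : smooth_on U h -> smooth_on U ('D_v h).
Proof. by move=> hU k; case: (hU k.+1) => _; exact. Qed.

Lemma smooth_on_continuous U h x : smooth_on U h -> U x -> {for x, continuous h}.
Proof. by move=> /(_ 0%N); exact. Qed.

Lemma is_derive_chain h (c : R -> V) (s : R) v :
  is_derive s (1 : R) c v -> differentiable h (c s) ->
  is_derive s (1 : R) (h \o c) ('D_v h (c s)).
Proof.
move=> [cD cv] hD; have cd : differentiable c s by apply/derivable1_diffP.
have hcd : differentiable (h \o c) s by exact: differentiable_comp.
split; first exact/diff_derivable.
by rewrite deriveE// diff_comp//= -[X in 'd h _ X]deriveE// cv deriveE.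
Qed.

Lemma is_derive_scale (a : V) (s : R) :
  is_derive s (1 : R) (fun s : R => s *: a) a.
Proof.
have dl : differentiable (fun s : R => s *: a) s by [].
by split; [exact/diff_derivable|rewrite deriveE// diff_val scale1r].
Qed.

Lemma is_derive_line (x a : V) (s : R) :
  is_derive s (1 : R) (fun s : R => x + s *: a) a.
Proof.
by have := is_deriveD (is_derive_cst x s (1 : R)) (is_derive_scale a s); rewrite add0r.
Qed.

Lemma line_continuous (x a : V) : continuous (fun s : R => x + s *: a).
Proof.
move=> s; apply: differentiable_continuous; apply/derivable1_diffP.
by case: (is_derive_line x a s).
Qed.

Lemma is_derive_along_line h x a (s : R) : differentiable h (x + s *: a) ->
  is_derive s (1 : R) (fun s : R => h (x + s *: a)) ('D_a h (x + s *: a)).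
Proof. exact: is_derive_chain (is_derive_line x a s). Qed.

Lemma derive_linear h x : differentiable h x ->
  exists L : {linear V -> W}, forall v, 'D_v h x = L v.
Proof. by move=> hx; exists ('d h x) => v; rewrite deriveE. Qed.

Lemma derive_dirD h x a b : differentiable h x ->
  'D_(a + b) h x = 'D_a h x + 'D_b h x.
Proof. by move=> hx; rewrite !deriveE// linearD. Qed.

Lemma derive_dirZ h x k a : differentiable h x -> 'D_(k *: a) h x = k *: 'D_a h x.
Proof. by move=> hx; rewrite !deriveE// linearZ. Qed.

Lemma derive_dirB h x a b : differentiable h x ->
  'D_(a - b) h x = 'D_a h x - 'D_b h x.
Proof. by move=> hx; rewrite !deriveE// linearB. Qed.

End smooth_maps.

Lemma near_eq_differentiable {R : numFieldType} {V W : normedModType R}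
    (g h : V -> W) (x : V) :
  (\near x, g x = h x) -> differentiable g x -> differentiable h x.
Proof.
move=> gh /diff_locallyP[dgc dgE]; have ghx : g x = h x := nbhs_singleton gh.
have hE : h \o shift x = cst (h x) + 'd g x +o_ 0 id.
  apply/eqaddoP => _/posnumP[e]; move/eqaddoP : dgE => /(_ e%:num (gt0 e)).
  move: gh; rewrite (near_shift 0 x) subr0; apply: filterS2 => t /= ght.
  by rewrite -ghx !fctE /= ght.
have hgx : 'd h x = 'd g x :> (V -> W) by exact: diff_unique hE.
by apply/diff_locallyP; rewrite hgx.
Qed.

Lemma eq_Ck {R : realType} {V W : normedModType R} k (U : set V) (g h : V -> W) : open U ->
  (forall x, U x -> g x = h x) -> Ck k U g -> Ck k U h.
Proof.
move=> oU; elim: k g h => [|k IH] g h gh;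
  have {}ghn x : U x -> \near x, g x = h x
    by move=> Ux; apply: filterS (open_nbhs_nbhs (conj oU Ux)) => y /gh.
  move=> gc x Ux; rewrite /prop_for /continuous_at -(gh x Ux).
  apply: cvg_trans (gc x Ux); apply: near_eq_cvg.
  by apply: filterS (ghn x Ux) => y /= ->.
move=> [gd gD]; split=> [x Ux|v].
  exact: near_eq_differentiable (ghn x Ux) (gd x Ux).
by apply: IH (gD v) => x Ux; apply: near_eq_derive; exact: ghn.
Qed.

Section smooth_composition.
Context {R : realType} {V W : normedModType R}.

Lemma derive_linear_comp {Z : normedModType R} (L : {linear W -> Z}) (h : V -> W) x v :
  continuous L -> differentiable h x -> 'D_v (L \o h) x = L ('D_v h x).
Proof.
move=> Lc hx; have Ld := linear_differentiable (h x) Lc.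
have Lhx : differentiable (L \o h) x by exact: differentiable_comp.
by rewrite !deriveE// diff_comp//= diff_lin.
Qed.

Lemma smooth_on_linear_comp {Z : normedModType R} (L : {linear W -> Z})
    (U : set V) (h : V -> W) :
  open U -> continuous L -> smooth_on U h -> smooth_on U (L \o h).
Proof.
move=> oU Lc hU k; elim: k h hU => [|k IH] h hU.
  move=> x Ux; apply: continuous_comp; first exact: smooth_on_continuous hU Ux.
  exact: Lc.
have hd x : U x -> differentiable h x by exact: smooth_on_differentiable.
split=> [x Ux|v].
  by apply: differentiable_comp (hd x Ux) _; exact: linear_differentiable.
apply: (@eq_Ck _ _ _ _ _ (L \o 'D_v h) _ oU) => [x Ux|].
  by rewrite derive_linear_comp//; exact: hd.
exact/IH/smooth_on_derive.
Qed.

Lemma smooth_on_line (U : set V) (h : V -> W) (w a : V) :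
  open U -> smooth_on U h ->
  smooth_on [set s : R | U (w + s *: a)] (fun s => h (w + s *: a)).
Proof.
move=> oU hU k; pose I := [set s : R | U (w + s *: a)].
have oI : open I.
  have lc : continuous (fun s : R => w + s *: a) by exact: line_continuous.
  exact: ((continuousP _).1 lc _ oU).
elim: k h hU => [|k IH] h hU.
  move=> s Is; apply: (@continuous_comp _ _ _ (fun s : R => w + s *: a) h).
    exact: line_continuous.
  exact: smooth_on_continuous hU Is.
have hd s : I s -> differentiable h (w + s *: a).
  by move=> Is; exact: smooth_on_differentiable hU Is.
have lineD s : I s -> differentiable (fun s : R => h (w + s *: a)) s.
  by move=> Is; apply/derivable1_diffP; case: (is_derive_along_line (hd s Is)).
split=> [s|v]; first exact: lineD.
apply: (@eq_Ck _ _ _ k I (fun s => 'D_(v *: a) h (w + s *: a))) => // [s Is|].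
  have -> : 'D_v (fun s : R => h (w + s *: a)) s =
      v *: 'D_1 (fun s : R => h (w + s *: a)) s.
    by rewrite -(derive_dirZ _ _ (lineD s Is)) /GRing.scale/= mulr1.
  rewrite (derive_dirZ _ _ (hd s Is)).
  by case: (is_derive_along_line (hd s Is)) => _ ->.
exact: (IH _ (smooth_on_derive (v *: a) hU)).
Qed.

End smooth_composition.

(** * Local bounds for smooth maps *)

Section local_bounds.
Context {R : realType} {m n k l : nat}.
Implicit Types (h : 'M[R]_(m, n) -> 'M[R]_(k, l)) (x y z a b v : 'M[R]_(m, n))
  (U : set 'M[R]_(m, n)) (r C : R).

Definition lipschitz_derive h z r C : Prop := forall x y v,
  fball z r x -> fball z r y ->
  frob ('D_v h x - 'D_v h y) <= C * frob v * frob (x - y).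

Definition lipschitz_derive_increment h z r C : Prop := forall x y a v,
  fball z r x -> fball z r y -> fball z r (x + a) -> fball z r (y + a) ->
  frob ('D_v h (x + a) - 'D_v h x - ('D_v h (y + a) - 'D_v h y)) <=
  C * frob v * (frob a * frob (x - y)).

Definition remainder h x a : 'M[R]_(k, l) := h (x + a) - h x - 'D_a h x.

Definition lipschitz_remainder h z r C : Prop := forall x y a b,
  fball z r x -> fball z r y ->
  fball z r (x + a) -> fball z r (x + b) -> fball z r (y + b) ->
  frob (remainder h x a - remainder h y b) <=
  C * (frob b ^+ 2 * frob (x - y) + (frob a + frob b) * frob (a - b)).

Lemma smooth_bounded_derive U h z : open U -> U z -> smooth_on U h ->
  \forall C \near +oo, \forall x \near z, forall v, frob ('D_v h x) <= C * frob v.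
Proof.
move=> oU Uz hU.
pose B := \big[Num.max/0]_ij (frob ('D_(delta_mx ij.1 ij.2) h z) + 1).
near=> C.
have Dnear (ij : 'I_m * 'I_n) :
    \forall x \near z, frob ('D_(delta_mx ij.1 ij.2) h x) <= B.
  have := smooth_on_continuous (smooth_on_derive (delta_mx ij.1 ij.2) hU) Uz.
  move=> /continuous_fballP/(_ 1 ltr01); apply: filterS => x /ltW xz.
  apply: le_trans (frob_le_distD _ ('D_(delta_mx ij.1 ij.2) h z)) _.
  apply: le_trans (le_bigmax _ (fun ij => frob ('D_(delta_mx ij.1 ij.2) h z) + 1) ij).
  by rewrite lerD2l.
have Un : \forall x \near z, U x by exact: open_nbhs_nbhs.
apply: filterS2 Un (filter_forall (nbhs_filter z) Dnear) => x Ux Dx v.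
have [L xE] := derive_linear (smooth_on_differentiable hU Ux).
rewrite xE; apply: le_trans (frob_linear_le (C := B) _ v) _ => [i j|].
  by rewrite -xE; exact: (Dx (i, j)).
apply: ler_wpM2r; first exact: frob_ge0.
by near: C; exact: nbhs_pinfty_ge (num_real _).
Unshelve. all: by end_near. Qed.

Lemma bounded_derive_lipschitz h z r C :
  (forall x, fball z r x -> differentiable h x) ->
  (forall x v, fball z r x -> frob ('D_v h x) <= C * frob v) ->
  forall x y, fball z r x -> fball z r y -> frob (h x - h y) <= C * frob (x - y).
Proof.
move=> hd hC x y xr yr; have xE : y + (x - y) = x by rewrite subrKC.
have seg s : 0 <= s <= 1 -> fball z r (y + s *: (x - y)).
  by apply: fball_segment => //; rewrite xE.
have := @frob_mean_value01 _ _ _ (fun s => h (y + s *: (x - y)))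
  (fun s => 'D_(x - y) h (y + s *: (x - y))) (C * frob (x - y)).
rewrite scale1r scale0r addr0 xE; apply=> s /seg sr; last exact: hC.
by apply: is_derive_along_line; exact: hd.
Qed.

Lemma smooth_lipschitz_derive U h z : open U -> U z -> smooth_on U h ->
  \forall C \near +oo, \forall r \near 0^'+, lipschitz_derive h z r C.
Proof.
move=> oU Uz hU; pose D (ij : 'I_m * 'I_n) := 'D_(delta_mx ij.1 ij.2) h.
have sD ij : smooth_on U (D ij) by exact: smooth_on_derive.
near (pinfty_nbhs R) => B.
have BD : forall ij, \forall x \near z, forall v, frob ('D_v (D ij) x) <= B * frob v.
  near: B; apply: filter_forall => ij; exact: smooth_bounded_derive (sD ij).
near=> C.
have Un : \forall x \near z, U x by exact: open_nbhs_nbhs.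
have DB := filter_forall (nbhs_filter z) BD.
near=> r => x y v xr yr.
have inU w : fball z r w -> U w by move: w; near: r; exact: near_fball.
have Dr w : fball z r w -> forall ij v, frob ('D_v (D ij) w) <= B * frob v.
  by move: w; near: r; exact: near_fball.
have hd w : fball z r w -> differentiable h w.
  by move=> /inU; exact: smooth_on_differentiable.
have [Lx xE] := derive_linear (hd x xr); have [Ly yE] := derive_linear (hd y yr).
rewrite xE yE; apply: le_trans (frob_linearB_le (C := B * frob (x - y)) _ v) _ => [i j|].
  rewrite -xE -yE.
  apply: (@bounded_derive_lipschitz (D (i, j)) z r) => // w; last by move=> ? /Dr.
  by move=> /inU; exact: smooth_on_differentiable.
rewrite mulrA mulrAC; apply: ler_wpM2r; first exact: frob_ge0.
apply: ler_wpM2r; first exact: frob_ge0.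
by near: C; exact: nbhs_pinfty_ge (num_real _).
Unshelve. all: by end_near. Qed.

Lemma increment_lipschitz h z r C x y a :
  (forall x, fball z r x -> differentiable h x) -> lipschitz_derive h z r C ->
  fball z r x -> fball z r y -> fball z r (x + a) -> fball z r (y + a) ->
  frob (h (x + a) - h x - (h (y + a) - h y)) <= C * frob a * frob (x - y).
Proof.
move=> hd hC xr yr xar yar.
have sx s : 0 <= s <= 1 -> fball z r (x + s *: a) by exact: fball_segment.
have sy s : 0 <= s <= 1 -> fball z r (y + s *: a) by exact: fball_segment.
rewrite [X in frob X](_ : _ = h (x + a) - h (y + a) - (h x - h y)); last first.
  by move: (h _) (h _) (h _) (h _) => *; mx_ring.
have := @frob_mean_value01 _ _ _ (fun s => h (x + s *: a) - h (y + s *: a))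
  (fun s => 'D_a h (x + s *: a) - 'D_a h (y + s *: a)) (C * frob a * frob (x - y)).
rewrite !scale1r !scale0r !addr0; apply=> s s01.
  by apply: is_deriveB; apply: is_derive_along_line; apply: hd; [exact: sx|exact: sy].
apply: le_trans (hC _ _ a (sx s s01) (sy s s01)) _.
by rewrite opprD addrACA subrr addr0.
Qed.

Lemma smooth_lipschitz_derive_increment U h z : open U -> U z -> smooth_on U h ->
  \forall C \near +oo, \forall r \near 0^'+, lipschitz_derive_increment h z r C.
Proof.
move=> oU Uz hU; pose D (ij : 'I_m * 'I_n) := 'D_(delta_mx ij.1 ij.2) h.
have sD ij : smooth_on U (D ij) by exact: smooth_on_derive.
near (pinfty_nbhs R) => B.
have BD : forall ij, \forall r \near 0^'+, lipschitz_derive (D ij) z r B.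
  near: B; apply: filter_forall => ij; exact: smooth_lipschitz_derive (sD ij).
near=> C.
have Un : \forall x \near z, U x by exact: open_nbhs_nbhs.
have DB := filter_forall (at_right_proper_filter (0 : R)) BD.
near=> r => x y a v xr yr xar yar.
have inU w : fball z r w -> U w by move: w; near: r; exact: near_fball.
have hd w : fball z r w -> differentiable h w.
  by move=> /inU; exact: smooth_on_differentiable.
have Dr ij : lipschitz_derive (D ij) z r B by move: ij; near: r.
have [Lx xE] := derive_linear (hd x xr); have [Ly yE] := derive_linear (hd y yr).
have [Lxa xaE] := derive_linear (hd _ xar); have [Lya yaE] := derive_linear (hd _ yar).
rewrite xE yE xaE yaE.
apply: le_trans (frob_linearB_le (L := Lxa \- Lx) (L' := Lya \- Ly)
  (C := B * frob a * frob (x - y)) _ v) _ => [i j|].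
  rewrite /= -xE -yE -xaE -yaE.
  apply: (@increment_lipschitz (D (i, j)) z r) => // w.
  by move=> /inU; exact: smooth_on_differentiable.
have -> : (m * n)%:R * (B * frob a * frob (x - y)) * frob v =
    (m * n)%:R * B * frob v * (frob a * frob (x - y)) by ring.
apply: ler_wpM2r; first by rewrite mulr_ge0 ?frob_ge0.
apply: ler_wpM2r; first exact: frob_ge0.
by near: C; exact: nbhs_pinfty_ge (num_real _).
Unshelve. all: by end_near. Qed.

Lemma remainder_lipschitz_dir h z r C x a b :
  0 <= C -> (forall x, fball z r x -> differentiable h x) -> lipschitz_derive h z r C ->
  fball z r x -> fball z r (x + a) -> fball z r (x + b) ->
  frob (remainder h x a - remainder h x b) <= C * ((frob a + frob b) * frob (a - b)).
Proof.
move=> C0 hd hC xr xar xbr.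
have abE : x + b + (a - b) = x + a by rewrite addrACA -addrA subrr addr0.
have seg s : 0 <= s <= 1 -> fball z r (x + b + s *: (a - b)).
  by apply: fball_segment; rewrite ?abE.
have -> : remainder h x a - remainder h x b =
    h (x + a) - 'D_(a - b) h x - h (x + b).
  rewrite /remainder (derive_dirB _ _ (hd x xr)).
  by move: (h _) (h _) (h _) ('D_a h _) ('D_b h _) => *; mx_ring.
have := @frob_mean_value01 _ _ _
  (fun s => h (x + b + s *: (a - b)) - (s *: 'D_(a - b) h x))
  (fun s => 'D_(a - b) h (x + b + s *: (a - b)) - 'D_(a - b) h x)
  (C * ((frob a + frob b) * frob (a - b))).
rewrite !scale1r !scale0r !addr0 !subr0 abE; apply=> s s01.
  apply: is_deriveB; last exact: is_derive_scale.
  by apply: is_derive_along_line; apply: hd; exact: seg.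
apply: le_trans (hC _ _ _ (seg _ s01) xr) _.
rewrite -mulrA ler_wpM2l// mulrC ler_wpM2r ?frob_ge0//.
rewrite [X in frob X](_ : _ = s *: a + (1 - s) *: b); last by mx_ring.
case/andP : s01 => s0 s1.
apply: le_trans (frobD _ _) _; rewrite !frobZ !ger0_norm ?subr_ge0//.
by rewrite lerD// ler_piMl ?frob_ge0// gerBl.
Qed.

Lemma remainder_lipschitz_base h z r C x y b :
  0 <= C -> (forall x, fball z r x -> differentiable h x) ->
  lipschitz_derive_increment h z r C ->
  fball z r x -> fball z r y -> fball z r (x + b) -> fball z r (y + b) ->
  frob (remainder h x b - remainder h y b) <= C * (frob b ^+ 2 * frob (x - y)).
Proof.
move=> C0 hd hC xr yr xbr ybr.
have seg w s : fball z r w -> fball z r (w + b) -> 0 <= s <= 1 -> fball z r (w + s *: b).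
  exact: fball_segment.
have -> : remainder h x b - remainder h y b =
    h (x + b) - 'D_b h x - (h (y + b) - 'D_b h y) - (h x - h y).
  rewrite /remainder; move: (h _) (h _) (h _) (h _) ('D_b h _) ('D_b h _) => *.
  by mx_ring.
have := @frob_mean_value01 _ _ _
  (fun s => (h (x + s *: b) - (s *: 'D_b h x)) -
            (h (y + s *: b) - (s *: 'D_b h y)))
  (fun s => ('D_b h (x + s *: b) - 'D_b h x) - ('D_b h (y + s *: b) - 'D_b h y))
  (C * (frob b ^+ 2 * frob (x - y))).
rewrite !scale1r !scale0r !addr0 !subr0; apply=> s s01.
  apply: is_deriveB; apply: is_deriveB; try exact: is_derive_scale.
    by apply: is_derive_along_line; apply: hd; exact: seg.
  by apply: is_derive_along_line; apply: hd; exact: seg.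
apply: le_trans (hC _ _ _ b xr yr (seg _ _ xr xbr s01) (seg _ _ yr ybr s01)) _.
case/andP : s01 => s0 s1; rewrite -mulrA ler_wpM2l// expr2 -mulrA ler_wpM2l ?frob_ge0//.
by rewrite ler_wpM2r ?frob_ge0// frobZ ger0_norm// ler_piMl ?frob_ge0.
Qed.

Lemma smooth_lipschitz_remainder U h z : open U -> U z -> smooth_on U h ->
  \forall C \near +oo, \forall r \near 0^'+, lipschitz_remainder h z r C.
Proof.
move=> oU Uz hU; near=> C.
have C0 : 0 <= C by near: C; exact: nbhs_pinfty_ge (num_real _).
have derive_lip : \forall r \near 0^'+, lipschitz_derive h z r C.
  by near: C; exact: smooth_lipschitz_derive hU.
have increment_lip : \forall r \near 0^'+, lipschitz_derive_increment h z r C.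
  by near: C; exact: smooth_lipschitz_derive_increment hU.
have Un : \forall x \near z, U x by exact: open_nbhs_nbhs.
near=> r => x y a b xr yr xar xbr ybr.
have inU w : fball z r w -> U w by move: w; near: r; exact: near_fball.
have hd w : fball z r w -> differentiable h w.
  by move=> /inU; exact: smooth_on_differentiable.
rewrite -(subrKA (remainder h x b)).
apply: le_trans (frobD _ _) _; rewrite mulrDr addrC; apply: lerD.
  by apply: (remainder_lipschitz_base C0 hd _ xr yr) => //; near: r.
by apply: (remainder_lipschitz_dir C0 hd _ xr) => //; near: r.
Unshelve. all: by end_near. Qed.

Lemma remainder0 h x : remainder h x 0 = 0.
Proof. by rewrite /remainder addr0 derive0 !subrr. Qed.

Lemma frob_remainder_le h z r C x a : lipschitz_remainder h z r C ->
  fball z r x -> fball z r (x + a) -> frob (remainder h x a) <= C * frob a ^+ 2.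
Proof.
move=> hC xr xar; have x0r : fball z r (x + 0) by rewrite addr0.
have := hC x x a 0 xr xr xar x0r x0r.
by rewrite remainder0 !subr0 frob0 expr0n mul0r add0r addr0 expr2.
Qed.

End local_bounds.

(** * Compact sets of matrices *)

Lemma mxdot_mxvec {R : realType} {m n : nat} (A B : 'M[R]_(m, n)) :
  mxdot (mxvec A) (mxvec B) = mxdot A B.
Proof.
rewrite /mxdot big_ord1 pair_big/= (reindex (uncurry (@mxvec_index m n))) /=; last first.
  by have [g gK Kg] := curry_mxvec_bij m n; exists g.
by apply: eq_bigr => -[i j] _; rewrite /= !mxvecE.
Qed.

Section compactness.
Context {R : realType} {m n : nat}.
Implicit Types (K : set 'M[R]_(m, n)) (x y z : 'M[R]_(m, n)).

Lemma closure_frobP K x :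
  closure K x <-> forall e : R, 0 < e -> exists2 y, K y & frob (x - y) <= e.
Proof.
split=> [Kx e e0|Kx P /nbhs_fballP[e e0 eP]].
  by have [y [Ky /ltW]] := Kx _ (nbhs_fball x e0); exists y; rewrite // frob_distC.
have [y Ky xy] := Kx (e / 2) (divr_gt0 e0 (ltr0Sn _ 1)).
exists y; split=> //; apply: eP; rewrite /fball/= frob_distC.
by apply: le_lt_trans xy _; lra.
Qed.

Lemma frob_bounded_closed_compact K (B : R) :
  closed K -> (forall x, K x -> frob x <= B) -> compact K.
Proof.
move=> cK KB; pose unvec (v : 'rV[R]_(m * n)) : 'M[R]_(m, n) := vec_mx v.
have unvec_continuous : continuous unvec by exact: linear_mx_continuous.
have -> : K = unvec @` (unvec @^-1` K).
  apply/seteqP; split=> [x Kx|_ [v Kv <-]//].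
  by exists (mxvec x); rewrite /unvec /= mxvecK.
apply: continuous_compact; first exact: continuous_subspaceT.
apply: bounded_closed_compact; last by apply: preimage_closed => // v _.
exists B; split=> [|b Bb v /KB vB]; first exact: num_real.
apply: le_trans (mx_norm_le_frob _) _; apply: le_trans (ltW Bb).
by rewrite /frob -[v in mxdot v]vec_mxK -[X in mxdot _ X]vec_mxK mxdot_mxvec.
Qed.

Lemma compact_uniform_bounds K (Q : 'M[R]_(m, n) -> R -> R -> Prop) : compact K ->
  (forall x (r r' C C' : R), r' <= r -> C <= C' -> Q x r C -> Q x r' C') ->
  (forall z, K z -> exists r C : R, 0 < r /\ forall x, fball z r x -> Q x r C) ->
  exists r C : R, [/\ 0 < r, 0 < C & forall x, K x -> Q x r C].
Proof.
move=> /compact_near_coveringP cK Qmono Qloc.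
pose F := filter_prod (0 : R)^'+ (pinfty_nbhs R).
have QF : \forall rC \near F, K `<=` (fun x => Q x rC.1 rC.2).
  apply: cK => z /Qloc[r [C [r0 QrC]]]; exists (fball z r, [set s | s.1 <= r /\ C <= s.2]).
    split; first exact: nbhs_fball.
    exists ([set s | s <= r], [set s | C <= s]) => //; split.
      exact: nbhs_right_le.
    exact: nbhs_pinfty_ge (num_real C).
  by move=> [x [s D]] /= [xz [sr CD]]; apply: (Qmono x r s C D) => //; exact: QrC.
have F_gt0 : \forall rC \near F, 0 < rC.1 /\ 0 < rC.2.
  exists ([set s | 0 < s], [set s | 0 < s]) => [|[s D] [/= ? ?]//]; split.
    exact: nbhs_right_gt.
  exact: nbhs_pinfty_gt (num_real 0).
near F => rC; have [r0 C0] : 0 < rC.1 /\ 0 < rC.2 by near: rC; exact: F_gt0.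
by exists rC.1, rC.2; split=> //; near: rC; exact: QF.
Unshelve. all: by end_near. Qed.

(* Lebesgue number, for a property of pairs that holds near every diagonal point. *)
Lemma compact_uniform_pairs K (P : 'M[R]_(m, n) -> 'M[R]_(m, n) -> Prop) : compact K ->
  (forall z, K z -> exists2 r : R, 0 < r &
    forall x y, fball z r x -> fball z r y -> P x y) ->
  exists2 r : R, 0 < r & forall x y, K x -> fball x r y -> P x y.
Proof.
move=> cK Ploc.
have [||r [_ [r0 _ Pr]]] := @compact_uniform_bounds K
  (fun x r _ => forall y, fball x r y -> P x y) cK.
- by move=> x r r' _ _ rr _ Pr y yr; apply: Pr; exact: lt_le_trans rr.
- move=> z /Ploc[r r0 Pr]; exists (r / 2), 0; split=> [|x]; first by rewrite divr_gt0.
  rewrite /fball/= => xz y yx; apply: Pr; rewrite /fball/=; first by move: xz; lra.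
  by apply: le_lt_trans (frob_dist_triangle x _ _) _; lra.
by exists r => // x y /Pr; exact.
Qed.

(* The cluster point is taken along the filter generated by the sets [D e]. *)
Lemma bounded_family_cluster (D : R -> set 'M[R]_(m, n)) (B : R) :
  (forall e e', e <= e' -> D e `<=` D e') -> (forall e, 0 < e -> D e !=set0) ->
  (forall e v, D e v -> frob v <= B) ->
  exists l, forall e : R, 0 < e -> exists2 v, D e v & frob (v - l) <= e.
Proof.
move=> Dmono D0 DB; pose F := filter_from [set e : R | 0 < e] D.
have filterF : Filter F.
  apply: filter_from_filter; first by exists 1; exact: ltr01.
  move=> e e' e0 e'0; exists (Num.min e e'); first by rewrite /= lt_min e0.
  by move=> v Dv; split; apply: Dmono Dv; rewrite ge_min lexx ?orbT.
have properF : ProperFilter F by apply: filter_from_proper => // e; exact: D0.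
have cB : compact [set v : 'M[R]_(m, n) | frob v <= B].
  by apply: (@frob_bounded_closed_compact _ B) => //; exact: closed_frob_le.
have FB : F [set v | frob v <= B] by exists 1; [exact: ltr01|exact: DB].
have [l [_ lF]] := cB F properF FB; exists l => e e0.
have FD : F (D e) by exists e.
by have [v [Dv /ltW vl]] := lF _ _ FD (nbhs_fball l e0); exists v.
Qed.

End compactness.

(** * Local equations of embedded submanifolds *)

Section slice_charts.
Context {R : realType} {m n : nat}.
Implicit Types (M U V : set 'M[R]_(m, n)) (S : {vspace 'M[R]_(m, n)})
  (phi psi : 'M[R]_(m, n) -> 'M[R]_(m, n)) (x z v w a : 'M[R]_(m, n)).

Record slice_chart M U V phi psi S : Prop := SliceChart {
  slice_domain_open : open U;
  slice_image_open : open V;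
  slice_smooth : smooth_on U phi;
  slice_inv_smooth : smooth_on V psi;
  sliceK : forall x, U x -> V (phi x) /\ psi (phi x) = x;
  slice_invK : forall w, V w -> U (psi w) /\ phi (psi w) = w;
  sliceP : forall x, U x -> M x <-> phi x \in S }.

Lemma slice_chart_exists d M z : embedded_submanifold d M -> M z ->
  exists U V phi psi S, U z /\ slice_chart M U V phi psi S.
Proof.
move=> eM Mz; have [U [V [phi [psi [S [[oU oV Uz] [[? ? ? ?] [_ ?]]]]]]]] := eM z Mz.
by exists U, V, phi, psi, S.
Qed.

Lemma derive_inverse U phi psi x v : open U -> U x ->
  (forall y, U y -> psi (phi y) = y) -> differentiable phi x ->
  differentiable psi (phi x) -> 'D_('D_v phi x) psi (phi x) = v.
Proof.
move=> oU Ux phiK dphi dpsi.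
have x0 : x + (0 : R) *: v = x by rewrite scale0r addr0.
have := @is_derive_along_line _ _ _ phi x v 0; rewrite x0 => /(_ dphi) phiD.
have := @is_derive_chain _ _ _ psi _ _ _ phiD; rewrite x0 => /(_ dpsi)[_ <-].
have [_ vE] := is_derive_line x v 0; rewrite -[RHS]vE.
apply: near_eq_derive; near=> s => /=; apply: phiK; near: s.
have lc : {for 0 : R, continuous (fun s : R => x + s *: v)} by exact: line_continuous.
by apply: lc; rewrite x0; exact: open_nbhs_nbhs.
Unshelve. all: by end_near. Qed.

Lemma slice_tangent M U V phi psi S w a : slice_chart M U V phi psi S ->
  V w -> w \in S -> a \in S -> tangent M (psi w) ('D_a psi w).
Proof.
move=> ch Vw wS aS; have w0 : w + (0 : R) *: a = w by rewrite scale0r addr0.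
exists (fun s => psi (w + s *: a)).
  exists [set s : R | V (w + s *: a)]; split=> /=.
  - have lc : continuous (fun s : R => w + s *: a) by exact: line_continuous.
    exact: ((continuousP _).1 lc _ (slice_image_open ch)).
  - by rewrite w0.
  - exact: smooth_on_line (slice_image_open ch) (slice_inv_smooth ch).
  - move=> s Vs; have [Us psiK] := slice_invK ch Vs; apply/(sliceP ch Us).
    by rewrite psiK memvD// memvZ.
  - by rewrite w0.
have dpsi : differentiable psi (w + (0 : R) *: a).
  by rewrite w0; exact: smooth_on_differentiable (slice_inv_smooth ch) Vw.
by rewrite derive1E; case: (is_derive_along_line dpsi) => _ ->; rewrite w0.
Qed.

End slice_charts.

Lemma tangent_derive_eq0 {R : realType} {m n : nat} {W : normedModType R}
    (M U : set 'M[R]_(m, n)) (F : 'M[R]_(m, n) -> W) x v : open U -> U x ->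
  (forall y, U y -> M y -> F y = 0) -> differentiable F x ->
  tangent M x v -> 'D_v F x = 0.
Proof.
move=> oU Ux F0 dF [c [I [oI I0 sc cM c0] <-]].
have cD : is_derive (0 : R) (1 : R) c (derive1 c 0).
  rewrite derive1E; apply: derivableP; apply/derivable1_diffP.
  exact: smooth_on_differentiable sc I0.
have := @is_derive_chain _ _ _ F _ _ _ cD; rewrite c0 => /(_ dF)[_ <-].
rewrite -(derive_cst (0 : W) (0 : R) (1 : R)); apply: near_eq_derive.
have cc : {for 0 : R, continuous c} by exact: smooth_on_continuous sc I0.
have cU : nbhs (0 : R) (c @^-1` U) by apply: cc; rewrite c0; exact: open_nbhs_nbhs.
apply: filterS2 cU (open_nbhs_nbhs (conj oI I0)) => s Us Is /=.
by apply: F0 => //; exact: cM.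
Qed.

(* Near [z], the submanifold is the zero set of [F] and its tangent spaces are
   the kernels of the derivative of [F], with uniform C^3 bounds. *)
Record local_equation {R : realType} {m n : nat} (M : set 'M[R]_(m, n))
    (z : 'M[R]_(m, n)) (r C : R) (F : 'M[R]_(m, n) -> 'M[R]_(m, n)) : Prop :=
  LocalEquation {
  equation_radius_gt0 : 0 < r;
  equation_bound_gt0 : 0 < C;
  equation_differentiable : forall x, fball z r x -> differentiable F x;
  equation_derive_le : forall x v, fball z r x -> frob ('D_v F x) <= C * frob v;
  equation_lipschitz_derive : lipschitz_derive F z r C;
  equation_lipschitz_remainder : lipschitz_remainder F z r C;
  equationP : forall x, fball z r x -> M x <-> F x = 0;
  equation_tangentP : forall x v, fball z r x -> M x ->
    tangent M x v <-> 'D_v F x = 0;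
  equation_tangent_near : forall x v, fball z r x -> M x ->
    exists2 u, tangent M x u & frob (v - u) <= C * frob ('D_v F x) }.

(* [F] is the component of the slice chart transverse to the slice. *)
Lemma slice_equation {R : realType} {m n : nat} (M U V : set 'M[R]_(m, n)) phi psi S z :
  slice_chart M U V phi psi S -> U z -> exists F : 'M[R]_(m, n) -> 'M[R]_(m, n),
  [/\ smooth_on U F, forall x, U x -> M x <-> F x = 0,
      forall x v, U x -> M x -> tangent M x v <-> 'D_v F x = 0 &
      \forall C \near +oo, \forall x \near z, forall v, U x -> M x ->
        exists2 u, tangent M x u & frob (v - u) <= C * frob ('D_v F x)].
Proof.
move=> ch Uz; have oU := slice_domain_open ch; have oV := slice_image_open ch.
pose L : {linear 'M[R]_(m, n) -> 'M[R]_(m, n)} := idfun \- projv S.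
have L0 w : L w = 0 <-> w \in S.
  split=> [/eqP|wS]; last by rewrite /L/= projv_id// subrr.
  by rewrite /L/= subr_eq0 => /eqP ->; exact: memv_proj.
have L_continuous : continuous L by exact: linear_mx_continuous.
have sF := smooth_on_linear_comp oU L_continuous (slice_smooth ch).
have dphi x : U x -> differentiable phi x.
  exact: smooth_on_differentiable (slice_smooth ch).
have dpsi w : V w -> differentiable psi w.
  exact: smooth_on_differentiable (slice_inv_smooth ch).
have DF x v : U x -> 'D_v (L \o phi) x = L ('D_v phi x).
  by move=> Ux; exact: derive_linear_comp L_continuous (dphi x Ux).
have F0 x : U x -> M x <-> L (phi x) = 0.
  by move=> Ux; split=> [/(sliceP ch Ux)/L0//|/L0/(sliceP ch Ux)].
have phiK x v : U x -> 'D_('D_v phi x) psi (phi x) = v.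
  move=> Ux; have [Vx _] := sliceK ch Ux.
  apply: (@derive_inverse _ _ _ U phi psi x v oU Ux) (dphi x Ux) (dpsi _ Vx).
  by move=> y /(sliceK ch)[].
have psi_tangent x a : U x -> M x -> a \in S -> tangent M x ('D_a psi (phi x)).
  move=> Ux Mx aS; have [Vx xK] := sliceK ch Ux; rewrite -{1}xK.
  by apply: (slice_tangent ch) => //; exact/(sliceP ch Ux).
exists (L \o phi); split=> // [x v Ux Mx|].
  split=> [|DvF]; last by rewrite -(phiK x v Ux); apply: psi_tangent => //; apply/L0; rewrite -DF.
  apply: (tangent_derive_eq0 oU Ux) => [y Uy /(F0 y Uy)//|].
  exact: smooth_on_differentiable sF Ux.
have [Vz _] := sliceK ch Uz.
have psiB := smooth_bounded_derive oV Vz (slice_inv_smooth ch).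
apply: filterS psiB => C psiB.
have := near_continuous (smooth_on_continuous (slice_smooth ch) Uz) psiB.
apply: filterS => x {}psiB v Ux Mx; have [Vx _] := sliceK ch Ux.
exists ('D_(projv S ('D_v phi x)) psi (phi x)).
  by apply: psi_tangent => //; exact: memv_proj.
by rewrite -[X in X - _](phiK x v Ux) -(derive_dirB _ _ (dpsi _ Vx)) (DF x v Ux).
Qed.

Lemma local_equation_exists {R : realType} {m n d : nat} (M : set 'M[R]_(m, n)) z :
  embedded_submanifold d M -> M z -> exists r C F, local_equation M z r C F.
Proof.
move=> eM Mz; have [U [V [phi [psi [S [Uz ch]]]]]] := slice_chart_exists eM Mz.
have oU := slice_domain_open ch.
have [F [sF MF tF FT]] := slice_equation ch Uz.
near (pinfty_nbhs R) => C.
have FB : \forall x \near z, forall v, frob ('D_v F x) <= C * frob v.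
  by near: C; exact: smooth_bounded_derive oU Uz sF.
have FL : \forall r \near 0^'+, lipschitz_derive F z r C.
  by near: C; exact: smooth_lipschitz_derive oU Uz sF.
have FR : \forall r \near 0^'+, lipschitz_remainder F z r C.
  by near: C; exact: smooth_lipschitz_remainder oU Uz sF.
have tangent_nearC : \forall x \near z, forall v, U x -> M x ->
    exists2 u, tangent M x u & frob (v - u) <= C * frob ('D_v F x) by near: C.
have Un : \forall x \near z, U x by exact: open_nbhs_nbhs.
near (0 : R)^'+ => r.
have inU x : fball z r x -> U x by move: x; near: r; exact: near_fball.
have derive_le x : fball z r x -> forall v, frob ('D_v F x) <= C * frob v.
  by move: x; near: r; exact: near_fball.
have tangent_near x : fball z r x -> forall v, U x -> M x ->
    exists2 u, tangent M x u & frob (v - u) <= C * frob ('D_v F x).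
  by move: x; near: r; exact: near_fball.
exists r, C, F; split.
- by near: r; exact: nbhs_right_gt.
- by near: C; exact: nbhs_pinfty_gt (num_real 0).
- by move=> x /inU; exact: smooth_on_differentiable.
- by move=> x v xr; exact: derive_le.
- by near: r.
- by near: r.
- by move=> x /inU/MF.
- by move=> x v /inU/tF; exact.
- by move=> x v xr; apply: tangent_near => //; exact: inU.
Unshelve. all: by end_near. Qed.

Section local_equation_theory.
Context {R : realType} {m n : nat}.
Variables (M : set 'M[R]_(m, n)) (z : 'M[R]_(m, n)) (r C : R)
  (F : 'M[R]_(m, n) -> 'M[R]_(m, n)).
Hypothesis eqF : local_equation M z r C F.
Implicit Types (x y u w : 'M[R]_(m, n)).

Let C0 : 0 <= C. Proof. exact/ltW/(equation_bound_gt0 eqF). Qed.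

Lemma equation_closed x : fball z r x -> closure M x -> M x.
Proof.
move=> xr Mx; apply/(equationP eqF xr)/frob_small_eq0 => e e0.
have Fc : {for x, continuous F}.
  exact: differentiable_continuous (equation_differentiable eqF xr).
have xn : nbhs x (fball z r `&` [set y | fball (F x) e (F y)]).
  apply: filterI; first exact: open_nbhs_nbhs (conj (@fball_open _ _ _ z r) xr).
  exact: near_continuous Fc (nbhs_fball _ e0).
have [y [My [yr]]] := Mx _ xn.
by rewrite /fball/= ((equationP eqF yr).1 My) sub0r frobN => /ltW.
Qed.

Lemma equation_coercive x w (eta : R) : fball z r x -> M x -> 0 <= eta ->
  (forall u, tangent M x u -> `|mxdot w u| <= eta * frob u) ->
  frob w <= C * frob ('D_w F x) + (1 + C ^+ 2) * eta.
Proof.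
move=> xr Mx eta0 w_normal; have [u Tu wu] := equation_tangent_near eqF w xr Mx.
have u_le : frob u <= (1 + C ^+ 2) * frob w.
  apply: le_trans (frob_le_distD _ w) _; rewrite mulrDl mul1r lerD2l frob_distC expr2 -mulrA.
  exact: le_trans wu (ler_wpM2l C0 (equation_derive_le eqF w xr)).
have D0 : 0 <= C * frob ('D_w F x) by rewrite mulr_ge0 ?frob_ge0.
have C20 : 0 <= 1 + C ^+ 2 by rewrite addr_ge0 ?sqr_ge0.
apply: frob_le_mxdot; first by rewrite addr_ge0// mulr_ge0.
have -> : mxdot w w = mxdot w (w - u) + mxdot w u by rewrite mxdotBr subrK.
rewrite mulrDl; apply: lerD.
  by apply: le_trans (mxdot_le _ _) _; rewrite mulrC ler_wpM2r ?frob_ge0.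
apply: le_trans (ler_norm _) _; apply: le_trans (w_normal u Tu) _.
by rewrite -mulrA mulrCA ler_wpM2l.
Qed.

Lemma equation_almost_normal x y w (eta : R) u : fball z r x -> fball z r y ->
  M x -> M y -> 0 <= eta ->
  (forall v, tangent M y v -> `|mxdot w v| <= eta * frob v) -> tangent M x u ->
  `|mxdot w u| <= ((1 + C ^+ 2) * eta + C ^+ 2 * frob w * frob (x - y)) * frob u.
Proof.
move=> xr yr Mx My eta0 w_normal Tu.
have [v Tv uv] := equation_tangent_near eqF u yr My.
have Du : frob ('D_u F y) <= C * frob u * frob (x - y).
  have := equation_lipschitz_derive eqF u yr xr.
  by rewrite ((equation_tangentP eqF u xr Mx).1 Tu) subr0 (frob_distC y).
have uv_near : frob (u - v) <= C ^+ 2 * frob (x - y) * frob u.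
  apply: le_trans uv (le_trans (ler_wpM2l C0 Du) _).
  by rewrite !mulrA -expr2 mulrAC.
have v_le : frob v <= (1 + C ^+ 2) * frob u.
  apply: le_trans (frob_le_distD _ u) _; rewrite mulrDl mul1r lerD2l frob_distC expr2 -mulrA.
  exact: le_trans uv (ler_wpM2l C0 (equation_derive_le eqF u yr)).
have -> : mxdot w u = mxdot w v + mxdot w (u - v) by rewrite mxdotBr subrKC.
apply: le_trans (ler_normD _ _) _; rewrite mulrDl; apply: lerD.
  by apply: le_trans (w_normal v Tv) _; rewrite [leRHS]mulrAC mulrC ler_wpM2r.
apply: le_trans (normr_mxdot_le _ _) _.
apply: le_trans (ler_wpM2l (frob_ge0 w) uv_near) _.
lra.
Qed.

End local_equation_theory.

Section tangent_space.
Context {R : realType} {m n : nat} (d : nat) (M : set 'M[R]_(m, n)).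
Hypothesis eM : embedded_submanifold d M.

Lemma tangent_lincomb x (k : R) u v : M x -> tangent M x u -> tangent M x v ->
  tangent M x (k *: u + v).
Proof.
move=> Mx; have [r [C [F eqF]]] := local_equation_exists eM Mx.
have xr := fball_center x (equation_radius_gt0 eqF).
have dF := equation_differentiable eqF xr.
move=> /(equation_tangentP eqF _ xr Mx) Du /(equation_tangentP eqF _ xr Mx) Dv.
apply/(equation_tangentP eqF _ xr Mx).
by rewrite (derive_dirD _ _ dF) (derive_dirZ _ _ dF) Du Dv scaler0 addr0.
Qed.

Lemma tangent0 x : M x -> tangent M x 0.
Proof.
move=> Mx; have [r [C [F eqF]]] := local_equation_exists eM Mx.
have xr := fball_center x (equation_radius_gt0 eqF).
by apply/(equation_tangentP eqF _ xr Mx); rewrite derive0.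
Qed.

Lemma tangentZ x (k : R) v : M x -> tangent M x v -> tangent M x (k *: v).
Proof.
by move=> Mx Tv; have := tangent_lincomb k Mx Tv (tangent0 Mx); rewrite addr0.
Qed.

Lemma tangent_sum x (I : Type) (s : seq I) (P : pred I) (v : I -> 'M[R]_(m, n)) :
  M x -> (forall i, tangent M x (v i)) -> tangent M x (\sum_(i <- s | P i) v i).
Proof.
move=> Mx Tv; elim/big_ind : _ => //; first exact: tangent0.
by move=> u w Tu Tw; have := tangent_lincomb 1 Mx Tu Tw; rewrite scale1r.
Qed.

End tangent_space.

(** * Geodesics *)

Section smooth_curves.
Context {R : realType} {m n : nat} (c : R -> 'M[R]_(m, n)).
Hypothesis sc : smooth_on setT c.

Lemma smooth_derive1n k : smooth_on setT (derive1n k c).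
Proof.
elim: k => [//|k IH]; rewrite derive1nS.
have -> : (derive1n k c)^`()%classic = 'D_1 (derive1n k c).
  by apply/funext => s; rewrite derive1E.
exact: smooth_on_derive.
Qed.

Lemma is_derive_derive1n k s : is_derive s (1 : R) (derive1n k c) (derive1n k.+1 c s).
Proof.
rewrite derive1nS derive1E; apply: derivableP; apply/derivable1_diffP.
exact: smooth_on_differentiable (smooth_derive1n k) _.
Qed.

Lemma derive1n_bounded k (T : R) : exists2 K : R, 0 < K &
  forall s, 0 <= s <= T -> frob (derive1n k c s) <= K.
Proof.
have [T0|T0] := leP 0 T; last by exists 1 => // s; lra.
have cK : {within `[0, T], continuous (@frob R m n \o derive1n k c)}.
  apply: continuous_subspaceT => s; apply: continuous_comp; last exact: frob_continuous.
  exact: smooth_on_continuous (smooth_derive1n k) _.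
have [s0 _ max_s0] := EVT_max T0 cK.
exists (frob (derive1n k c s0) + 1) => [|s sT]; first by rewrite ltr_wpDl ?frob_ge0.
by apply: ler_wpDr => //; apply: max_s0; rewrite in_itv.
Qed.

Lemma smooth_curve_at (M : set 'M[R]_(m, n)) s : (forall t, M (c t)) ->
  curve_at M (c s) (fun t : R => c (s + t *: (1 : R^o))).
Proof.
move=> cM; exists setT; split=> //; first exact: openT.
  exact: (smooth_on_line s (1 : R^o) openT sc).
by rewrite scale0r addr0.
Qed.

Lemma derive1_shift s : derive1 (fun t : R => c (s + t *: (1 : R^o))) 0 = derive1 c s.
Proof.
have dc : differentiable c (s + (0 : R) *: (1 : R^o)).
  exact: smooth_on_differentiable sc _.
rewrite derive1E; have [_ ->] := is_derive_along_line dc.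
by rewrite scale0r addr0 derive1E.
Qed.

End smooth_curves.

Section geodesics.
Context {R : realType} {m n : nat} (M : set 'M[R]_(m, n)) (c : R -> 'M[R]_(m, n)).
Hypothesis gc : geodesic M c.

Lemma geodesic_smooth : smooth_on setT c.
Proof. by case: gc. Qed.

Lemma geodesic_M s : M (c s).
Proof. by case: gc. Qed.

Lemma geodesic_is_derive s : is_derive s (1 : R) c (derive1 c s).
Proof. exact: (is_derive_derive1n geodesic_smooth 0). Qed.

Lemma geodesic_is_derive1 s : is_derive s (1 : R) (derive1 c) (derive1n 2 c s).
Proof. exact: (is_derive_derive1n geodesic_smooth 1). Qed.

Lemma geodesic_tangent s : tangent M (c s) (derive1 c s).
Proof.
rewrite -(derive1_shift geodesic_smooth); exists (fun t : R => c (s + t *: (1 : R^o))) => //.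
by apply: (smooth_curve_at geodesic_smooth) => t; exact: geodesic_M.
Qed.

Lemma geodesic_normal s v : tangent M (c s) v -> mxdot (derive1n 2 c s) v = 0.
Proof. by case: gc => _ _; exact. Qed.

Lemma geodesic_speed s : frob (derive1 c s) = frob (derive1 c 0).
Proof.
have speedD t : is_derive t (1 : R) (fun t => mxdot (derive1 c t) (derive1 c t)) 0.
  have := is_derive_mxdot (geodesic_is_derive1 t) (geodesic_is_derive1 t).
  have a0 := geodesic_normal (geodesic_tangent t).
  by rewrite [X in _ + X]mxdotC [X in X + _]a0 [X in _ + X]a0 addr0.
by have := is_derive_0_is_cst s 0 speedD; rewrite /frob => ->.
Qed.

Lemma geodesic_lipschitz s t :
  frob (c s - c t) <= frob (derive1 c 0) * `|s - t|.
Proof.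
wlog st : s t / t <= s.
  move=> sym; have [ts|/ltW st] := leP t s; first exact: sym.
  by rewrite frob_distC distrC; exact: sym.
rewrite ger0_norm ?subr_ge0//.
apply: (frob_mean_value st (fun s _ => geodesic_is_derive s)) => x _.
by rewrite geodesic_speed.
Qed.

(* Differentiating ['D_(c') F c = 0] bounds the normal component of [c'']. *)
Lemma geodesic_acceleration z r C F s : local_equation M z r C F -> fball z r (c s) ->
  frob (derive1n 2 c s) <= C ^+ 2 * frob (derive1 c 0) ^+ 2.
Proof.
move=> eqF csr; set v := frob (derive1 c 0).
have C0 := ltW (equation_bound_gt0 eqF).
have DFc t : fball z r (c t) -> 'D_(derive1 c t) F (c t) = 0.
  move=> ctr; apply/(equation_tangentP eqF _ ctr (geodesic_M t)).
  exact: geodesic_tangent.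
have Dacc : frob ('D_(derive1n 2 c s) F (c s)) <= C * v ^+ 2.
  have [L FL] := derive_linear (equation_differentiable eqF csr).
  have LD : is_derive s (1 : R) (L \o derive1 c) (L (derive1n 2 c s)).
    have dL := linear_differentiable (derive1 c s) (@linear_mx_continuous _ _ _ _ _ L).
    have := is_derive_chain (geodesic_is_derive1 s) dL.
    by rewrite (deriveE _ dL) diff_lin//; exact: linear_mx_continuous.
  rewrite FL; apply: is_derive_frob_le LD _.
  have c_near : \forall t \near s, fball z r (c t).
    have cc : {for s, continuous c} by exact: smooth_on_continuous geodesic_smooth _.
    exact: near_continuous cc (open_nbhs_nbhs (conj (@fball_open _ _ _ z r) csr)).
  apply: filterS c_near => t ctr.
  rewrite /= -!FL (DFc s csr) subr0 -[X in frob X]subr0 -(DFc t ctr).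
  apply: le_trans (equation_lipschitz_derive eqF _ csr ctr) _.
  rewrite geodesic_speed -/v expr2 -!mulrA ler_wpM2l// ler_wpM2l ?frob_ge0//.
  by rewrite frob_distC geodesic_lipschitz.
have acc_normal u : tangent M (c s) u -> `|mxdot (derive1n 2 c s) u| <= 0 * frob u.
  by move=> /geodesic_normal ->; rewrite normr0 mul0r.
have := equation_coercive eqF csr (geodesic_M s) (lexx 0) acc_normal.
by rewrite mulr0 addr0 => /le_trans; apply; rewrite expr2 -mulrA ler_wpM2l.
Qed.

End geodesics.

Lemma geodesic_acceleration_compact {R : realType} {m n d : nat} (M K : set 'M[R]_(m, n)) :
  embedded_submanifold d M -> compact K -> K `<=` M ->
  exists2 k : R, 0 < k & forall c s, geodesic M c -> K (c s) ->
    frob (derive1n 2 c s) <= k * frob (derive1 c 0) ^+ 2.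
Proof.
move=> eM cK KM; have [||_ [k [_ k0 kP]]] := @compact_uniform_bounds _ _ _ K
  (fun x _ k => forall c s, geodesic M c -> c s = x ->
    frob (derive1n 2 c s) <= k * frob (derive1 c 0) ^+ 2) cK.
- move=> x _ _ k k' _ kk kP c s gc cs; apply: le_trans (kP c s gc cs) _.
  by rewrite ler_wpM2r// sqr_ge0.
- move=> z /KM Mz; have [r [C [F eqF]]] := local_equation_exists eM Mz.
  exists r, (C ^+ 2); split; first exact: equation_radius_gt0 eqF.
  by move=> x xr c s gc cs; apply: (geodesic_acceleration gc eqF); rewrite cs.
by exists k => // c s gc /kP; exact.
Qed.

(** * Stability of discrete geodesics *)

Section sequences.
Context {V : zmodType}.
Implicit Types (p : nat -> V).

Definition step p i : V := p i.+1 - p i.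

Definition second_difference p i : V := step p i.+1 - step p i.

End sequences.

Definition sample {R : realType} {V : zmodType} (c : R -> V) (t : R) (i : nat) : V :=
  c (i%:R * t).

Lemma is_derive_affine {R : realType} {V : normedModType R} (g : R -> V) (a b s : R) dg :
  is_derive (a + s * b) (1 : R) g dg ->
  is_derive s (1 : R) (fun s => g (a + s * b)) (b *: dg).
Proof.
move=> [/derivable1_diffP dg' gE].
have := @is_derive_chain _ _ _ g _ s b (is_derive_line (a : R^o) b s) dg'.
suff -> : 'D_b g (a + s * b) = b *: dg by [].
by rewrite -gE -(derive_dirZ _ _ dg') /GRing.scale/= mulr1.
Qed.

Section second_difference_of_curves.
Context {R : realType} {m n : nat}.

Lemma is_derive_sqr_scale (v : 'M[R]_(m, n)) (s : R) :
  is_derive s (1 : R) (fun s : R => s ^+ 2 *: v) ((2 * s) *: v).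
Proof.
have sqrD : is_derive s (1 : R) (fun s : R => s ^+ 2) (2 * s).
  have := is_deriveM (is_derive_id s (1 : R)) (is_derive_id s (1 : R)).
  by move=> /is_derive_eq; apply; rewrite /GRing.scale/=; ring.
have scaleD y : differentiable (fun y : R => y *: v) y.
  by apply/derivable1_diffP; case: (is_derive_scale v y).
have := @is_derive_chain _ _ _ (fun y : R => y *: v) _ s _ sqrD (scaleD _).
move=> /is_derive_eq; apply.
have [_ vE] := is_derive_scale v (s ^+ 2); rewrite -[in RHS]vE -(derive_dirZ _ _ (scaleD _)).
by rewrite /GRing.scale/= mulr1.
Qed.

Variables c c1 c2 : R -> 'M[R]_(m, n).
Hypothesis cD : forall s, is_derive s (1 : R) c (c1 s).
Hypothesis c1D : forall s, is_derive s (1 : R) c1 (c2 s).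
Variables (s t K : R).
Hypotheses (t0 : 0 <= t) (K0 : 0 <= K).
Hypothesis c2_lipschitz : forall x, `|x - s| <= t -> frob (c2 x - c2 s) <= K * `|x - s|.

Let fwd f df x : (forall s, is_derive s (1 : R) f (df s)) ->
  is_derive x (1 : R) (fun x => f (s + x * 1)) (df (s + x * 1) : 'M[R]_(m, n)).
Proof. by move=> fD; have := is_derive_affine (fD (s + x * 1)); rewrite scale1r. Qed.

Let bwd f df x : (forall s, is_derive s (1 : R) f (df s)) ->
  is_derive x (1 : R) (fun x => f (s + x * -1)) (- df (s + x * -1) : 'M[R]_(m, n)).
Proof. by move=> fD; have := is_derive_affine (fD (s + x * -1)); rewrite scaleN1r. Qed.

Lemma symmetric_difference_le x : 0 <= x <= t ->
  frob (c1 (s + x) - c1 (s - x) - (2 * x) *: c2 s) <= 2 * K * t * x.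
Proof.
move=> /andP[x0 xt].
pose g y := c1 (s + y * 1) - c1 (s + y * -1) - y *: (2 *: c2 s).
have -> : c1 (s + x) - c1 (s - x) - (2 * x) *: c2 s = g x - g 0.
  by rewrite /g !mulr1 mulrN1 !mul0r addr0 subrr scale0r subr0 oppr0 addr0 scalerA mulrC.
have gD y : is_derive y (1 : R) g (c2 (s + y * 1) - - c2 (s + y * -1) - 2 *: c2 s).
  exact: (is_deriveB (is_deriveB (fwd y c1D) (bwd y c1D)) (is_derive_scale _ y)).
rewrite -[X in _ * X]subr0.
apply: (frob_mean_value x0 (fun y _ => gD y)) => y /andP[y0 yx].
have yt : y <= t by exact: le_trans xt.
rewrite mulr1 mulrN1 opprK scaler_nat mulr2n opprD addrACA.
have c2_near e : `|e| = y -> frob (c2 (s + e) - c2 s) <= K * t.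
  move=> eE; have := @c2_lipschitz (s + e); rewrite [s + e - s]addrAC subrr add0r eE.
  by move=> /(_ yt)/le_trans; apply; rewrite ler_wpM2l.
apply: le_trans (frobD _ _) _; rewrite -mulrA mulr_natl mulr2n.
by apply: lerD; apply: c2_near; rewrite ?normrN ger0_norm.
Qed.

Lemma second_difference_approx :
  frob (c (s + t) - c s - (c s - c (s - t)) - t ^+ 2 *: c2 s) <= 2 * K * t ^+ 3.
Proof.
pose g x := c (s + x * 1) + c (s + x * -1) - x ^+ 2 *: c2 s.
have -> : c (s + t) - c s - (c s - c (s - t)) - t ^+ 2 *: c2 s = g t - g 0.
  rewrite /g mulr1 mulrN1 !mul0r addr0 expr0n scale0r subr0.
  by move: (c _) (c _) (c _) => *; mx_ring.
have gD x : is_derive x (1 : R) g (c1 (s + x * 1) + - c1 (s + x * -1) - (2 * x) *: c2 s).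
  exact: (is_deriveB (is_deriveD (fwd x cD) (bwd x cD)) (is_derive_sqr_scale _ x)).
rewrite (_ : 2 * K * t ^+ 3 = 2 * K * t * t * (t - 0)); last by ring.
apply: (frob_mean_value t0 (fun x _ => gD x)) => x xt; rewrite mulr1 mulrN1.
apply: le_trans (symmetric_difference_le xt) _; case/andP : xt => _ xt.
by rewrite ler_wpM2l// !mulr_ge0.
Qed.

End second_difference_of_curves.

Section sampled_geodesics.
Context {R : realType} {m n : nat} (M : set 'M[R]_(m, n)) (c : R -> 'M[R]_(m, n)).
Hypothesis gc : geodesic M c.

Lemma frob_step_sample_le (t : R) i : 0 <= t ->
  frob (step (sample c t) i) <= frob (derive1 c 0) * t.
Proof.
move=> t0; apply: le_trans (geodesic_lipschitz gc _ _) _.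
by rewrite -mulrBl -natrB// subSnn mul1r ger0_norm.
Qed.

Lemma geodesic_first_order : exists2 B : R, 0 < B &
  forall t, 0 <= t <= 1 -> frob (c t - c 0 - t *: derive1 c 0) <= B * t ^+ 2.
Proof.
have [B B0 c2_le] := derive1n_bounded (geodesic_smooth gc) 2 1.
exists B => // t /andP[t0 t1].
pose g s := c s - s *: derive1 c 0.
have -> : c t - c 0 - t *: derive1 c 0 = g t - g 0 by rewrite /g scale0r subr0 addrAC.
have gD s : is_derive s (1 : R) g (derive1 c s - derive1 c 0).
  exact: (is_deriveB (geodesic_is_derive gc s) (is_derive_scale _ s)).
rewrite (_ : B * t ^+ 2 = B * t * (t - 0)); last by rewrite subr0 expr2 mulrA.
apply: (frob_mean_value t0 (fun s _ => gD s)) => s /andP[s0 st].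
apply: (@le_trans _ _ (B * (s - 0))); last by rewrite ler_wpM2l ?subr0// ltW.
apply: (frob_mean_value s0 (fun x _ => geodesic_is_derive1 gc x)) => x /andP[x0 xs].
by apply: c2_le; rewrite x0 (le_trans xs)// (le_trans st).
Qed.

Lemma geodesic_segment_compact (T : R) : compact (c @` `[0, T]).
Proof.
apply: continuous_compact; last exact: segment_compact.
apply: continuous_subspaceT => s.
exact: smooth_on_continuous (geodesic_smooth gc) _.
Qed.

Lemma sample_second_difference (T : R) : exists2 B : R, 0 < B &
  forall (t : R) i, 0 < t <= 1 -> i.+1%:R * t <= T ->
    frob (second_difference (sample c t) i) <= B * t ^+ 2 /\
    forall u, tangent M (sample c t i.+1) u ->
      `|mxdot (second_difference (sample c t) i) u| <= B * t ^+ 3 * frob u.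
Proof.
have sc := geodesic_smooth gc.
have [K2 K20 c2_le] := derive1n_bounded sc 2 (T + 1).
have [K3 K30 c3_le] := derive1n_bounded sc 3 (T + 1).
exists (K2 + 2 * K3) => [|t i /andP[t0 t1]]; first by rewrite addr_gt0// mulr_gt0.
rewrite /second_difference /step /sample; set s := i.+1%:R * t => sT.
have -> : i.+2%:R * t = s + t by rewrite -natr1 mulrDl mul1r.
have -> : i%:R * t = s - t by rewrite /s -natr1 mulrDl mul1r addrK.
have ts : t <= s by rewrite /s ler_peMl ?(ltW t0)// ler1n.
have c2_lipschitz x : `|x - s| <= t ->
    frob (derive1n 2 c x - derive1n 2 c s) <= K3 * `|x - s|.
  have c3D y : is_derive y (1 : R) (derive1n 2 c) (derive1n 3 c y).
    exact: (is_derive_derive1n sc 2).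
  rewrite ler_norml => /andP[xs1 xs2].
  have [xs|/ltW xs] := leP x s; [rewrite frob_distC distrC|];
    rewrite ger0_norm ?subr_ge0//; apply: (frob_mean_value xs (fun y _ => c3D y)) => y ys;
    by apply: c3_le; move: xs1 xs2 ys; lra.
have approx := second_difference_approx (geodesic_is_derive gc) (geodesic_is_derive1 gc)
  (ltW t0) (ltW K30) c2_lipschitz.
set w := (w in frob (w - _)) in approx *.
have t20 : 0 <= t ^+ 2 by exact: sqr_ge0.
split=> [|u Tu].
  apply: le_trans (frob_le_distD _ (t ^+ 2 *: derive1n 2 c s)) _.
  rewrite frobZ ger0_norm// mulrDl; apply: lerD.
    by rewrite mulrC ler_wpM2r//; apply: c2_le; lra.
  apply: le_trans approx _; rewrite ler_wpM2l ?mulr_ge0 ?(ltW K30)//.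
  by rewrite exprS ler_piMl.
have -> : mxdot w u = mxdot (w - t ^+ 2 *: derive1n 2 c s) u.
  by rewrite [RHS]mxdotBl mxdotZl (geodesic_normal gc Tu) mulr0 subr0.
apply: le_trans (normr_mxdot_le _ _) _; apply: ler_wpM2r; first exact: frob_ge0.
by apply: le_trans approx _; rewrite ler_wpM2r ?exprn_ge0 ?(ltW t0)// lerDr ltW.
Qed.

End sampled_geodesics.

Section second_difference_stability.
Context {R : realType} {m n : nat}.
Implicit Types (p q : nat -> 'M[R]_(m, n)).

Definition position_gap p q i : R := frob (p i - q i).

Definition step_gap p q i : R := frob (step p i - step q i).

Definition step_total p q i : R := frob (step p i) + frob (step q i).

(* Bounds, up to a constant, the difference of the second differences of two
   sequences of points of a submanifold. *)
Definition second_difference_defect p q i : R :=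
  (frob (step q i.+1) ^+ 2 + frob (step q i) ^+ 2 + frob (second_difference q i))
    * position_gap p q i.+1
  + step_total p q i.+1 * step_gap p q i.+1 + step_total p q i * step_gap p q i.

Lemma position_gap_ge0 p q i : 0 <= position_gap p q i.
Proof. exact: frob_ge0. Qed.

Lemma step_gap_ge0 p q i : 0 <= step_gap p q i.
Proof. exact: frob_ge0. Qed.

Lemma step_total_ge0 p q i : 0 <= step_total p q i.
Proof. by rewrite addr_ge0 ?frob_ge0. Qed.

Lemma position_gapS_le p q i : position_gap p q i.+1 <= position_gap p q i + step_gap p q i.
Proof.
rewrite /position_gap /step_gap.
have -> : p i.+1 - q i.+1 = p i - q i + (step p i - step q i) by rewrite /step; mx_ring.
exact: frobD.
Qed.

Lemma step_gapS_le p q i :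
  step_gap p q i.+1 <= step_gap p q i + frob (second_difference p i - second_difference q i).
Proof.
rewrite /step_gap /second_difference.
have -> : step p i.+1 - step q i.+1 =
    step p i - step q i + (step p i.+1 - step p i - (step q i.+1 - step q i)).
  by move: (step _ _) (step _ _) (step _ _) => *; mx_ring.
exact: frobD.
Qed.

Lemma second_difference_defect_ge0 p q i : 0 <= second_difference_defect p q i.
Proof.
have gap_ge0 j : 0 <= step_total p q j * step_gap p q j.
  by rewrite mulr_ge0 ?step_total_ge0 ?step_gap_ge0.
rewrite /second_difference_defect; apply: addr_ge0 => //; apply: addr_ge0 => //.
by rewrite mulr_ge0 ?position_gap_ge0 ?addr_ge0 ?sqr_ge0 ?frob_ge0.
Qed.

Variables (M : set 'M[R]_(m, n)) (z : 'M[R]_(m, n)) (r C : R)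
  (F : 'M[R]_(m, n) -> 'M[R]_(m, n)).
Hypothesis eqF : local_equation M z r C F.

Lemma derive_second_difference p i :
  (forall j, (i <= j <= i.+2)%N -> fball z r (p j) /\ M (p j)) ->
  'D_(second_difference p i) F (p i.+1) =
  - (remainder F (p i.+1) (step p i.+1) + remainder F (p i.+1) (- step p i)).
Proof.
move=> pM; have F0 j : (i <= j <= i.+2)%N -> F (p j) = 0.
  by move=> /pM[pr] /(equationP eqF pr).
have [pr _] := pM i.+1 ltac:(by rewrite !leqnSn).
rewrite /remainder /second_difference (derive_dirD _ _ (equation_differentiable eqF pr)).
rewrite {2 4}/step opprB !subrKC !F0 ?leqnn ?leqnSn ?(leq_trans (leqnSn i))//.
by move: ('D_(step p i.+1) F (p i.+1)) ('D_(- step p i) F (p i.+1)) => a b; mx_ring.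
Qed.

Section two_sequences.
Variables (p q : nat -> 'M[R]_(m, n)) (i : nat).
Hypothesis near : forall j, (i <= j <= i.+2)%N ->
  [/\ fball z (r / 3) (p j), fball z (r / 3) (q j), M (p j) & M (q j)].

Let fball3 w : fball z (r / 3) w -> fball z r w.
Proof. by rewrite /fball/=; have := equation_radius_gt0 eqF; lra. Qed.

Let mid : (i <= i.+1 <= i.+2)%N. Proof. by rewrite !leqnSn. Qed.

Lemma remainder_gap_le (a b : 'M[R]_(m, n)) j : (i <= j <= i.+2)%N ->
  p i.+1 + a = p j -> q i.+1 + b = q j ->
  frob (remainder F (p i.+1) a - remainder F (q i.+1) b) <=
  C * (frob b ^+ 2 * frob (p i.+1 - q i.+1) + (frob a + frob b) * frob (a - b)).
Proof.
move=> ij aE bE; have [pr qr _ _] := near mid; have [pj qj _ _] := near ij.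
apply: (equation_lipschitz_remainder eqF); rewrite ?aE ?bE; try exact: fball3.
have -> : b = q j - q i.+1 by rewrite -bE addrAC subrr add0r.
rewrite /fball/=.
have -> : p i.+1 + (q j - q i.+1) - z = (p i.+1 - z) + ((q j - z) - (q i.+1 - z)) by mx_ring.
apply: le_lt_trans (frobD _ _) _; have := frobB (q j - z) (q i.+1 - z).
by move: pr qr qj; rewrite /fball/=; lra.
Qed.

Lemma derive_second_difference_defect :
  frob ('D_(second_difference p i - second_difference q i) F (p i.+1)) <=
  C * second_difference_defect p q i.
Proof.
have pM j : (i <= j <= i.+2)%N -> fball z r (p j) /\ M (p j).
  by move=> /near[/fball3].
have qM j : (i <= j <= i.+2)%N -> fball z r (q j) /\ M (q j).
  by move=> /near[_ /fball3].
have [pr _] := pM _ mid; have [qr _] := qM _ mid.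
have i0 : (i <= i <= i.+2)%N by rewrite leqnn (leq_trans (leqnSn i)).
have i2 : (i <= i.+2 <= i.+2)%N by rewrite leqnn (leq_trans (leqnSn i)).
have fwd := @remainder_gap_le (step p i.+1) (step q i.+1) _ i2 (subrKC _ _) (subrKC _ _).
have bwd : frob (remainder F (p i.+1) (- step p i) - remainder F (q i.+1) (- step q i)) <=
    C * (frob (step q i) ^+ 2 * frob (p i.+1 - q i.+1)
      + (frob (step p i) + frob (step q i)) * frob (step p i - step q i)).
  have := @remainder_gap_le (- step p i) (- step q i) _ i0.
  by rewrite !frobN -opprD frobN; apply; rewrite opprB subrKC.
have lip := equation_lipschitz_derive eqF (second_difference q i) pr qr.
have pE := derive_second_difference pM; have qE := derive_second_difference qM.
have -> : 'D_(second_difference p i - second_difference q i) F (p i.+1) =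
    - (remainder F (p i.+1) (step p i.+1) - remainder F (q i.+1) (step q i.+1))
    - (remainder F (p i.+1) (- step p i) - remainder F (q i.+1) (- step q i))
    - ('D_(second_difference q i) F (p i.+1) - 'D_(second_difference q i) F (q i.+1)).
  rewrite (derive_dirB _ _ (equation_differentiable eqF pr)) pE qE.
  move: (remainder F _ _) (remainder F _ _) (remainder F _ _) (remainder F _ _).
  by move: ('D_(second_difference q i) F (p i.+1)) => *; mx_ring.
apply: le_trans (frobB _ _) _; apply: le_trans (lerD (frobB _ _) lip) _; rewrite frobN.
apply: le_trans (lerD (lerD fwd bwd) (lexx _)) _.
rewrite /second_difference_defect /position_gap /step_total /step_gap.
by rewrite -subr_ge0 [leRHS](_ : _ = 0)//; ring.
Qed.

Hypothesis p_normal : forall u, tangent M (p i.+1) u -> mxdot (second_difference p i) u = 0.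
Variable eta : R.
Hypothesis eta0 : 0 <= eta.
Hypothesis q_normal : forall u, tangent M (q i.+1) u ->
  `|mxdot (second_difference q i) u| <= eta * frob u.

Lemma second_difference_le :
  frob (second_difference p i - second_difference q i) <=
  (1 + C ^+ 2) ^+ 2 * (second_difference_defect p q i + eta).
Proof.
have [/fball3 pr /fball3 qr Mp Mq] := near mid.
set D := second_difference_defect p q i; have D0 : 0 <= D := second_difference_defect_ge0 p q i.
have qD : frob (second_difference q i) * frob (p i.+1 - q i.+1) <= D.
  rewrite /D /second_difference_defect -addrA; apply: ler_wpDr.
    by rewrite addr_ge0 ?mulr_ge0 ?step_total_ge0 ?step_gap_ge0.
  by rewrite ler_wpM2r ?frob_ge0// lerDr addr_ge0 ?sqr_ge0.
have C20 : 0 <= C ^+ 2 by exact: sqr_ge0.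
have eta_D0 : 0 <= (1 + C ^+ 2) * eta + C ^+ 2 * D.
  by apply: addr_ge0; apply: mulr_ge0 => //; rewrite addr_ge0.
have normal u : tangent M (p i.+1) u ->
    `|mxdot (second_difference p i - second_difference q i) u| <=
    ((1 + C ^+ 2) * eta + C ^+ 2 * D) * frob u.
  move=> Tu; rewrite mxdotBl p_normal// sub0r normrN.
  apply: le_trans (equation_almost_normal eqF pr qr Mp Mq eta0 q_normal Tu) _.
  by rewrite ler_wpM2r ?frob_ge0// lerD2l -mulrA ler_wpM2l ?sqr_ge0.
apply: le_trans (equation_coercive eqF pr Mp eta_D0 normal) _.
have := ler_wpM2l (ltW (equation_bound_gt0 eqF)) derive_second_difference_defect.
rewrite -/D mulrA -expr2 => /lerD /(_ (lexx _))/le_trans; apply.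
rewrite -subr_ge0 (_ : _ - _ = D); first exact: D0.
by ring.
Qed.

End two_sequences.

End second_difference_stability.

Lemma second_difference_le_compact {R : realType} {m n d : nat} (M K : set 'M[R]_(m, n)) :
  embedded_submanifold d M -> compact K -> K `<=` M ->
  exists r C : R, [/\ 0 < r, 0 < C & forall (p q : nat -> 'M[R]_(m, n)) i (eta : R),
    K (q i.+1) ->
    (forall j, (i <= j <= i.+2)%N ->
      [/\ fball (q i.+1) r (p j), fball (q i.+1) r (q j), M (p j) & M (q j)]) ->
    (forall u, tangent M (p i.+1) u -> mxdot (second_difference p i) u = 0) ->
    0 <= eta ->
    (forall u, tangent M (q i.+1) u ->
      `|mxdot (second_difference q i) u| <= eta * frob u) ->
    frob (second_difference p i - second_difference q i) <=
    C * (second_difference_defect p q i + eta)].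
Proof.
move=> eM cK KM; have [||r [C [r0 C0 rC]]] := @compact_uniform_bounds _ _ _ K
  (fun x r C => forall (p q : nat -> 'M[R]_(m, n)) i (eta : R), q i.+1 = x ->
    (forall j, (i <= j <= i.+2)%N ->
      [/\ fball x r (p j), fball x r (q j), M (p j) & M (q j)]) ->
    (forall u, tangent M (p i.+1) u -> mxdot (second_difference p i) u = 0) ->
    0 <= eta ->
    (forall u, tangent M x u -> `|mxdot (second_difference q i) u| <= eta * frob u) ->
    frob (second_difference p i - second_difference q i) <=
    C * (second_difference_defect p q i + eta)) cK.
- move=> x r r' C C' rr CC rC p q i eta qx near pn eta0 qn.
  apply: le_trans (rC p q i eta qx _ pn eta0 qn) _.
    by move=> j /near[pj qj Mp Mq]; split=> //; exact: lt_le_trans rr.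
  by rewrite ler_wpM2r// addr_ge0// second_difference_defect_ge0.
- move=> z /KM Mz; have [r [C [F eqF]]] := local_equation_exists eM Mz.
  exists (r / 6), ((1 + C ^+ 2) ^+ 2).
  split=> [|x]; first by rewrite divr_gt0 ?(equation_radius_gt0 eqF).
  rewrite /fball/= => xz p q i eta qx near pn eta0; rewrite -qx => qn.
  apply: (second_difference_le eqF) => // j /near[pj qj Mp Mq]; split=> //.
    by apply: le_lt_trans (frob_dist_triangle x _ _) _; move: pj xz; rewrite /fball/=; lra.
  by apply: le_lt_trans (frob_dist_triangle x _ _) _; move: qj xz; rewrite /fball/=; lra.
exists r, C; split=> // p q i eta Kq; exact: (rC _ Kq p q i eta erefl).
Qed.

Lemma gronwall_implicit {R : realType} (Y mu : nat -> R) (k : R) n : 0 <= k ->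
  (forall i, (i <= n)%N -> 0 <= mu i <= 1 / 2) -> (forall i, 0 <= Y i) ->
  (forall i, (i < n)%N -> (1 - mu i.+1) * Y i.+1 <= (1 + mu i + k) * Y i) ->
  Y n <= expR (2 * mu n + 3 * (\sum_(i < n) mu i) + n%:R * k) * Y 0%N.
Proof.
move=> k0; elim: n => [|n IH] mu_le Y0 Y_step.
  rewrite big_ord0 mulr0 addr0 mul0r addr0 ler_peMl// -expR0 ler_expR mulr_ge0//.
  by case/andP: (mu_le 0%N isT).
have /andP[mu_ge0 _] := mu_le n (leqnSn n); have /andP[mu'0 mu'1] := mu_le n.+1 (leqnn _).
have invert : 1 <= expR (2 * mu n.+1) * (1 - mu n.+1).
  apply: le_trans (_ : (1 + 2 * mu n.+1) * (1 - mu n.+1) <= _); first by nra.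
  by rewrite ler_wpM2r ?expR_ge1Dx//; lra.
have growth : (1 + mu n + k) <= expR (mu n + k) by rewrite -addrA expR_ge1Dx.
have {}IH := IH (fun i iN => mu_le i (leqW iN)) Y0 (fun i iN => Y_step i (leqW iN)).
apply: le_trans (ler_peMl (Y0 _) invert) _; rewrite -mulrA.
apply: le_trans (ler_wpM2l (expR_ge0 _) (Y_step n (ltnSn n))) _.
apply: le_trans (ler_wpM2l (expR_ge0 _) (ler_pM _ (Y0 n) growth IH)) _.
  by rewrite !addr_ge0.
rewrite !mulrA -!expRD ler_wpM2r// ler_expR big_ord_recr/= -natr1.
lra.
Qed.

Lemma sum_prefix_le {R : numDomainType} (F : nat -> R) k N : (k <= N)%N ->
  (forall i, 0 <= F i) -> \sum_(i < k) F i <= \sum_(i < N) F i.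
Proof.
move=> kN F0; rewrite (big_ord_widen _ F kN) [leRHS](bigID (fun i : 'I_N => (i < k)%N))/=.
by rewrite lerDl sumr_ge0.
Qed.

Definition second_order_recursion {R : realType} (g G lam : nat -> R) (K B t : R) i : Prop :=
  G i.+1 <= G i +
    K * (B * t ^+ 2 * g i.+1 + lam i.+1 * G i.+1 + lam i * G i + B * t ^+ 3).

(* [g] and [G] are the errors in position and in increments, in units of length. *)
Lemma gronwall_second_order {R : realType} (g G lam : nat -> R) (K B t : R) n :
  0 <= K -> 0 <= B -> 0 < t <= 1 ->
  (forall i, [/\ 0 <= g i, 0 <= G i & 0 <= lam i]) ->
  (forall i, (i <= n)%N -> K * lam i <= 1 / 2) ->
  (forall i, g i.+1 <= g i + G i) ->
  (forall i, (i < n)%N -> second_order_recursion g G lam K B t i) ->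
  t * g n + G n <=
  expR (1 + 3 * K * (\sum_(i < n) lam i) + n%:R * t * (1 + K * B)) *
  (t * g 0%N + G 0%N + t ^+ 2).
Proof.
move=> K0 B0 /andP[t0 t1] gG0 lam_le g_step G_step.
have KB0 : 0 <= K * B by exact: mulr_ge0.
have kt0 : 0 <= (1 + K * B) * t by rewrite mulr_ge0 ?addr_ge0// ltW.
pose Y i := t * g i + G i + t ^+ 2.
have Y0 i : 0 <= Y i.
  by have [g0 G0 _] := gG0 i; rewrite /Y !addr_ge0 ?sqr_ge0// mulr_ge0// ltW.
have mu_le i : (i <= n)%N -> 0 <= K * lam i <= 1 / 2.
  by move=> iN; rewrite lam_le// andbT mulr_ge0//; case: (gG0 i).
have Y_step i : (i < n)%N ->
    (1 - K * lam i.+1) * Y i.+1 <= (1 + K * lam i + (1 + K * B) * t) * Y i.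
  move=> iN; have [g0 G0 l0] := gG0 i; have [g'0 G'0 l'0] := gG0 i.+1.
  have l'g' : 0 <= K * lam i.+1 * (t * g i.+1 + t ^+ 2).
    by rewrite !mulr_ge0// addr_ge0 ?sqr_ge0// mulr_ge0// ltW.
  have lg : 0 <= K * lam i * (t * g i + t ^+ 2).
    by rewrite !mulr_ge0// addr_ge0 ?sqr_ge0// mulr_ge0// ltW.
  have tg' : (1 + K * B * t) * (t * g i.+1) <= (1 + K * B * t) * (t * g i + t * G i).
    rewrite ler_wpM2l ?addr_ge0 ?mulr_ge0 ?(ltW t0)//.
    by rewrite -mulrDr ler_pM2l.
  have KBtt : K * B * t * (t * G i) <= K * B * t * G i.
    by rewrite ler_wpM2l ?mulr_ge0 ?(ltW t0)// ler_piMl.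
  have slack : 0 <= t * (t * g i + t ^+ 2).
    by rewrite mulr_ge0 ?addr_ge0 ?sqr_ge0 ?mulr_ge0 ?(ltW t0).
  by have := G_step i iN; rewrite /second_order_recursion /Y; move: l'g' lg tg' KBtt slack; lra.
have := gronwall_implicit kt0 mu_le Y0 Y_step.
have Yn : t * g n + G n <= Y n by rewrite /Y lerDl sqr_ge0.
move=> /(le_trans Yn)/le_trans; apply; rewrite ler_wpM2r// ler_expR -mulr_sumr.
by have := lam_le n (leqnn n); lra.
Qed.

Section tracking.
Context {R : realType} {m n : nat}.
Implicit Types (M : set 'M[R]_(m, n)) (c : R -> 'M[R]_(m, n)) (p q : nat -> 'M[R]_(m, n)).

Definition discrete_geodesic M p N : Prop :=
  (forall i, (i <= N)%N -> M (p i)) /\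
  forall i v, (i.+1 < N)%N -> tangent M (p i.+1) v -> mxdot (second_difference p i) v = 0.

Definition chain_length N p : R := \sum_(i < N) frob (step p i).

Lemma chain_length_ge0 N p : 0 <= chain_length N p.
Proof. by apply: sumr_ge0 => i _; exact: frob_ge0. Qed.

Lemma chain_length_le k N p : (k <= N)%N -> chain_length k p <= chain_length N p.
Proof.
by move=> kN; apply: (@sum_prefix_le _ (fun i => frob (step p i)) _ _ kN) => i; exact: frob_ge0.
Qed.

Definition tracks c p (t e : R) i : Prop :=
  position_gap p (sample c t) i <= e /\ step_gap p (sample c t) i <= e * t.

Lemma tracks_le c p (t e e' : R) i : 0 <= t -> e <= e' -> tracks c p t e i -> tracks c p t e' i.
Proof.
move=> t0 ee [pos inc]; split; first exact: le_trans ee.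
by apply: le_trans inc _; exact: ler_wpM2r.
Qed.

Section geodesic_tracking.
Variables (d : nat) (M : set 'M[R]_(m, n)) (c : R -> 'M[R]_(m, n)).
Hypothesis eM : embedded_submanifold d M.
Hypothesis gc : geodesic M c.

Local Notation speed := (frob (derive1 c 0)).

Lemma tracks_near p (t e dl r : R) i : 0 < t <= 1 -> tracks c p t e i ->
  frob (step p i) <= dl -> frob (step p i.+1) <= dl ->
  2 * e + dl < r -> speed * t < r ->
  forall j, (i <= j <= i.+2)%N ->
    fball (sample c t i.+1) r (p j) /\ fball (sample c t i.+1) r (sample c t j).
Proof.
move=> /andP[t0 t1] [pos inc] st st' er ct j.
have e0 : 0 <= e by exact: le_trans (frob_ge0 _) pos.
have next : frob (p i.+1 - sample c t i.+1) <= 2 * e.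
  apply: le_trans (position_gapS_le _ _ _) _; apply: le_trans (lerD pos inc) _.
  by have := ler_piMr e0 t1; lra.
have dl0 : 0 <= dl by exact: le_trans (frob_ge0 _) st.
have r0 : 0 < r by lra.
have st_c k : frob (step (sample c t) k) < r.
  exact: le_lt_trans (frob_step_sample_le gc _ (ltW t0)) ct.
rewrite leq_eqVlt => /andP[/orP[/eqP <- _|]].
  rewrite /fball/= (frob_distC (sample c t i)); split; last exact: st_c.
  apply: le_lt_trans (frob_dist_triangle (p i.+1) _ _) _; rewrite frob_distC -/(step p i).
  by lra.
rewrite leq_eqVlt => /orP[/eqP <- _|ij ji].
  by split; [rewrite /fball/=; lra|exact: fball_center].
have -> : j = i.+2 by apply/eqP; rewrite eqn_leq ji.
split; last exact: st_c.
apply: le_lt_trans (frob_dist_triangle (p i.+1) _ _) _; rewrite -/(step p i.+1).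
by lra.
Qed.

Lemma step_defect_recursion (T : R) : exists r C B : R,
  [/\ 0 < r, 0 < C, 0 < B & forall p (t : R) i, 0 < t <= 1 -> i.+1%:R * t <= T ->
    (forall j, (i <= j <= i.+2)%N -> [/\ M (p j), fball (sample c t i.+1) r (p j) &
      fball (sample c t i.+1) r (sample c t j)]) ->
    (forall u, tangent M (p i.+1) u -> mxdot (second_difference p i) u = 0) ->
    second_order_recursion (position_gap p (sample c t)) (step_gap p (sample c t))
      (step_total p (sample c t)) C B t i].
Proof.
have cM : c @` `[0, T] `<=` M by move=> _ [s _ <-]; exact: geodesic_M gc s.
have cK : compact (c @` `[0, T]) by exact: (@geodesic_segment_compact _ _ _ _ _ gc T).
have [r [C [r0 C0 rC]]] := second_difference_le_compact eM cK cM.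
have [B B0 cB] := sample_second_difference gc T.
exists r, C, (2 * speed ^+ 2 + B); split=> //.
  by rewrite ltr_wpDl// mulr_ge0// sqr_ge0.
move=> p t i t01 iT near pn; pose q := sample c t; have /andP[t0 t1] := t01.
have [sd_le sd_normal] := cB t i t01 iT.
have t30 : 0 <= t ^+ 3 by rewrite exprn_ge0// ltW.
have seg : (c @` `[0, T]) (q i.+1).
  by exists (i.+1%:R * t) => //=; rewrite in_itv/= iT mulr_ge0// ltW.
have eta0 : 0 <= B * t ^+ 3 by rewrite mulr_ge0// ltW.
have near4 j : (i <= j <= i.+2)%N ->
    [/\ fball (q i.+1) r (p j), fball (q i.+1) r (q j), M (p j) & M (q j)].
  by move=> /near[]; split=> //; exact: geodesic_M gc _.
have := rC p q i (B * t ^+ 3) seg near4 pn eta0 sd_normal.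
move=> sd_dist; apply: le_trans (step_gapS_le _ _ _) _.
rewrite lerD2l; apply: le_trans sd_dist _; rewrite ler_pM2l// /second_difference_defect.
have sqr_step k : frob (step q k) ^+ 2 <= speed ^+ 2 * t ^+ 2.
  rewrite -exprMn ler_pXn2r ?nnegrE ?mulr_ge0 ?frob_ge0 ?(ltW t0)//.
  exact: (frob_step_sample_le gc k (ltW t0)).
have coeff : (frob (step q i.+1) ^+ 2 + frob (step q i) ^+ 2 + frob (second_difference q i))
    * position_gap p q i.+1 <= (2 * speed ^+ 2 + B) * t ^+ 2 * position_gap p q i.+1.
  rewrite ler_wpM2r ?frob_ge0//; have := sqr_step i.+1; have := sqr_step i.
  by move: sd_le; rewrite -/q; lra.
have tail : B * t ^+ 3 <= (2 * speed ^+ 2 + B) * t ^+ 3.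
  by rewrite ler_wpM2r// lerDr mulr_ge0// sqr_ge0.
by apply: lerD tail; apply: lerD => //; apply: lerD.
Qed.

Lemma sum_step_total_le p N (T l t : R) k : 0 <= t -> chain_length N p <= l ->
  (k <= N)%N -> k%:R * t <= T ->
  \sum_(i < k) step_total p (sample c t) i <= l + speed * T.
Proof.
move=> t0 len kN kT; rewrite big_split/=; apply: lerD.
  exact: le_trans (chain_length_le p kN) len.
apply: (@le_trans _ _ (\sum_(i < k) speed * t)).
  by apply: ler_sum => i _; exact: (frob_step_sample_le gc).
by rewrite sumr_const card_ord -mulr_natl mulrCA ler_wpM2l ?frob_ge0.
Qed.

Lemma initial_step_gap_le : exists2 B : R, 0 < B & forall p (t dl : R), 0 <= t <= 1 ->
  p 0%N = c 0 -> frob (step p 0%N - t *: derive1 c 0) <= dl * t ->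
  step_gap p (sample c t) 0%N <= (dl + B * t) * t.
Proof.
have [B B0 first_order] := geodesic_first_order gc; exists B => // p t dl t01 p0 init.
apply: le_trans (frob_dist_triangle (t *: derive1 c 0) _ _) _; rewrite mulrDl.
apply: lerD => //; rewrite frob_distC -mulrA -expr2; apply: le_trans (first_order t t01).
by rewrite /step /sample mul1r mul0r.
Qed.

(* With [K], [B] from the recursion and [B1] from the initial step, the distance
   of a chain to the geodesic is at most this constant times the mesh. *)
Definition tracking_constant (T l K B B1 : R) : R :=
  (2 + B1) * expR (1 + 3 * K * (l + speed * T) + T * (1 + K * B)).

Lemma tracking_constant_gt0 (T l K B B1 : R) : 0 < B1 -> 0 < tracking_constant T l K B B1.
Proof. by move=> B10; rewrite mulr_gt0 ?expR_gt0// addr_gt0. Qed.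

Lemma recursion_tracks (T l K B B1 dl t : R) p N k :
  0 <= K -> 0 <= B -> 0 <= B1 -> 0 < t <= dl -> dl <= 1 -> K * ((1 + speed) * dl) <= 1 / 2 ->
  chain_length N p <= l -> (forall i, (i < N)%N -> frob (step p i) <= dl) ->
  (k < N)%N -> k%:R * t <= T -> p 0%N = c 0 ->
  step_gap p (sample c t) 0%N <= (dl + B1 * t) * t ->
  (forall i, (i < k)%N ->
    second_order_recursion (position_gap p (sample c t)) (step_gap p (sample c t))
      (step_total p (sample c t)) K B t i) ->
  tracks c p t (tracking_constant T l K B B1 * dl) k.
Proof.
move=> K0 B0 B10 /andP[t0 tdl] dl1 Kdl len steps kN kT p0 gap0 recursion.
have t1 : t <= 1 by exact: le_trans dl1.
have total_le i : (i <= k)%N -> K * step_total p (sample c t) i <= 1 / 2.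
  move=> ik; apply: le_trans Kdl; rewrite ler_wpM2l// mulrDl mul1r lerD//.
    exact: steps (leq_ltn_trans ik kN).
  apply: le_trans (frob_step_sample_le gc _ (ltW t0)) _.
  by rewrite ler_wpM2l ?frob_ge0.
have gap_ge0 i : [/\ 0 <= position_gap p (sample c t) i, 0 <= step_gap p (sample c t) i &
    0 <= step_total p (sample c t) i].
  by rewrite position_gap_ge0 step_gap_ge0 step_total_ge0.
have t01 : 0 < t <= 1 by rewrite t0.
have := gronwall_second_order K0 B0 t01 gap_ge0 total_le (position_gapS_le p _) recursion.
set E := expR _; set Y0 := t * _ + _ + _ => Gk.
have E_le : E <= expR (1 + 3 * K * (l + speed * T) + T * (1 + K * B)).
  rewrite ler_expR lerD ?lerD2l//; last by rewrite ler_wpM2r// addr_ge0 ?mulr_ge0.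
  rewrite ler_wpM2l ?mulr_ge0//; exact: sum_step_total_le (ltW t0) len (ltnW kN) kT.
have Y0_le : Y0 <= (2 + B1) * dl * t.
  rewrite /Y0 /position_gap p0 /sample mul0r subrr frob0 mulr0 add0r.
  have B1t : B1 * t <= B1 * dl by rewrite ler_wpM2l.
  apply: le_trans (lerD gap0 (lexx _)) _; rewrite expr2 -mulrDl ler_pM2r//.
  by move: B1t tdl; lra.
have {}Gk : t * position_gap p (sample c t) k + step_gap p (sample c t) k <=
    tracking_constant T l K B B1 * dl * t.
  have Y00 : 0 <= Y0 by rewrite !addr_ge0 ?sqr_ge0 ?step_gap_ge0 ?mulr_ge0 ?frob_ge0// ltW.
  apply: le_trans Gk _; apply: le_trans (ler_pM (expR_ge0 _) Y00 E_le Y0_le) _.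
  by rewrite /tracking_constant; lra.
have g0 := position_gap_ge0 p (sample c t) k; have G0 := step_gap_ge0 p (sample c t) k.
split; last by apply: le_trans Gk; rewrite lerDr mulr_ge0// ltW.
by rewrite -(ler_pM2r t0) mulrC; apply: le_trans Gk; rewrite lerDl.
Qed.

(* What the mesh of a chain must satisfy for the recursion to propagate along it. *)
Lemma admissible_mesh (r K c0 e : R) : 0 < r -> 0 < K -> 0 < c0 -> 0 < e ->
  exists2 dl : R, 0 < dl &
    [/\ dl <= 1, dl < r / 4, speed * dl < r, K * ((1 + speed) * dl) <= 1 / 2 & c0 * dl <= e].
Proof.
move=> r0 K0 c00 e0; have s1 : 0 < 1 + speed by rewrite ltr_pwDl ?frob_ge0.
near (0 : R)^'+ => dl; have dl0 : 0 < dl by near: dl; exact: nbhs_right_gt.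
exists dl => //; split.
- by near: dl; exact: nbhs_right_le.
- by near: dl; apply: nbhs_right_lt; rewrite divr_gt0.
- apply: (@le_lt_trans _ _ ((1 + speed) * dl)); first by rewrite ler_pM2r// lerDr.
  by rewrite mulrC -ltr_pdivlMr//; near: dl; apply: nbhs_right_lt; rewrite divr_gt0.
- rewrite mulrA mulrC -ler_pdivlMr; last exact: mulr_gt0.
  by near: dl; apply: nbhs_right_le; rewrite !divr_gt0// mulr_gt0.
- by rewrite mulrC -ler_pdivlMr//; near: dl; apply: nbhs_right_le; rewrite divr_gt0.
Unshelve. all: by end_near. Qed.

Lemma discrete_geodesic_tracks (T l e : R) : 0 < e -> exists2 dl : R, 0 < dl &
  forall p N (t : R), discrete_geodesic M p N -> chain_length N p <= l ->
    (forall i, (i < N)%N -> frob (step p i) <= dl) ->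
    p 0%N = c 0 -> 0 < t <= dl -> frob (step p 0%N - t *: derive1 c 0) <= dl * t ->
    forall i, (i < N)%N -> i%:R * t <= T -> tracks c p t e i.
Proof.
move=> e0; have [r [K [B [r0 K0 B0 recursion]]]] := step_defect_recursion T.
have [B1 B10 initial_gap] := initial_step_gap_le.
pose e' := Num.min e (r / 4); have e'0 : 0 < e' by rewrite lt_min e0 divr_gt0.
have e'r : e' <= r / 4 by rewrite ge_min lexx orbT.
have [dl dl0 [dl1 dlr dls dlK dle]] :=
  admissible_mesh r0 K0 (tracking_constant_gt0 T l K B B10) e'0.
exists dl => // p N t [pM pn] len steps p0 /andP[t0 tdl] init k kN kT.
have t1 : t <= 1 by exact: le_trans dl1.
apply: (@tracks_le _ _ _ e'); [exact: ltW|by rewrite ge_min lexx|].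
elim/ltn_ind: k kN kT => k IH kN kT.
apply: (tracks_le (ltW t0) dle).
apply: (@recursion_tracks _ _ _ _ _ _ _ p N) => //; rewrite ?(ltW K0) ?(ltW B0) ?(ltW B10) ?t0//.
  by apply: initial_gap => //; rewrite (ltW t0).
move=> i ik; have iN : (i.+1 < N)%N by exact: leq_ltn_trans ik kN.
have iT j : (j <= k)%N -> j%:R * t <= T.
  by move=> jk; apply: le_trans kT; rewrite ler_pM2r// ler_nat.
apply: recursion; rewrite ?t0 ?iT//; last by move=> u; exact: pn.
move=> j ij.
have er : 2 * e' + dl < r by lra.
have tr : speed * t < r by apply: le_lt_trans dls; rewrite ler_wpM2l ?frob_ge0.
have t01 : 0 < t <= 1 by rewrite t0.
have [pr qr] := tracks_near t01 (IH i ik (ltnW iN) (iT i (ltnW ik)))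
  (steps i (ltnW iN)) (steps _ iN) er tr ij.
by split=> //; apply: pM; case/andP: ij => _ /leq_trans; apply.
Qed.

End geodesic_tracking.
End tracking.

(** * Paths in a submanifold *)

Section reach.
Context {R : realType} {m n : nat}.
Implicit Types (M : set 'M[R]_(m, n)) (x y q : 'M[R]_(m, n)) (r : R) (g : R -> 'M[R]_(m, n)).

Definition lipschitz_path M g (T l : R) : Prop :=
  (forall s, 0 <= s <= T -> M (g s)) /\
  forall s s', 0 <= s -> s <= s' -> s' <= T -> frob (g s' - g s) <= l * (s' - s).

Definition reach M x r q : Prop := exists g, [/\ g 0 = x, g r = q & lipschitz_path M g r 1].

Lemma reach_M M x r q : 0 <= r -> reach M x r q -> M q.
Proof. by move=> r0 [g [_ <- [gM _]]]; apply: gM; rewrite r0 lexx. Qed.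

Lemma reach_dist M x r q : 0 <= r -> reach M x r q -> frob (q - x) <= r.
Proof.
by move=> r0 [g [<- <- [_ gl]]]; have := gl 0 r (lexx 0) r0 (lexx r); rewrite subr0 mul1r.
Qed.

Lemma reach_refl M x r : M x -> reach M x r x.
Proof.
move=> Mx; exists (fun=> x); split=> //; split=> // s s' _ ss _.
by rewrite subrr frob0 mul1r subr_ge0.
Qed.

Lemma reach_cat M x y q r r' : 0 <= r -> 0 <= r' -> reach M x r y -> reach M y r' q ->
  reach M x (r + r') q.
Proof.
move=> r0 r'0 [g [g0 gr [gM gl]]] [h [h0 hr [hM hl]]].
have glue s : r <= s -> (if s <= r then g s else h (s - r)) = h (s - r).
  rewrite le_eqVlt => /orP[/eqP <-|rs]; first by rewrite lexx gr subrr h0.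
  by rewrite leNgt rs.
exists (fun s => if s <= r then g s else h (s - r)); split; first by rewrite r0.
  by rewrite glue ?lerDl// addrAC subrr add0r.
split=> [s /andP[s0 sr]|s s' s0 ss' s'r].
  by case: leP => sr'; [apply: gM; rewrite s0|apply: hM; lra].
have [sr|rs] := leP s r; have [s'r'|rs'] := leP s' r; last 1 first.
- by apply: le_trans (hl _ _ _ _ _) _; lra.
- exact: gl.
- apply: le_trans (frob_dist_triangle y _ _) _.
  have h_le : frob (h (s' - r) - y) <= 1 * (s' - r - 0) by rewrite -h0; apply: hl; lra.
  have g_le : frob (y - g s) <= 1 * (r - s) by rewrite -gr; exact: gl.
  by move: h_le g_le; lra.
- lra.
Qed.

Lemma reach_le M x q r r' : 0 <= r -> r <= r' -> reach M x r q -> reach M x r' q.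
Proof.
move=> r0 rr' xq; have := reach_cat r0 (_ : 0 <= r' - r) xq (reach_refl _ (reach_M r0 xq)).
by rewrite subrKC subr_ge0; exact.
Qed.

Lemma reach_shorten M x r q (e : R) : 0 <= e <= r -> reach M x r q ->
  exists2 q', reach M x (r - e) q' & frob (q - q') <= e.
Proof.
move=> e0r [g [g0 gr [gM gl]]]; exists (g (r - e)).
  exists g; split=> //; split=> [s sr|s s' s0 ss' s'r]; first by apply: gM; lra.
  by apply: gl; lra.
by rewrite -gr; apply: le_trans (gl _ _ _ _ _) _; lra.
Qed.

Lemma lipschitz_path_reach M g (T l : R) : 0 <= T -> 0 <= l -> lipschitz_path M g T l ->
  reach M (g 0) (l * T) (g T).
Proof.
move=> T0; rewrite le_eqVlt => /orP[/eqP <-|l0] [gM gl].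
  have -> : g T = g 0.
    apply/eqP; rewrite -subr_eq0 -frob_eq0 eq_le frob_ge0 andbT.
    by have := gl 0 T (lexx 0) T0 (lexx T); rewrite mul0r.
  by apply: reach_refl; apply: gM; rewrite lexx.
exists (fun s => g (s / l)); rewrite mul0r mulrAC divff ?gt_eqF// mul1r.
have le_div s : (s / l <= T) = (s <= l * T) by rewrite ler_pdivrMr// mulrC.
split=> //; split=> [s /andP[s0 sT]|s s' s0 ss' s'T].
  by apply: gM; rewrite le_div sT divr_ge0// ltW.
apply: le_trans (gl (s / l) (s' / l) _ _ _) _; rewrite ?le_div ?divr_ge0 ?(ltW l0)//.
  by rewrite ler_pM2r ?invr_gt0.
by rewrite -mulrBl mulrCA divff ?gt_eqF// mulr1 mul1r.
Qed.

Lemma closure_reach_compact M x r : 0 <= r -> compact (closure (reach M x r)).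
Proof.
move=> r0; apply: (@frob_bounded_closed_compact _ _ _ _ (frob x + r + 1)).
  exact: closed_closure.
move=> y /closure_frobP/(_ 1 ltr01)[q /(reach_dist r0) qx yq].
by have := frob_le_distD y q; have := frob_le_distD q x; move: qx yq; lra.
Qed.

Lemma reach_closure M x s r y : 0 <= s -> s <= r -> reach M x s y -> closure (reach M x r) y.
Proof. by move=> s0 sr xy; apply: subset_closure; exact: reach_le xy. Qed.

End reach.

Section nearly_straight_paths.
Context {R : realType} {m n : nat}.
Implicit Types (M : set 'M[R]_(m, n)) (x y z : 'M[R]_(m, n)).

Lemma derive_near_increment (h : 'M[R]_(m, n) -> 'M[R]_(m, n)) z r C w a (s : R) :
  0 <= C -> (forall x, fball z r x -> differentiable h x) -> lipschitz_derive h z r C ->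
  fball z r w -> fball z r (w + a) -> 0 <= s <= 1 ->
  frob ('D_a h (w + s *: a) - (h (w + a) - h w)) <= C * frob a ^+ 2.
Proof.
move=> C0 hd hC wr war s01; set b := 'D_a h (w + s *: a).
have inr (u : R) : 0 <= u <= 1 -> fball z r (w + u *: a) by exact: fball_segment.
pose g (u : R) := h (w + u *: a) - (0 + u *: b).
have gD (u : R) : 0 <= u <= 1 -> is_derive u 1 g ('D_a h (w + u *: a) - b).
  move=> /inr/hd du; exact: is_deriveB (is_derive_along_line du) (is_derive_line 0 b u).
have -> : b - (h (w + a) - h w) = - (g 1 - g 0).
  rewrite /g !scale1r !scale0r !addr0; move: (h _) (h _) => p1 p2; mx_ring.
rewrite frobN; apply: (frob_mean_value01 gD) => u u01.
apply: le_trans (hC _ _ _ (inr u u01) (inr s s01)) _; rewrite expr2 mulrA.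
apply: ler_wpM2l; first by rewrite mulr_ge0 ?frob_ge0.
have -> : w + u *: a - (w + s *: a) = (u - s) *: a by mx_ring.
by rewrite frobZ ler_piMl ?frob_ge0// ler_norml; lra.
Qed.

Lemma slice_segment_path M U V phi psi S z r C w a (l : R) :
  slice_chart M U V phi psi S -> fball z r `<=` V -> 0 <= C -> lipschitz_derive psi z r C ->
  fball z r w -> fball z r (w + a) -> w \in S -> w + a \in S ->
  frob (psi (w + a) - psi w) + C * frob a ^+ 2 <= l ->
  lipschitz_path M (fun s => psi (w + s *: a)) 1 l.
Proof.
move=> ch rV C0 psiC wr war wS waS al.
have inr (s : R) : 0 <= s <= 1 -> fball z r (w + s *: a) by exact: fball_segment.
have dpsi x : fball z r x -> differentiable psi x.
  by move=> /rV; exact: smooth_on_differentiable (slice_inv_smooth ch).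
split=> [s /inr/rV Vs|s s' s0 ss' s'1].
  have [Us psiK] := slice_invK ch Vs; apply/(sliceP ch Us).
  by rewrite psiK -(addrK w a) (addrC a) memvD// memvZ// memvB.
apply: (@frob_mean_value _ _ _ (fun u => psi (w + u *: a)) (fun u => 'D_a psi (w + u *: a))
  s s' l ss') => u u_in; have u01 : 0 <= u <= 1 by move: u_in; lra.
  exact: is_derive_along_line (dpsi _ (inr u u01)).
apply: le_trans (frob_le_distD _ (psi (w + a) - psi w)) _; apply: le_trans al.
by rewrite lerD2l; exact: (derive_near_increment C0 dpsi psiC).
Qed.

Lemma slice_chart_bounds M U V phi psi S z : slice_chart M U V phi psi S -> U z ->
  exists2 C : R, 0 < C & \forall rho \near 0^'+,
    [/\ fball (phi z) rho `<=` V, lipschitz_derive psi (phi z) rho C &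
        \forall r \near 0^'+, forall x, fball z r x ->
          [/\ U x, fball (phi z) rho (phi x) & forall v, frob ('D_v phi x) <= C * frob v]].
Proof.
move=> ch Uz; have oU := slice_domain_open ch; have oV := slice_image_open ch.
have sphi := slice_smooth ch; have spsi := slice_inv_smooth ch; have [Vz _] := sliceK ch Uz.
near (pinfty_nbhs R) => C; exists C; first by near: C; exact: nbhs_pinfty_gt (num_real 0).
have psiC : \forall r \near 0^'+, lipschitz_derive psi (phi z) r C.
  by near: C; exact: smooth_lipschitz_derive oV Vz spsi.
have phiC : \forall x \near z, forall v, frob ('D_v phi x) <= C * frob v.
  by near: C; exact: smooth_bounded_derive oU Uz sphi.
near=> rho; have rho0 : 0 < rho by near: rho; exact: nbhs_right_gt.
split; last first.
- apply: near_fball; have phi_rho : \forall x \near z, fball (phi z) rho (phi x).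
    by apply: near_continuous (smooth_on_continuous sphi Uz) _; exact: nbhs_fball.
  by apply: filterS3 (open_nbhs_nbhs (conj oU Uz)) phi_rho phiC => x; split.
- by near: rho.
- by near: rho; apply: near_fball; exact: open_nbhs_nbhs.
Unshelve. all: by end_near. Qed.

(* The path is the image under a slice chart of the segment between the two points. *)
Lemma nearly_straight_path M z d (e : R) : embedded_submanifold d M -> M z -> 0 < e ->
  exists2 r : R, 0 < r & forall x y, fball z r x -> fball z r y -> M x -> M y ->
    reach M x ((1 + e) * frob (y - x)) y.
Proof.
move=> eM Mz e0; have [U [V [phi [psi [S [Uz ch]]]]]] := slice_chart_exists eM Mz.
have [C C0 bounds] := slice_chart_bounds ch Uz.
near (0 : R)^'+ => rho.
have [rhoV psiC near_z] : [/\ fball (phi z) rho `<=` V, lipschitz_derive psi (phi z) rho C &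
    \forall r \near 0^'+, forall x, fball z r x ->
      [/\ U x, fball (phi z) rho (phi x) & forall v, frob ('D_v phi x) <= C * frob v]].
  by near: rho.
have rho_small : C * C * 2 * rho <= e.
  rewrite mulrC -ler_pdivlMr ?mulr_gt0//; near: rho; apply: nbhs_right_le.
  by rewrite divr_gt0// !mulr_gt0.
near (0 : R)^'+ => r; have r0 : 0 < r by near: r; exact: nbhs_right_gt.
have in_chart : forall x, fball z r x ->
    [/\ U x, fball (phi z) rho (phi x) & forall v, frob ('D_v phi x) <= C * frob v] by near: r.
exists r => // x y xr yr Mx My.
have [Ux xrho _] := in_chart x xr; have [Uy yrho _] := in_chart y yr.
pose a := phi y - phi x; have aE : phi x + a = phi y by rewrite subrKC.
have [_ xK] := sliceK ch Ux; have [_ yK] := sliceK ch Uy.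
have a_le : frob a <= C * frob (y - x).
  apply: (@bounded_derive_lipschitz _ _ _ _ _ phi z r C) => // [w|w v] /in_chart[] //.
  by move=> Uw _ _; exact: smooth_on_differentiable (slice_smooth ch) Uw.
have a_rho : frob a <= 2 * rho.
  have := frob_dist_triangle (phi z) (phi y) (phi x); rewrite (frob_distC (phi z)) -/a.
  by move: xrho yrho; rewrite /fball/=; lra.
have l0 : 0 <= (1 + e) * frob (y - x) by rewrite mulr_ge0 ?frob_ge0// addr_ge0// ltW.
have path : lipschitz_path M (fun s : R => psi (phi x + s *: a)) 1 ((1 + e) * frob (y - x)).
  apply: (slice_segment_path ch rhoV (ltW C0) psiC); rewrite ?aE.
  - exact: xrho.
  - exact: yrho.
  - exact/(sliceP ch Ux).
  - exact/(sliceP ch Uy).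
  rewrite xK yK mulrDl mul1r lerD2l expr2.
  apply: le_trans (ler_wpM2l (ltW C0) (ler_pM (frob_ge0 _) (frob_ge0 _) a_rho a_le)) _.
  apply: le_trans (ler_wpM2r (frob_ge0 _) rho_small).
  lra.
have := lipschitz_path_reach ler01 l0 path.
by rewrite scale0r addr0 scale1r aE xK yK mulr1.
Unshelve. all: by end_near. Qed.

Lemma nearly_straight_path_compact M K d (e : R) : embedded_submanifold d M ->
  compact K -> K `<=` M -> 0 < e ->
  exists2 r : R, 0 < r & forall x y, K x -> fball x r y -> M y ->
    reach M x ((1 + e) * frob (y - x)) y.
Proof.
move=> eM cK KM e0; have [|r r0 rP] := compact_uniform_pairs
  (P := fun x y => M x -> M y -> reach M x ((1 + e) * frob (y - x)) y) cK.
  by move=> z /KM Mz; exact: nearly_straight_path eM Mz e0.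
by exists r => // x y Kx xy; apply: rP => //; exact: KM.
Qed.

End nearly_straight_paths.

(** * Discrete geodesics as energy minimisers *)

Lemma sqr_sum_le {R : realType} N (a : nat -> R) :
  (\sum_(i < N) a i) ^+ 2 <= N%:R * \sum_(i < N) a i ^+ 2.
Proof.
pose u : 'rV[R]_N := \row_i a i; pose v : 'rV[R]_N := const_mx 1.
have -> : \sum_(i < N) a i = mxdot u v.
  by rewrite /mxdot big_ord1; apply: eq_bigr => i _; rewrite !mxE mulr1.
have -> : \sum_(i < N) a i ^+ 2 = frob u ^+ 2.
  by rewrite sqr_frob /mxdot big_ord1; apply: eq_bigr => i _; rewrite !mxE expr2.
have -> : N%:R = frob v ^+ 2.
  rewrite sqr_frob /mxdot big_ord1 -[N in LHS]card_ord -sumr_const.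
  by apply: eq_bigr => i _; rewrite !mxE mulr1.
rewrite -exprMn mulrC -real_normK ?num_real//.
by rewrite ler_pXn2r ?nnegrE ?mulr_ge0 ?frob_ge0// normr_mxdot_le.
Qed.

Section energy.
Context {R : realType} {m n : nat}.
Implicit Types (K M : set 'M[R]_(m, n)) (p : nat -> 'M[R]_(m, n)).

Definition energy N p : R := \sum_(i < N) frob (step p i) ^+ 2.

Lemma energy_le k N p : (k <= N)%N -> energy k p <= energy N p.
Proof.
move=> kN; apply: (@sum_prefix_le _ (fun i => frob (step p i) ^+ 2)) => // i.
exact: sqr_ge0.
Qed.

Lemma sqr_step_le_energy N p i : (i < N)%N -> frob (step p i) ^+ 2 <= energy N p.
Proof.
move=> iN; apply: le_trans (energy_le p iN); rewrite /energy big_ord_recr/= lerDr.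
by apply: sumr_ge0 => j _; exact: sqr_ge0.
Qed.

Lemma sqr_chain_length_le N p : chain_length N p ^+ 2 <= N%:R * energy N p.
Proof. exact: (sqr_sum_le N (fun i => frob (step p i))). Qed.

Lemma energy_replace p N i y : (i.+1 < N)%N ->
  energy N (fun j => if j == i.+1 then y else p j) - energy N p =
  frob (y - p i) ^+ 2 + frob (p i.+2 - y) ^+ 2
  - (frob (p i.+1 - p i) ^+ 2 + frob (p i.+2 - p i.+1) ^+ 2).
Proof.
move=> iN; pose a := Ordinal (ltnW iN); pose b := Ordinal iN.
have ba : b != a by rewrite -val_eqE/= gtn_eqF.
have energyE f : energy N f = frob (f i.+1 - f i) ^+ 2 + (frob (f i.+2 - f i.+1) ^+ 2 +
     \sum_(j < N | (j != a) && (j != b)) frob (step f j) ^+ 2).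
  by rewrite /energy (bigD1 a)//= (bigD1 b).
rewrite (energyE p) energyE !eqxx (ltn_eqF (ltnSn i)) (gtn_eqF (ltnSn i.+1)).
rewrite (eq_bigr (fun j : 'I_N => frob (step p j) ^+ 2)) => [|j /andP[]].
  by move: (\sum_(_ | _) _) => *; ring.
by rewrite -!val_eqE/= /step eqSS => /negbTE-> /negbTE->.
Qed.

Lemma energy_continuous N :
  continuous (energy N : prod_topology (fun _ : nat => 'M[R]_(m, n)) -> R).
Proof.
rewrite /energy; apply: continuous_big => [|i _]; first exact: add_continuous.
pose T := prod_topology (fun _ : nat => 'M[R]_(m, n)); move=> p.
apply: (@continuous_comp T _ _ (fun f => frob (step f i)) (fun b => b ^+ 2)); last first.
  exact: exprn_continuous.
apply: (@continuous_comp T _ _ (fun f => step f i) (@frob R m n)); last exact: frob_continuous.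
have prj k : {for p, continuous (fun f : T => f k)}.
  exact: (@proj_continuous _ (fun _ : nat => 'M[R]_(m, n)) k).
exact: (continuousB (prj i.+1) (prj i)).
Qed.

Definition energy_minimal K N p : Prop :=
  (forall i, K (p i)) /\ forall p', p' 0%N = p 0%N -> p' N = p N ->
    (forall i, K (p' i)) -> energy N p <= energy N p'.

Lemma energy_minimal_exists K N p0 : compact K -> (forall i, K (p0 i)) ->
  exists p, [/\ p 0%N = p0 0%N, p N = p0 N & energy_minimal K N p].
Proof.
move=> cK Kp0; pose A i := if (i == 0%N) || (i == N) then [set p0 i] else K.
have cA i : compact (A i) by rewrite /A; case: ifP => // _; exact: compact_set1.
pose chains := [set f : prod_topology (fun _ : nat => 'M[R]_(m, n)) | forall i, A i (f i)].
have chains_compact : compact chains := tychonoff cA.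
have chains0 : chains !=set0 by exists p0 => i; rewrite /A; case: ifP.
have [p /set_mem pA pmin] := compact_EVT_min chains0 chains_compact
  (continuous_subspaceT (@energy_continuous N)).
have p_0 : p 0%N = p0 0%N by have := pA 0%N; rewrite /A eqxx.
have p_N : p N = p0 N by have := pA N; rewrite /A eqxx orbT.
exists p; split=> //; split=> [i|p' p'0 p'N Kp'].
  by have := pA i; rewrite /A; case: ifP => // _ ->; exact: Kp0.
apply: pmin; apply/mem_set => i; rewrite /A.
by case: ifPn => // /orP[] /eqP ->; rewrite ?p'0 ?p'N.
Qed.

(* First variation: [s |-> |c s - p|^2 + |q - c s|^2] is minimal at [s = 0]. *)
Lemma minimal_midpoint_normal M (p q y v : 'M[R]_(m, n)) (e : R) : 0 < e ->
  (forall x, M x -> fball y e x ->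
     frob (y - p) ^+ 2 + frob (q - y) ^+ 2 <= frob (x - p) ^+ 2 + frob (q - x) ^+ 2) ->
  tangent M y v -> mxdot (q - y - (y - p)) v = 0.
Proof.
move=> e0 ymin [c [I [oI I0 sc cM c0]] cv].
pose f (s : R) := mxdot (c s - p) (c s - p) + mxdot (q - c s) (q - c s).
have cD s : I s -> is_derive s (1 : R) c (derive1 c s).
  move=> Is; rewrite derive1E; apply: derivableP; apply/derivable1_diffP.
  exact: smooth_on_differentiable sc Is.
have fD s : I s -> is_derive s (1 : R) f
    (2 * mxdot (derive1 c s) (c s - p) - 2 * mxdot (derive1 c s) (q - c s)).
  move=> Is; have leftD := is_deriveB (cD s Is) (is_derive_cst p s (1 : R)).
  have rightD := is_deriveB (is_derive_cst q s (1 : R)) (cD s Is).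
  have := is_deriveD (is_derive_mxdot leftD leftD) (is_derive_mxdot rightD rightD).
  move=> /is_derive_eq; apply; rewrite subr0 sub0r /= mxdotNl mxdotNr.
  by rewrite !(mxdotC _ (derive1 c s)); ring.
have near_y : \forall s \near (0 : R), I s /\ fball y e (c s).
  apply: filterI; first exact: open_nbhs_nbhs.
  have cc : {for (0 : R), continuous c} by exact: smooth_on_continuous sc I0.
  by rewrite -c0; apply: (near_continuous cc); exact: nbhs_fball.
have [a /= a0 aP] := (nbhs_normP _ _).1 near_y.
have inI s : s \in `]-a, a[%R -> I s /\ fball y e (c s).
  by rewrite in_itv/= => sa; apply: aP; rewrite /ball_/= sub0r normrN ltr_norml.
have in0 : (0 : R) \in `]-a, a[%R by rewrite in_itv/= oppr_lt0 a0.
have [|s /inI[/fD[]]//|s /inI[Is se]|_] := @derive1_at_min R f (- a) a 0 _ _ in0; first lra.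
  by rewrite /f -!sqr_frob c0; apply: ymin => //; exact: cM.
by have [_ ->] := fD 0 I0; rewrite c0 cv mxdotBl !(mxdotC _ v); lra.
Qed.

Lemma energy_minimal_normal M K N p i v (e : R) : energy_minimal K N p -> (i.+1 < N)%N ->
  0 < e -> (forall x, M x -> fball (p i.+1) e x -> K x) ->
  tangent M (p i.+1) v -> mxdot (second_difference p i) v = 0.
Proof.
move=> [Kp pmin] iN e0 inK; apply: (minimal_midpoint_normal e0) => x Mx xe.
rewrite -subr_ge0 -(energy_replace p x iN) subr_ge0; apply: pmin; rewrite ?(gtn_eqF iN)//.
by move=> j; case: ifP => // _; exact: inK.
Qed.

End energy.

Section discrete_geodesics.
Context {R : realType} {m n : nat} (M : set 'M[R]_(m, n)).
Implicit Types (p : nat -> 'M[R]_(m, n)) (x q : 'M[R]_(m, n)).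

Lemma path_subdivision x (r : R) q N : 0 <= r -> (0 < N)%N -> reach M x r q ->
  exists p, [/\ p 0%N = x, p N = q, forall i, reach M x r (p i) & N%:R * energy N p <= r ^+ 2].
Proof.
move=> r0 N0 [g [g0 gr [gM gl]]]; have NR : 0 < N%:R :> R by rewrite ltr0n.
have dt0 : 0 <= r / N%:R by rewrite divr_ge0 ?ler0n.
pose time i : R := (minn i N)%:R * (r / N%:R).
have timeN : time N = r by rewrite /time minnn mulrC divfK ?gt_eqF.
have time_r i : 0 <= time i <= r.
  by rewrite mulr_ge0//= -[leRHS]timeN ler_wpM2r// minnn ler_nat geq_minr.
exists (fun i => g (time i)); rewrite timeN; split=> // [|i|].
- by rewrite /time min0n mul0r.
- have /andP[t0 tr] := time_r i; apply: (reach_le t0 tr); exists g; split=> //.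
  by split=> [s st|s s' s0 ss' s't]; [apply: gM; lra|apply: gl; lra].
have step_le (i : 'I_N) : frob (step (fun i => g (time i)) i) ^+ 2 <= (r / N%:R) ^+ 2.
  rewrite ler_pXn2r ?nnegrE ?frob_ge0// /step; have timeS : time i.+1 = time i + r / N%:R.
    by rewrite /time (minn_idPl _) ?(minn_idPl _) ?(ltnW (ltn_ord i))// -natr1; ring.
  apply: le_trans (gl _ _ _ _ _) _; rewrite ?timeS ?lerDl//; first by have /andP[] := time_r i.
    by rewrite -timeS; have /andP[] := time_r i.+1.
  by rewrite mul1r addrAC subrr add0r.
apply: le_trans (ler_wpM2l (ltW NR) (ler_sum _ (fun i _ => step_le i))) _.
by rewrite sumr_const card_ord -[_ ^+ 2 *+ N]mulr_natl mulrA -expr2 -exprMn mulrC divfK ?gt_eqF.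
Qed.

Record short_discrete_geodesic x (r dl : R) N p : Prop := ShortDiscreteGeodesic {
  chain_nonempty : (0 < N)%N;
  chain_start : p 0%N = x;
  chain_mesh : N%:R^-1 <= dl;
  chain_step_le : forall i, (i < N)%N -> frob (step p i) <= dl;
  chain_energy_le : N%:R * energy N p <= r ^+ 2;
  chain_stationary : discrete_geodesic M p N }.

Lemma chain_length_le_of_energy (r : R) N p : 0 <= r -> N%:R * energy N p <= r ^+ 2 ->
  chain_length N p <= r.
Proof.
move=> r0 En; rewrite -(@ler_pXn2r _ 2%N)// ?nnegrE ?chain_length_ge0//.
exact: le_trans (sqr_chain_length_le N p) En.
Qed.

Section minimal_chains.
Variables (x0 : 'M[R]_(m, n)) (r h l : R).
Let K := closure (reach M x0 r).
Hypotheses (KM : K `<=` M) (h0 : 0 < h) (l0 : 0 < l).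
Hypothesis nearly_straight : forall x y, K x -> fball x l y -> M y ->
  reach M x ((1 + h) * frob (y - x)) y.

Lemma chain_reach N p i : p 0%N = x0 -> (forall i, K (p i)) ->
  (forall i, (i < N)%N -> frob (step p i) < l) -> (i <= N)%N ->
  reach M x0 ((1 + h) * chain_length i p) (p i).
Proof.
move=> p0 Kp st; have h10 : 0 <= 1 + h by rewrite addr_ge0// ltW.
elim: i => [_|i IH iN].
  by rewrite /chain_length big_ord0 mulr0 p0; apply: reach_refl; rewrite -p0; exact: KM.
rewrite /chain_length big_ord_recr/= mulrDr; apply: reach_cat (IH (ltnW iN)) _.
- by rewrite mulr_ge0// chain_length_ge0.
- by rewrite mulr_ge0// frob_ge0.
- by apply: nearly_straight => //; [exact: st|exact: KM].
Qed.

Lemma minimal_chain_stationary N p : p 0%N = x0 -> energy_minimal K N p ->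
  (forall i, (i < N)%N -> frob (step p i) < l) -> (1 + h) * chain_length N p < r ->
  discrete_geodesic M p N.
Proof.
move=> p0 pmin st len; have [Kp _] := pmin.
split=> [i _|i v iN]; first exact: KM.
set rp := (1 + h) * chain_length N p in len; have h10 : 0 < 1 + h by rewrite addr_gt0.
have rp0 : 0 <= rp by rewrite mulr_ge0 ?chain_length_ge0// ltW.
have pi_reach : reach M x0 rp (p i.+1).
  apply: reach_le (chain_reach p0 Kp st (ltnW iN)).
    by rewrite mulr_ge0 ?chain_length_ge0// ltW.
  by rewrite ler_pM2l//; exact: chain_length_le (ltnW iN).
pose e := Num.min l ((r - rp) / (1 + h)).
have e0 : 0 < e by rewrite lt_min l0 divr_gt0// subr_gt0.
apply: (energy_minimal_normal pmin iN e0) => x Mx xe.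
have xl : fball (p i.+1) l x by apply: lt_le_trans xe _; rewrite ge_min lexx.
have gap : (1 + h) * frob (x - p i.+1) <= r - rp.
  by rewrite mulrC -ler_pdivlMr//; apply: ltW; apply: lt_le_trans xe _; rewrite ge_min lexx orbT.
apply: subset_closure; rewrite -[r](subrKC rp); apply: reach_cat pi_reach _ => //; first lra.
by apply: reach_le gap (nearly_straight (Kp _) xl Mx); rewrite mulr_ge0 ?frob_ge0// ltW.
Qed.

End minimal_chains.

Lemma discrete_geodesic_exists d x0 (r r1 dl : R) q : embedded_submanifold d M ->
  0 <= r -> r < r1 -> 0 < dl -> closure (reach M x0 r1) `<=` M -> reach M x0 r q ->
  exists N p, short_discrete_geodesic x0 r dl N p /\ p N = q.
Proof.
move=> eM r0 rr1 dl0 KM xq; have r10 : 0 <= r1 by lra.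
have [h h0 hr] : exists2 h : R, 0 < h & (1 + h) * r < r1.
  exists ((r1 - r) / (r + 1)); first by rewrite divr_gt0 ?subr_gt0// ltr_wpDl.
  have : (r1 - r) / (r + 1) * (r + 1) = r1 - r by rewrite divfK// gt_eqF// ltr_wpDl.
  have : 0 < (r1 - r) / (r + 1) by rewrite divr_gt0 ?subr_gt0// ltr_wpDl.
  lra.
have cK := @closure_reach_compact _ _ _ M x0 r1 r10.
have [l l0 straight] := nearly_straight_path_compact eM cK KM h0.
pose step_bound := Num.min (l / 2) dl.
have sb0 : 0 < step_bound by rewrite lt_min dl0 divr_gt0.
near \oo => N.
have N0 : (0 < N)%N by near: N; exists 1%N.
have NR : 0 < N%:R :> R by rewrite ltr0n.
have mesh : N%:R^-1 <= dl.
  rewrite invf_ple ?posrE//; near: N; exact: nbhs_infty_ger.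
have r2N : r ^+ 2 / N%:R <= step_bound ^+ 2.
  rewrite ler_pdivrMr// mulrC -ler_pdivrMr ?exprn_gt0//; near: N; exact: nbhs_infty_ger.
have [p0 [p00 p0N p0K p0E]] := path_subdivision r0 N0 xq.
have Kp0 i : closure (reach M x0 r1) (p0 i) by exact: reach_closure (ltW rr1) (p0K i).
have [p [p_0 p_N pmin]] := energy_minimal_exists N cK Kp0.
rewrite p00 p0N in p_0 p_N.
have pE : N%:R * energy N p <= r ^+ 2.
  by apply: le_trans p0E; rewrite ler_pM2l//; apply: pmin.2; rewrite ?p00 ?p0N.
have steps i : (i < N)%N -> frob (step p i) <= step_bound.
  move=> iN; rewrite -(@ler_pXn2r _ 2%N)// ?nnegrE ?frob_ge0 ?(ltW sb0)//.
  apply: le_trans (sqr_step_le_energy _ iN) (le_trans _ r2N).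
  by rewrite ler_pdivlMr// mulrC.
exists N, p; split=> //; split=> // [i /steps|].
  by move/le_trans; apply; rewrite ge_min lexx orbT.
apply: (minimal_chain_stationary KM h0 l0 straight) => // [i /steps|].
  by move/le_lt_trans; apply; rewrite gt_min ltr_pdivrMr// ltr_pMr// ltr1n.
apply: le_lt_trans hr; rewrite ler_wpM2l ?addr_ge0 ?(ltW h0)//.
exact: chain_length_le_of_energy.
Unshelve. all: by end_near. Qed.

End discrete_geodesics.

(** * Completeness of intrinsic balls *)

Lemma secant_limit_tangent {R : realType} {m n d : nat} (M : set 'M[R]_(m, n)) x l :
  embedded_submanifold d M -> M x ->
  (forall e : R, 0 < e -> exists y (t : R), [/\ M y, 0 < t <= e, frob (y - x) <= t &
     frob (t^-1 *: (y - x) - l) <= e]) ->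
  tangent M x l.
Proof.
move=> eM Mx secant; have [r [C [F eqF]]] := local_equation_exists eM Mx.
have xr := fball_center x (equation_radius_gt0 eqF); have C0 := equation_bound_gt0 eqF.
have dF := equation_differentiable eqF xr.
apply/(equation_tangentP eqF _ xr Mx)/frob_small_eq0 => e e0.
pose e' := Num.min (e / (2 * C)) (r / 2).
have e'0 : 0 < e' by rewrite lt_min !divr_gt0 ?(equation_radius_gt0 eqF)// mulr_gt0.
have Ce' : C * e' <= e / 2.
  have : e' <= e / (2 * C) by rewrite ge_min lexx.
  by rewrite ler_pdivlMr ?mulr_gt0//; lra.
have e'r : e' < r.
  have : e' <= r / 2 by rewrite ge_min lexx orbT.
  by have := equation_radius_gt0 eqF; lra.
have [y [t [My /andP[t0 te'] yt vl]]] := secant e' e'0.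
have yr : fball x r y by exact: le_lt_trans (le_trans yt te') e'r.
have xyr : fball x r (x + (y - x)) by rewrite subrKC.
have DyF : 'D_(y - x) F x = - remainder F x (y - x).
  rewrite /remainder subrKC ((equationP eqF yr).1 My) ((equationP eqF xr).1 Mx).
  by rewrite subrr sub0r opprK.
have -> : 'D_l F x = - 'D_(t^-1 *: (y - x) - l) F x - t^-1 *: remainder F x (y - x).
  rewrite (derive_dirB _ _ dF) (derive_dirZ _ _ dF) DyF scalerN.
  by move: ('D_l F x) (_ *: _) => a b; mx_ring.
apply: le_trans (frobB _ _) _; rewrite frobN [e]splitr; apply: lerD.
  apply: le_trans (equation_derive_le eqF _ xr) _; apply: le_trans Ce'.
  by rewrite ler_pM2l.
rewrite frobZ gtr0_norm ?invr_gt0// ler_pdivrMl//; apply: le_trans (frob_remainder_le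
  (equation_lipschitz_remainder eqF) xr xyr) _.
apply: (@le_trans _ _ (t * (C * e'))); last by rewrite ler_pM2l.
by rewrite [leRHS]mulrCA ler_pM2l// expr2 ler_pM ?frob_ge0// (le_trans yt).
Qed.

Section initial_direction.
Context {R : realType} {m n : nat}.
Implicit Types (M : set 'M[R]_(m, n)) (p : nat -> 'M[R]_(m, n)).

(* The time step at which the chain leaves its origin with speed at most one;
   the bound from below by [1 / N] keeps it positive for constant chains. *)
Definition time_step N p : R := Num.max (frob (step p 0%N)) N%:R^-1.

Definition initial_direction N p : 'M[R]_(m, n) := (time_step N p)^-1 *: step p 0%N.

Lemma time_step_gt0 N p : (0 < N)%N -> 0 < time_step N p.
Proof. by move=> N0; rewrite lt_max invr_gt0 ltr0n N0 orbT. Qed.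

Lemma initial_step N p : (0 < N)%N -> step p 0%N = time_step N p *: initial_direction N p.
Proof. by move=> N0; rewrite scalerA mulfV ?scale1r// gt_eqF// time_step_gt0. Qed.

Lemma frob_initial_direction_le N p : (0 < N)%N -> frob (initial_direction N p) <= 1.
Proof.
move=> N0; have t0 := time_step_gt0 p N0.
by rewrite frobZ gtr0_norm ?invr_gt0// ler_pdivrMl// mulr1 le_max lexx.
Qed.

Lemma time_step_le M x (r dl : R) N p : short_discrete_geodesic M x r dl N p ->
  time_step N p <= dl.
Proof.
by case=> N0 _ mesh steps _ _; rewrite ge_max mesh steps.
Qed.

Lemma short_discrete_geodesic_le M x (r dl dl' : R) N p : dl <= dl' ->
  short_discrete_geodesic M x r dl N p -> short_discrete_geodesic M x r dl' N p.
Proof.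
move=> dd [N0 p0 mesh steps En stat]; split=> //; first exact: le_trans dd.
by move=> i iN; apply: le_trans (steps i iN) dd.
Qed.

End initial_direction.

Section duration.
Context {R : realType} {m n : nat} (M : set 'M[R]_(m, n)) (c : R -> 'M[R]_(m, n)).
Hypothesis gc : geodesic M c.
Implicit Types (p : nat -> 'M[R]_(m, n)) (t : R).

Lemma dist_le_chain_length N p : frob (p N - p 0%N) <= chain_length N p.
Proof.
elim: N => [|N IH]; first by rewrite subrr frob0 chain_length_ge0.
apply: le_trans (frob_dist_triangle (p N) _ _) _.
by rewrite addrC /chain_length big_ord_recr/= lerD2r.
Qed.

Lemma geodesic_departs : derive1 c 0 != 0 -> exists s0 a : R,
  [/\ 0 < s0, 0 < a & forall s, s0 / 2 <= s <= s0 -> a <= frob (c s - c 0)].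
Proof.
rewrite -frob_gt0; set v := frob _ => v0.
have [B B0 first_order] := geodesic_first_order gc.
pose s0 := Num.min 1 (v / (2 * B)).
have s00 : 0 < s0 by rewrite lt_min ltr01 divr_gt0// mulr_gt0.
have Bs0 : B * s0 <= v / 2.
  have : s0 <= v / (2 * B) by rewrite ge_min lexx orbT.
  by rewrite ler_pdivlMr ?mulr_gt0//; lra.
have s01 : s0 <= 1 by rewrite ge_min lexx.
exists s0, (s0 * v / 4); split=> [//||s /andP[s_ge s_le]]; first by rewrite divr_gt0// mulr_gt0.
have sge0 : 0 <= s by lra.
have := first_order s _; rewrite sge0 (le_trans s_le)// => /(_ isT) c_near.
have := frob_le_distD (s *: derive1 c 0) (c s - c 0).
rewrite (frob_distC (s *: _)) frobZ ger0_norm// -/v => s_far.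
have Bss : B * s * s <= v / 2 * s.
  by rewrite ler_wpM2r//; apply: le_trans Bs0; rewrite ler_pM2l.
have vs : s0 / 2 * v <= s * v by rewrite ler_pM2r.
by move: c_near s_far Bss vs; rewrite expr2; lra.
Qed.

(* A chain tracking a moving geodesic has length bounded below after a fixed time,
   hence so is its energy per step, while the total energy is bounded. *)
Lemma moving_duration_bounded (rs : R) : derive1 c 0 != 0 -> exists T e : R, 0 < e /\
  forall p N t, p 0%N = c 0 -> 0 < t <= e -> N%:R * energy N p <= rs ^+ 2 ->
    (forall i, (i < N)%N -> i%:R * t <= T -> position_gap p (sample c t) i <= e) ->
    N%:R * t <= T.
Proof.
move=> /geodesic_departs[s0 [a [s00 a0 departs]]].
pose b := a / 2; have b0 : 0 < b by rewrite divr_gt0.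
exists (s0 + s0 * rs ^+ 2 / b ^+ 2), (Num.min b (s0 / 2)).
split=> [|p N t p0 /andP[t0 te] En near]; first by rewrite lt_min b0 divr_gt0.
have {te} [tb ts0] : t <= b /\ t <= s0 / 2.
  by split; apply: le_trans te _; rewrite ge_min lexx ?orbT.
rewrite leNgt; apply/negP => long.
have extra0 : 0 <= s0 * rs ^+ 2 / b ^+ 2.
  by rewrite divr_ge0 ?sqr_ge0// mulr_ge0 ?sqr_ge0// ltW.
pose k := Num.truncn (s0 / t).
have /andP[k_le k_gt] : k%:R <= s0 / t < k.+1%:R by apply: truncn_itv; rewrite divr_ge0 ?ltW.
have kt_le : k%:R * t <= s0 by rewrite -ler_pdivlMr.
have kt_ge : s0 / 2 <= k%:R * t.
  by move: k_gt; rewrite ltr_pdivrMr// -natr1 mulrDl mul1r; lra.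
have kN : (k < N)%N by rewrite -(@ltr_nat R) -(ltr_pM2r t0); lra.
have k_near : position_gap p (sample c t) k <= b.
  by apply: le_trans (near k kN _) _; [lra|rewrite ge_min lexx].
have k_far : b <= chain_length k p.
  have := departs (k%:R * t); rewrite kt_ge kt_le => /(_ isT).
  have := dist_le_chain_length k p; rewrite p0.
  have := frob_dist_triangle (p k) (c (k%:R * t)) (c 0); rewrite (frob_distC _ (p k)).
  by move: k_near; rewrite /position_gap /sample /b; lra.
have kE : b ^+ 2 <= k%:R * energy N p.
  apply: le_trans (_ : chain_length k p ^+ 2 <= _).
    by rewrite ler_pXn2r ?nnegrE ?chain_length_ge0// ltW.
  by apply: le_trans (sqr_chain_length_le k p) _; rewrite ler_wpM2l// energy_le// ltnW.
have Nt_le : N%:R * t * b ^+ 2 <= s0 * rs ^+ 2.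
  apply: (@le_trans _ _ (k%:R * t * (N%:R * energy N p))).
    rewrite (_ : _ * (_ * energy N p) = N%:R * t * (k%:R * energy N p)); last by ring.
    by rewrite ler_wpM2l// mulr_ge0// ltW.
  by rewrite ler_pM// ?mulr_ge0 ?(ltW t0)// sumr_ge0// => i _; exact: sqr_ge0.
by move: Nt_le long; rewrite -ler_pdivlMr ?exprn_gt0//; move: s00; lra.
Qed.

Lemma duration_bounded (rs : R) : exists T e : R, 0 < e /\
  forall N p, short_discrete_geodesic M (c 0) rs e N p ->
    frob (initial_direction N p - derive1 c 0) <= e ->
    (forall i, (i < N)%N -> i%:R * time_step N p <= T ->
      position_gap p (sample c (time_step N p)) i <= e) ->
    N%:R * time_step N p <= T.
Proof.
have [c'0|moving] := eqVneq (derive1 c 0) 0; last first.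
  have [T [e [e0 bounded]]] := moving_duration_bounded rs moving; exists T, e; split=> // N p.
  move=> sg _; apply: bounded; [exact: chain_start sg| |exact: chain_energy_le sg].
  by rewrite time_step_gt0 ?(chain_nonempty sg)// (time_step_le sg).
exists 1, (1 / 2); split=> [|N p sg]; first by rewrite divr_gt0.
have N0 := chain_nonempty sg; have t0 := time_step_gt0 p N0.
rewrite c'0 subr0 /initial_direction frobZ gtr0_norm ?invr_gt0// ler_pdivrMl//.
rewrite /time_step; case: (leP (frob (step p 0%N)) N%:R^-1) => [_ _ _|sN half _].
  by rewrite mulfV// pnatr_eq0 -lt0n.
have : 0 < frob (step p 0%N) by apply: lt_trans sN; rewrite invr_gt0 ltr0n.
by move: half; lra.
Qed.

End duration.

Section hopf_rinow.
Context {R : realType} {m n : nat} (d : nat) (M : set 'M[R]_(m, n))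
  (E : 'M[R]_(m, n) -> 'M[R]_(m, n) -> 'M[R]_(m, n)).
Hypothesis eM : embedded_submanifold d M.
Hypothesis hE : exponential_map M E.
Variable x0 : 'M[R]_(m, n).
Hypothesis Mx0 : M x0.
Implicit Types (r rs : R) (a : 'M[R]_(m, n)).

Lemma reach_extend r : 0 <= r -> closure (reach M x0 r) `<=` M ->
  exists2 e : R, 0 < e & closure (reach M x0 (r + e)) `<=` M.
Proof.
move=> r0 KM; have cK := @closure_reach_compact _ _ _ M x0 r r0.
have [|e e0 eP] := compact_uniform_pairs (P := fun _ y => closure M y -> M y) cK.
  move=> z /KM Mz; have [r1 [C [F eqF]]] := local_equation_exists eM Mz.
  exists r1; first exact: equation_radius_gt0 eqF.
  by move=> _ y _; exact: (equation_closed eqF).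
have e30 : 0 < e / 3 by rewrite divr_gt0.
exists (e / 3) => // a Ka; have [q rq aq] := (closure_frobP _ _).1 Ka _ e30.
have er : 0 <= e / 3 <= r + e / 3 by lra.
have [q' rq' qq'] := reach_shorten er rq; rewrite addrK in rq'.
have Ma : closure M a.
  by move=> B /Ka[y [ry By]]; exists y; split=> //; apply: reach_M ry; lra.
apply: (eP q' a) Ma; first exact: subset_closure.
by rewrite /fball/=; apply: le_lt_trans (frob_dist_triangle q _ _) _; lra.
Qed.

Lemma short_discrete_geodesic_approx rs a : 0 < rs ->
  (forall r, 0 <= r < rs -> closure (reach M x0 r) `<=` M) -> closure (reach M x0 rs) a ->
  forall e, 0 < e -> exists N p, short_discrete_geodesic M x0 rs e N p /\ frob (a - p N) <= e.
Proof.
move=> rs0 closed_lt /closure_frobP Ka e e0; have [q rq aq] := Ka (e / 2) (divr_gt0 e0 (ltr0n _ 2)).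
pose e1 := Num.min (e / 2) (rs / 2).
have e1e : e1 <= e / 2 by rewrite ge_min lexx.
have e1rs : e1 <= rs / 2 by rewrite ge_min lexx orbT.
have e10 : 0 < e1 by rewrite lt_min !divr_gt0.
have [|q' rq' qq'] := @reach_shorten _ _ _ M x0 rs q e1 _ rq; first lra.
have [|||N [p [sg pN]]] := discrete_geodesic_exists (r1 := rs - e1 / 2) eM _ _ e0 _ rq'.
- by lra.
- by lra.
- by apply: closed_lt; lra.
exists N, p; split; last by apply: le_trans (frob_dist_triangle q _ _) _; rewrite pN; lra.
case: sg => N0 p0 mesh steps En stat; split=> //; apply: le_trans En _.
by rewrite ler_pXn2r ?nnegrE//; lra.
Qed.

Section limit_geodesic.
Variables (rs : R) (a : 'M[R]_(m, n)).
Hypothesis rs0 : 0 < rs.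

Definition approximating_directions (e : R) : set 'M[R]_(m, n) :=
  [set v | exists N p, [/\ short_discrete_geodesic M x0 rs e N p, frob (a - p N) <= e &
    v = initial_direction N p]].

Lemma limit_direction_tangent l :
  (forall e : R, 0 < e -> exists2 v, approximating_directions e v & frob (v - l) <= e) ->
  tangent M x0 l.
Proof.
move=> l_limit; apply: (secant_limit_tangent eM Mx0) => e e0.
have [_ [N [p [sg _ ->]]] vl] := l_limit e e0.
have N0 := chain_nonempty sg; exists (p 1%N), (time_step N p); rewrite -(chain_start sg).
split=> //; first by case: (chain_stationary sg) => pM _; exact: pM.
  by rewrite time_step_gt0// (time_step_le sg).
by rewrite le_max lexx.
Qed.

Lemma closure_limit_geodesic c : geodesic M c -> c 0 = x0 ->
  (forall e : R, 0 < e -> exists2 v, approximating_directions e v &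
    frob (v - derive1 c 0) <= e) ->
  exists T : R, closure (c @` `[0, T]) a.
Proof.
move=> gc c0 c_limit; have [T [e0 [e00 bounded]]] := duration_bounded gc rs.
exists T; apply/closure_frobP => e e_gt0; pose e' := Num.min (e / 3) e0.
have e'0 : 0 < e' by rewrite lt_min e00 divr_gt0.
have [e'e e'e0] : e' <= e / 3 /\ e' <= e0 by split; rewrite ge_min lexx ?orbT.
have [dl dl0 tracking] := discrete_geodesic_tracks eM gc T rs e'0.
pose dl' := Num.min dl e'; have dl'0 : 0 < dl' by rewrite lt_min dl0.
have [dl'dl dl'e'] : dl' <= dl /\ dl' <= e' by split; rewrite ge_min lexx ?orbT.
have [_ [N [p [sg ap ->]]] vl] := c_limit dl' dl'0.
have N0 := chain_nonempty sg; set t := time_step N p; have t0 : 0 < t := time_step_gt0 p N0.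
have p_tracks i : (i < N)%N -> i%:R * t <= T -> tracks c p t e' i.
  apply: tracking; first exact: chain_stationary sg.
  - exact: chain_length_le_of_energy (ltW rs0) (chain_energy_le sg).
  - by move=> j /(chain_step_le sg)/le_trans; exact.
  - by rewrite c0 (chain_start sg).
  - by rewrite t0 (le_trans (time_step_le sg)).
  - rewrite (initial_step p N0) -scalerBr frobZ gtr0_norm// mulrC ler_pM2r//.
    exact: le_trans vl dl'dl.
have duration : N%:R * t <= T.
  apply: bounded; first by rewrite c0; apply: short_discrete_geodesic_le sg; exact: le_trans e'e0.
    by apply: le_trans vl _; exact: le_trans e'e0.
  by move=> i iN iT; have [pos _] := p_tracks i iN iT; exact: le_trans e'e0.
case: N N0 sg ap @t t0 p_tracks duration vl => // k _ sg ap t t0 p_tracks duration _.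
have kT : k%:R * t <= T by apply: le_trans duration; rewrite ler_pM2r// ler_nat.
have [pos _] := p_tracks k (ltnSn k) kT.
exists (c (k%:R * t)); first by exists (k%:R * t) => //=; rewrite in_itv/= kT mulr_ge0// ltW.
apply: le_trans (frob_dist_triangle (p k.+1) _ _) _.
have := frob_dist_triangle (p k) (p k.+1) (c (k%:R * t)).
have := chain_step_le sg (ltnSn k); move: pos ap.
by rewrite /position_gap /sample /step; lra.
Qed.

End limit_geodesic.

Lemma reach_limit rs : 0 < rs ->
  (forall r, 0 <= r < rs -> closure (reach M x0 r) `<=` M) -> closure (reach M x0 rs) `<=` M.
Proof.
move=> rs0 closed_lt a Ka.
have approx := short_discrete_geodesic_approx rs0 closed_lt Ka.
have [|||l l_limit] := @bounded_family_cluster _ _ _ (approximating_directions rs a) 1.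
- move=> e e' ee v [N [p [sg ap ->]]]; exists N, p; split=> //; last exact: le_trans ee.
  exact: short_discrete_geodesic_le sg.
- by move=> e /approx[N [p [sg ap]]]; exists (initial_direction N p), N, p.
- by move=> e _ [N [p [sg _ ->]]]; exact: frob_initial_direction_le (chain_nonempty sg).
have [c [gc c0 cl _]] := hE Mx0 (limit_direction_tangent l_limit).
rewrite -cl in l_limit; have [T Ta] := closure_limit_geodesic rs0 gc c0 l_limit.
have closed_segment : closed (c @` `[0, T]).
  apply: compact_closed; first exact: norm_hausdorff.
  exact: (@geodesic_segment_compact _ _ _ _ _ gc T).
by have [s _ <-] := closed_segment a Ta; exact: geodesic_M gc s.
Qed.

Lemma hopf_rinow r : 0 <= r -> closure (reach M x0 r) `<=` M.
Proof.
move=> r0; apply: contrapT => not_closed.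
pose A := [set s | 0 <= s /\ closure (reach M x0 s) `<=` M].
have A_le s s' : 0 <= s -> s <= s' -> A s' -> A s.
  move=> s0 ss' [_ As']; split=> // x /closure_subset Kx.
  by apply: As'; apply: Kx => y; exact: reach_le.
have A0 : A 0.
  split=> // x /closure_frobP Kx; suff -> : x = x0 by [].
  apply/eqP; rewrite -subr_eq0; apply/eqP/frob_small_eq0 => e e0.
  have [y /(reach_dist (lexx 0)) yx xy] := Kx e e0.
  by apply: le_trans (frob_dist_triangle y _ _) _; lra.
have A_bounded : ubound A r.
  move=> s As; rewrite leNgt; apply/negP => rs; apply: not_closed.
  by case: (A_le r s r0 (ltW rs) As).
have supA : has_sup A by split; [exists 0|exists r].
have sup0 : 0 <= sup A by apply: ub_le_sup => //; exists r.
have [_ A_sup] : A (sup A).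
  have [-> //|supN0] := eqVneq (sup A) 0.
  have sup_gt0 : 0 < sup A by rewrite lt_def supN0.
  split=> //; apply: reach_limit => // s /andP[s0 ss].
  have sup_s : 0 < sup A - s by rewrite subr_gt0.
  have [s' As' ss'] := sup_adherent sup_s supA.
  by case: (A_le s s' s0 _ As') => //; move: ss'; lra.
have [e e0 Ae] := reach_extend sup0 A_sup.
have : sup A + e <= sup A by apply: ub_le_sup; [exists r|split=> //; lra].
lra.
Qed.

End hopf_rinow.

(** * Linear algebra *)

Section vectorisation.
Context {R : realType} {m n : nat}.

Fact vec_is_linear : linear (@vec R m n).
Proof. by move=> k A B; rewrite /vec !linearP. Qed.

HB.instance Definition _ := GRing.isLinear.Build R 'M[R]_(m, n) 'cV[R]_(n * m) _ (@vec R m n)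
  vec_is_linear.

Lemma mxdot_vec (A B : 'M[R]_(m, n)) : mxdot (vec A) (vec B) = mxdot A B.
Proof. by rewrite /vec mxdot_tr mxdot_mxvec mxdot_tr. Qed.

Lemma frob_vec (A : 'M[R]_(m, n)) : frob (vec A) = frob A.
Proof. by rewrite /frob mxdot_vec. Qed.

Lemma unvecK (w : 'cV[R]_(n * m)) : vec (unvec w : 'M[R]_(m, n)) = w.
Proof. by rewrite /vec /unvec trmxK vec_mxK trmxK. Qed.

Lemma vecK (A : 'M[R]_(m, n)) : unvec (vec A) = A.
Proof. by rewrite /vec /unvec trmxK mxvecK trmxK. Qed.

End vectorisation.

Section quadratic_forms.
Context {R : realType}.

Lemma mxdot_mulmx m n p (A : 'M[R]_(m, n)) (B : 'M[R]_(n, p)) (C : 'M[R]_(m, p)) :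
  mxdot (A *m B) C = mxdot B (A^T *m C).
Proof.
have mxdotE k l (X Y : 'M[R]_(k, l)) : mxdot X Y = \tr (X^T *m Y).
  rewrite /mxdot exchange_big /mxtrace; apply: eq_bigr => j _; rewrite mxE.
  by apply: eq_bigr => i _; rewrite mxE.
by rewrite !mxdotE trmx_mul mulmxA.
Qed.

Lemma mxdot_symmx n p (A : 'M[R]_n) (B C : 'M[R]_(n, p)) : A^T = A ->
  mxdot B (A *m C) = mxdot (A *m B) C.
Proof. by move=> symA; rewrite mxdot_mulmx symA. Qed.

Lemma mxdot_gram n k p (J : 'M[R]_(n, k)) (v : 'M[R]_(n, p)) :
  mxdot v (J *m J^T *m v) = frob (J^T *m v) ^+ 2.
Proof. by rewrite sqr_frob mxdot_mulmx trmxK mulmxA. Qed.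

Lemma loewner_leE n (A B : 'M[R]_n) : loewner_le A B <->
  forall v : 'cV[R]_n, mxdot v (A *m v) <= mxdot v (B *m v).
Proof.
have formE (v : 'cV[R]_n) :
    (v^T *m (B - A) *m v) 0 0 = mxdot v (B *m v) - mxdot v (A *m v).
  rewrite -mxdotBr -mulmxBl -mulmxA mxE.
  by apply: eq_bigr => i _; rewrite big_ord1 mxE.
by split=> AB v; have := AB v; rewrite formE subr_ge0.
Qed.

Lemma mxdot_scalar_mx n (k : R) (v : 'cV[R]_n) : mxdot v (k%:M *m v) = k * frob v ^+ 2.
Proof. by rewrite mul_scalar_mx mxdotZr sqr_frob. Qed.

Lemma loewner_le_scalar_mx n (A : 'M[R]_n) (a b : R) : (0 < n)%N ->
  loewner_le a%:M A -> loewner_le A b%:M -> a <= b.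
Proof.
case: n A => // n A _ /loewner_leE aA /loewner_leE Ab.
have := le_trans (aA (delta_mx 0 0)) (Ab (delta_mx 0 0)).
by rewrite !mxdot_scalar_mx frob_delta_mx expr1n !mulr1.
Qed.

Lemma coercive_unitmx n (A : 'M[R]_n) (k : R) : 0 < k ->
  (forall v : 'cV[R]_n, k * frob v ^+ 2 <= mxdot v (A *m v)) -> A \in unitmx.
Proof.
move=> k0 Ak; rewrite -unitmx_tr -row_free_unit -kermx_eq0; apply/eqP/row_matrixP => i.
rewrite row0; set u := row i _; have uA : u *m A^T = 0 by rewrite -row_mul mulmx_ker row0.
have Au : A *m u^T = 0 by rewrite -[A]trmxK -trmx_mul uA trmx0.
have := Ak u^T; rewrite Au mxdot0r pmulr_rle0// => u_le0.
apply/eqP; rewrite -trmx_eq0 -frob_eq0 -sqrf_eq0.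
by rewrite eq_le u_le0 sqr_ge0.
Qed.

Lemma coercive_solve_dist n (A : 'M[R]_n) (k : R) (g e : 'cV[R]_n) : 0 < k ->
  (forall v : 'cV[R]_n, k * frob v ^+ 2 <= mxdot v (A *m v)) ->
  frob (invmx A *m g - e) <= frob (g - A *m e) / k.
Proof.
move=> k0 Ak; have uA := coercive_unitmx k0 Ak; set w := invmx A *m g - e.
have <- : A *m w = g - A *m e by rewrite mulmxBr mulKVmx.
rewrite ler_pdivlMr// mulrC; have [w0|w0] := eqVneq (frob w) 0.
  by rewrite w0 mulr0 frob_ge0.
have {}w0 : 0 < frob w by rewrite lt_def w0 frob_ge0.
rewrite -(ler_pM2l w0) mulrCA -expr2; exact: le_trans (Ak w) (mxdot_le _ _).
Qed.

Lemma psd_isotropic_ker n (A : 'M[R]_n) (v : 'cV[R]_n) : A^T = A ->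
  (forall w : 'cV[R]_n, 0 <= mxdot w (A *m w)) -> mxdot v (A *m v) = 0 -> A *m v = 0.
Proof.
move=> symA psd v0; set B := A *m v; set b := mxdot B B; set k := mxdot B (A *m B).
have ray (t : R) : mxdot (v + t *: B) (A *m (v + t *: B)) = 2 * b * t + k * t ^+ 2.
  rewrite mulmxDr -scalemxAr !(mxdotDl, mxdotDr, mxdotZl, mxdotZr) v0.
  by rewrite (mxdot_symmx v B symA) -/B -/b -/k; ring.
have poly_ge0 (t : R) : 0 <= (Poly [:: 0; 2 * b; k]).[t].
  by have := psd (v + t *: B); rewrite ray horner_Poly/=; lra.
have := deg_le2_poly_ge0 (size_Poly [:: 0; 2 * b; k]) poly_ge0.
rewrite !coef_Poly/= mulr0 subr0 => b2.
have : (2 * b) ^+ 2 == 0 by rewrite eq_le b2 sqr_ge0.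
by rewrite sqrf_eq0 mulf_eq0 pnatr_eq0/= /b -sqr_frob sqrf_eq0 frob_eq0 => /eqP.
Qed.

Lemma quadratic_form_continuous n (A : 'M[R]_n) :
  continuous (fun v : 'cV[R]_n => mxdot v (A *m v)).
Proof.
rewrite /mxdot; apply: continuous_big => [|i _]; first exact: add_continuous.
apply: continuous_big => [|j _ v]; first exact: add_continuous.
have coordA : {for v, continuous (fun v : 'cV[R]_n => (A *m v) i j)}.
  apply: (@continuous_comp _ _ _ (mulmx A) (fun w : 'cV[R]_n => w i j)); last first.
    exact: coord_continuous.
  exact: (@linear_mx_continuous _ _ _ _ _ (mulmx A)).
exact: continuousM (@coord_continuous R n 1 i j v) coordA.
Qed.

Lemma rayleigh_minimum n (A : 'M[R]_n.+1) : exists2 v : 'cV[R]_n.+1, frob v = 1 &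
  forall w : 'cV[R]_n.+1, mxdot v (A *m v) * frob w ^+ 2 <= mxdot w (A *m w).
Proof.
pose sphere := [set v : 'cV[R]_n.+1 | frob v = 1].
have sphere_compact : compact sphere.
  apply: (@frob_bounded_closed_compact _ _ _ _ 1) => [|v ->//].
  apply: (@preimage_closed 'cV[R]_n.+1 R (@frob R n.+1 1) [set b | b = 1]).
    by move=> v _; exact: frob_continuous.
  exact: closed_eq.
have sphere0 : sphere !=set0 by exists (delta_mx 0 0); exact: frob_delta_mx.
have [v /set_mem v1 vmin] := compact_EVT_min sphere0 sphere_compact
  (continuous_subspaceT (@quadratic_form_continuous _ A)).
exists v => // w; have [->|w0] := eqVneq w 0.
  by rewrite frob0 mulmx0 mxdot0r expr0n mulr0.
have {}w0 : 0 < frob w by rewrite frob_gt0.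
have w1 : (frob w)^-1 *: w \in sphere.
  by apply/mem_set; rewrite /sphere/= frobZ gtr0_norm ?invr_gt0// mulVf// gt_eqF.
have := vmin _ w1; rewrite -scalemxAr mxdotZl mxdotZr mulrA -expr2 exprVn.
by rewrite ler_pdivlMl ?exprn_gt0// mulrC.
Qed.

(* The minimum of the Rayleigh quotient is the least eigenvalue. *)
Lemma lambda_min_le n (A : 'M[R]_n) (z : 'cV[R]_n) : A^T = A ->
  lambda_min A * frob z ^+ 2 <= mxdot z (A *m z).
Proof.
case: n A z => [|n] A z symA.
  by rewrite (flatmx0 z) frob0 mulmx0 mxdot0r expr0n mulr0.
have [v v1] := rayleigh_minimum A; set l := mxdot v (A *m v) => lmin.
have eigenform (a : R) (u : 'rV[R]_n.+1) : u *m A = a *: u ->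
    mxdot u^T (A *m u^T) = a * frob u^T ^+ 2.
  by move=> uA; rewrite -{1}symA -trmx_mul uA linearZ mxdotZr sqr_frob.
have Av : (A - l%:M) *m v = 0.
  apply: psd_isotropic_ker; first by rewrite linearB/= symA tr_scalar_mx.
    by move=> w; rewrite mulmxBl mxdotBr mxdot_scalar_mx subr_ge0.
  by rewrite mulmxBl mxdotBr mxdot_scalar_mx v1 expr1n mulr1 subrr.
have l_eigen : eigenvalue A l.
  apply/eigenvalueP; exists v^T; last by rewrite trmx_eq0 -frob_eq0 v1 oner_neq0.
  move/eqP: Av; rewrite mulmxBl mul_scalar_mx subr_eq0 => /eqP Av.
  by rewrite -{1}symA -trmx_mul Av linearZ.
apply: le_trans (lmin z); rewrite ler_wpM2r ?sqr_ge0//.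
apply: ge_inf => //; exists l => a /= /eigenvalueP[u uA u0].
have u2 : 0 < frob u^T ^+ 2 by rewrite exprn_gt0// frob_gt0 trmx_eq0.
by rewrite -(ler_pM2r u2) -(eigenform _ _ uA).
Qed.

Lemma lambda_min_mx0 (A : 'M[R]_0) : lambda_min A = 0.
Proof.
rewrite /lambda_min (_ : [set a | eigenvalue A a] = set0) ?inf0//.
by rewrite -subset0 => a /eigenvalueP[v _]; rewrite (thinmx0 v) eqxx.
Qed.

End quadratic_forms.

Section least_norm_solutions.
Context {R : realType} {n k : nat}.
Implicit Types (J : 'M[R]_(n, k)) (s : R) (w : 'cV[R]_n).

Lemma sqrt_lambda_min_le J w :
  Num.sqrt (lambda_min (J *m J^T)) * frob w <= frob (J^T *m w).
Proof.
have [l0|/ltW l0] := leP (lambda_min (J *m J^T)) 0; first by rewrite ler0_sqrtr// mul0r frob_ge0.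
rewrite -(@ler_pXn2r _ 2%N)// ?nnegrE ?mulr_ge0 ?sqrtr_ge0 ?frob_ge0//.
by rewrite exprMn sqr_sqrtr// -mxdot_gram lambda_min_le// trmx_mul trmxK.
Qed.

Lemma bounded_below_perturb J J0 s e : (forall w : 'cV[R]_n, s * frob w <= frob (J0^T *m w)) ->
  frob (J - J0) <= e -> forall w : 'cV[R]_n, (s - e) * frob w <= frob (J^T *m w).
Proof.
move=> sJ0 JJ0 w; rewrite mulrBl lerBlDr; apply: le_trans (sJ0 w) _.
apply: le_trans (frob_le_distD _ (J^T *m w)) _; rewrite lerD2l -mulmxBl -linearB.
by apply: le_trans (frob_mulmx _ _) _; rewrite frob_tr frob_distC ler_wpM2r ?frob_ge0.
Qed.

Lemma gram_unitmx J s : 0 < s -> (forall w : 'cV[R]_n, s * frob w <= frob (J^T *m w)) ->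
  J *m J^T \in unitmx.
Proof.
move=> s0 sJ; apply: (@coercive_unitmx _ _ _ (s ^+ 2)); first by rewrite exprn_gt0.
move=> v; rewrite mxdot_gram -exprMn ler_pXn2r ?nnegrE ?mulr_ge0 ?frob_ge0 ?(ltW s0)//.
Qed.

Definition least_norm_solution J w : 'cV[R]_k := J^T *m (invmx (J *m J^T) *m w).

Lemma least_norm_solutionP J w : J *m J^T \in unitmx -> J *m least_norm_solution J w = w.
Proof. by move=> uJ; rewrite /least_norm_solution mulmxA mulKVmx. Qed.

Lemma frob_least_norm_solution_le J s w : 0 < s ->
  (forall v : 'cV[R]_n, s * frob v <= frob (J^T *m v)) ->
  frob (least_norm_solution J w) <= s^-1 * frob w.
Proof.
move=> s0 sJ; have uJ := gram_unitmx s0 sJ.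
set D := least_norm_solution J w; pose z : 'cV[R]_n := invmx (J *m J^T) *m w.
have [D0|D0] := eqVneq (frob D) 0; first by rewrite D0 mulr_ge0 ?frob_ge0// invr_ge0 ltW.
have {}D0 : 0 < frob D by rewrite lt_def D0 frob_ge0.
have D2 : frob D ^+ 2 <= frob z * frob w.
  by rewrite sqr_frob {1}/D mxdot_mulmx trmxK least_norm_solutionP// mxdot_le.
have z_le : frob z <= s^-1 * frob D by rewrite ler_pdivlMl//; exact: sJ.
rewrite -(ler_pM2l D0) -expr2; apply: le_trans D2 _.
by rewrite mulrCA mulrA ler_wpM2r ?frob_ge0.
Qed.

Lemma pinv_gram_mulmx J (H : 'M[R]_n) w : J *m J^T \in unitmx -> H \in unitmx ->
  Defs.pinv (J^T *m H *m J) *m J^T *m w = least_norm_solution J (invmx H *m w).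
Proof.
move=> uJ uH; rewrite pinv_gram// /least_norm_solution -!mulmxA; do 3 congr (_ *m _).
by rewrite (mulmxA J) mulKmx.
Qed.

End least_norm_solutions.

(** * Stacked vectors, gradients and geodesics *)

Section stacking.
Context {R : realType} {N q : nat}.

Lemma sum_stack (F : 'I_N -> 'I_q -> R) :
  \sum_(k < \sum_(i < N) q) F (tagnat.sig1 k) (tagnat.sig2 k) =
  \sum_(i < N) \sum_(a < q) F i a.
Proof.
have -> := @sig_big_dep R 0 +%R 'I_N (fun=> 'I_q) xpredT (fun i => xpredT) F.
by rewrite (reindex _ (@tagnat.sig_bij_on N (fun=> q))).
Qed.

Lemma mxdot_mxcol (B D : 'I_N -> 'cV[R]_q) :
  mxdot (\mxcol_(i < N) B i) (\mxcol_(i < N) D i) = \sum_(i < N) mxdot (B i) (D i).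
Proof.
rewrite /mxdot -(sum_stack (fun i a => \sum_(j < 1) B i a j * D i a j)).
by apply: eq_bigr => k _; apply: eq_bigr => j _; rewrite !mxE.
Qed.

Lemma coercive_mxdiag (A : 'I_N -> 'M[R]_q) (k : R) :
  (forall i (v : 'cV[R]_q), k * frob v ^+ 2 <= mxdot v (A i *m v)) ->
  forall v : 'cV[R]_(\sum_(i < N) q), k * frob v ^+ 2 <= mxdot v (\mxdiag_i A i *m v).
Proof.
move=> Ak v; rewrite -[v]submxcolK mul_mxdiag_mxcol mxdot_mxcol sqr_frob mxdot_mxcol mulr_sumr.
by apply: ler_sum => i _; rewrite -sqr_frob.
Qed.

End stacking.

Lemma sum_sqr_le_sqr_sum {R : realDomainType} (I : Type) (s : seq I) (a : I -> R) :
  (forall i, 0 <= a i) -> \sum_(i <- s) a i ^+ 2 <= (\sum_(i <- s) a i) ^+ 2.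
Proof.
move=> a0; elim: s => [|i s IH]; first by rewrite !big_nil expr0n.
rewrite !big_cons sqrrD; have sum0 : 0 <= \sum_(i <- s) a i by apply: sumr_ge0.
apply: le_trans (lerD (lexx _) IH) _; rewrite -addrA lerD2l lerDr.
by rewrite mulrn_wge0// mulr_ge0.
Qed.

Lemma frob_mxcol_sqr_le {R : realType} {N q : nat} (B D : 'I_N -> 'cV[R]_q) (k : R) : 0 <= k ->
  (forall i, frob (B i) <= k * frob (D i) ^+ 2) ->
  frob (\mxcol_(i < N) B i) <= k * frob (\mxcol_(i < N) D i) ^+ 2.
Proof.
move=> k0 BD; rewrite -(@ler_pXn2r _ 2%N)// ?nnegrE ?frob_ge0 ?(mulr_ge0 k0 (sqr_ge0 _))//.
have sqr_mxcol (C : 'I_N -> 'cV[R]_q) :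
    frob (\mxcol_(i < N) C i) ^+ 2 = \sum_(i < N) frob (C i) ^+ 2.
  by rewrite sqr_frob mxdot_mxcol; apply: eq_bigr => i _; rewrite sqr_frob.
rewrite !sqr_mxcol mulr_sumr.
have kD0 i : 0 <= k * frob (D i) ^+ 2 by rewrite mulr_ge0 ?sqr_ge0.
apply: le_trans (sum_sqr_le_sqr_sum _ kD0); apply: ler_sum => i _.
by rewrite ler_pXn2r ?nnegrE ?frob_ge0.
Qed.

Lemma frob_row_sum_le {R : realType} {k l : nat} (A : 'M[R]_(k, l)) :
  frob A <= \sum_(i < k) frob (row i A).
Proof.
rewrite -(@ler_pXn2r _ 2%N)// ?nnegrE ?frob_ge0 ?sumr_ge0// => [|i _]; last exact: frob_ge0.
apply: le_trans (sum_sqr_le_sqr_sum _ (fun i => frob_ge0 (row i A))).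
rewrite sqr_frob /mxdot; apply: ler_sum => i _; rewrite sqr_frob /mxdot big_ord1.
by apply: ler_sum => j _; rewrite !mxE.
Qed.

Section gradients.
Context {R : realType} {q : nat} (L : 'cV[R]_q -> R).
Hypothesis sL : smooth_on setT L.
Implicit Types (y z e : 'cV[R]_q).

Lemma is_derive_gradient y e (s : R) :
  is_derive s (1 : R) (fun s => gradient L (y + s *: e)) ((hessian L (y + s *: e))^T *m e).
Proof.
apply/is_derive_mxP => b j; rewrite ord1.
have -> : (fun s : R => gradient L (y + s *: e) b 0) =
    (fun s : R => 'D_(delta_mx b 0) L (y + s *: e)).
  by apply/funext => u; rewrite mxE.
have partial_differentiable : differentiable ('D_(delta_mx b 0) L) (y + s *: e).
  by apply: smooth_on_differentiable (smooth_on_derive _ sL) _.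
have := is_derive_along_line partial_differentiable; move=> /is_derive_eq; apply.
have [D DE] := derive_linear partial_differentiable.
rewrite DE {1}(matrix_sum_delta e) linear_sum mxE; apply: eq_bigr => a _.
by rewrite big_ord1 linearZ/= -DE !mxE mulrC.
Qed.

Lemma gradient_taylor y z (k : R) : 0 <= k -> (hessian L z)^T = hessian L z ->
  (forall w, frob (hessian L w - hessian L z) <= k * frob (w - z)) ->
  frob (gradient L z - gradient L y - hessian L z *m (z - y)) <= k * frob (z - y) ^+ 2.
Proof.
move=> k0 symH lipH; set H := hessian L z in symH lipH *; pose e := z - y.
pose g (s : R) := gradient L (y + s *: e) - (0 + s *: (H *m e)).
have gD s : is_derive s (1 : R) g ((hessian L (y + s *: e))^T *m e - H *m e).
  exact: (is_deriveB (is_derive_gradient y e s) (is_derive_line 0 (H *m e) s)).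
have -> : gradient L z - gradient L y - H *m (z - y) = g 1 - g 0.
  by rewrite /g !scale1r !scale0r !addr0 add0r subr0 /e subrKC addrAC.
apply: (frob_mean_value01 (fun s _ => gD s)) => s s01.
rewrite -[X in _ - X *m e]symH -mulmxBl -linearB; apply: le_trans (frob_mulmx _ _) _.
rewrite frob_tr expr2 mulrA ler_wpM2r ?frob_ge0//; apply: le_trans (lipH _) _.
have -> : y + s *: e - z = (s - 1) *: e by rewrite /e; mx_ring.
by rewrite ler_wpM2l// frobZ ler_piMl ?frob_ge0// ler_norml; lra.
Qed.

End gradients.

Section geodesic_paths.
Context {R : realType} {m n : nat} (M : set 'M[R]_(m, n)) (c : R -> 'M[R]_(m, n)).
Hypothesis gc : geodesic M c.

Lemma geodesic_derive_function (g : 'M[R]_(m, n) -> R) (G : 'M[R]_(m, n)) s :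
  is_rgrad M g (c s) G -> is_derive s (1 : R) (g \o c) (mxdot G (derive1 c s)).
Proof.
have sc := geodesic_smooth gc.
move=> [_ /(_ _ (smooth_curve_at sc s (geodesic_M gc)))]; rewrite derive1_shift// => gD.
pose shifted t := g (c (s + t *: (1 : R^o))).
have s0 : - s + s * 1 = 0 :> R by rewrite mulr1 addNr.
have -> : g \o c = fun u => shifted (- s + u * 1).
  by apply/funext => u; rewrite /shifted /GRing.scale/= !mulr1 addNKr.
have := @is_derive_affine R _ shifted (- s) 1 s (mxdot G (derive1 c s)).
by rewrite s0 scale1r; exact.
Qed.

Lemma geodesic_reach s : 0 <= s -> reach M (c 0) (frob (derive1 c 0) * s) (c s).
Proof.
move=> s0; apply: lipschitz_path_reach => //; first exact: frob_ge0.
split=> [u _|u u' _ uu' _]; first exact: geodesic_M gc u.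
by have := geodesic_lipschitz gc u' u; rewrite ger0_norm// subr_ge0.
Qed.

Lemma geodesic_derive_lipschitz (k : R) s : 0 <= s <= 1 ->
  (forall u, 0 <= u <= 1 -> frob (derive1n 2 c u) <= k) ->
  frob (derive1 c s - derive1 c 0) <= k.
Proof.
move=> /andP[s0 s1] ck; have k0 : 0 <= k.
  by apply: le_trans (frob_ge0 _) (ck 0 _); rewrite lexx ler01.
apply: (@le_trans _ _ (k * (s - 0))); last by rewrite subr0 ler_piMr.
apply: (frob_mean_value s0 (fun u _ => geodesic_is_derive1 gc u)) => u /andP[u0 us].
by apply: ck; rewrite u0 (le_trans us).
Qed.

End geodesic_paths.

(** * Natural gradient steps *)

Lemma fisher_sym {R : realType} {q : nat} (nu : {measure set (labels R q) -> \bar R})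
    (p : labels R q -> 'cV[R]_q -> R) z : (fisher nu p z)^T = fisher nu p z.
Proof.
apply/matrixP => a b; rewrite !mxE; congr Rintegral; apply/funext => w.
rewrite /fisher_entry; congr (_ * _); rewrite !mxE.
by apply: eq_bigr => j _; rewrite mulrC [X in X * _]mxE [X in _ = _ * X]mxE.
Qed.

(* Apart from the cap [1], the step bound is a fixed number divided by [kR]. *)
Lemma step_bound_small {R : realType} (mu kL kH s e r : R) : 0 <= e -> 0 < r ->
  exists2 kR : R, 0 < kR & forall t, 0 < t -> t <= step_bound mu kL kH kR s e -> t * e <= r.
Proof.
move=> e0 r0.
pose A := (1 / (6 * e) - kH / (2 * mu)) * ((3 * mu ^+ 2 * s) / (8 * kL ^+ 2)).
have A1 : 0 < `|A| + 1 by rewrite ltr_wpDl.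
have e1 : 0 < e + 1 by rewrite ltr_wpDl.
exists ((`|A| + 1) * ((e + 1) / r)) => [|t t0]; first by rewrite mulr_gt0// divr_gt0.
set kR := (X in step_bound _ _ _ X); have kR0 : 0 < kR by rewrite mulr_gt0// divr_gt0.
rewrite /step_bound; case: eqP => [-> _|_]; first by rewrite mulr0 ltW.
rewrite le_min => /andP[_].
have -> : (1 / (6 * e) - kH / (2 * mu)) * (3 * mu ^+ 2 * s / (8 * kR * kL ^+ 2)) = A / kR.
  by rewrite (mulrAC 8) (invfM (8 * kL ^+ 2)) /A !mulrA.
rewrite ler_pdivlMr// => tA; have {tA} : t * ((e + 1) / r) <= 1.
  rewrite -(ler_pM2l A1) mulr1 mulrCA; apply: le_trans tA _.
  by apply: le_trans (ler_norm A) _; rewrite lerDl.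
by rewrite mulrA ler_pdivrMr// mul1r; apply: le_trans; rewrite ler_pM2l// lerDl.
Qed.

Section natural_gradient.
Context {R : realType} {m n d q N : nat} {X : Type} {M : set 'M[R]_(m, n)}
  {E : 'M[R]_(m, n) -> 'M[R]_(m, n) -> 'M[R]_(m, n)}
  {nu : {measure set (labels R q) -> \bar R}}
  {p : labels R q -> 'cV[R]_q -> R} {f : X -> 'M[R]_(m, n) -> 'cV[R]_q}
  {x : 'I_N -> X} {y : 'I_N -> 'cV[R]_q} {H_L : 'cV[R]_q -> 'M[R]_q}
  {mu kL kH : R} {th0 : 'M[R]_(m, n)}.
Hypothesis hM : embedded_submanifold d M.
Hypothesis hE : exponential_map M E.
Hypothesis hf : forall (i : 'I_N) (a : 'I_q), C1_on_manifold M (fun th => f (x i) th a 0).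
Hypotheses (hmu : 0 < mu) (hkH : 0 < kH).
Hypothesis hL_smooth : forall i : 'I_N, smooth_on setT (fun z => loss p z (y i)).
Hypothesis hL_hess : forall (i : 'I_N) (z : 'cV[R]_q),
  loewner_le mu%:M (hessian (fun w => loss p w (y i)) z) /\
  loewner_le (hessian (fun w => loss p w (y i)) z) kL%:M.
Hypothesis hL_lip : forall (i : 'I_N) (z z' : 'cV[R]_q),
  frob (hessian (fun w => loss p w (y i)) z
        - hessian (fun w => loss p w (y i)) z') <= kH * frob (z - z').
Hypothesis hL_label : forall i : 'I_N, gradient (fun w => loss p w (y i)) (y i) = 0.
Hypothesis hF : forall (i : 'I_N) (th : 'M[R]_(m, n)), M th ->
  [/\ fisher_defined nu p (f (x i) th),
      fisher nu p (f (x i) th) = H_L (f (x i) th) &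
      forall j : 'I_N,
        hessian (fun w => loss p w (y j)) (f (x i) th) = H_L (f (x i) th)].
Hypothesis hth0 : M th0.

Local Notation J := (RJac M f x).
Local Notation H th := (\mxdiag_(i < N) H_L (f (x i) th)).
Local Notation error th := (outputs f x th - \mxcol_(i < N) y i).
Local Notation res := (residual f x y).
Local Notation s0 := (sigma0 M f x th0).
Local Notation dir := (RNG_direction M p H_L f x y).
Local Notation output k := (fun th => f (x (tagnat.sig1 k)) th (tagnat.sig2 k) 0).
Local Notation output_grad k := (rgrad M (output k)).

Hypothesis hs0 : 0 < s0.
Hypothesis hJ : forall th : 'M[R]_(m, n), M th ->
  frob (th - th0) <= 4 * kL * (mu * s0)^-1 * res th0 ->
  frob (J th - J th0) <= Num.min (1 / 2) (mu / (6 * kL)) * s0.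

Lemma output_gradP k th : M th -> is_rgrad M (output k) th (output_grad k th).
Proof. by move=> Mth; exact: (hf _ _).1. Qed.

Lemma RJacE th k j : J th k j = vec (output_grad k th) j 0.
Proof. by rewrite [LHS]mxE [LHS]mxE [LHS]mxE. Qed.

Lemma RJac_mul_vec th v k : (J th *m vec v) k 0 = mxdot (output_grad k th) v.
Proof.
rewrite mxE -mxdot_vec /mxdot; apply: eq_bigr => j _.
by rewrite big_ord1 RJacE.
Qed.

Lemma RJac_dist_le th th' :
  frob (J th - J th') <= \sum_k frob (output_grad k th - output_grad k th').
Proof.
apply: le_trans (frob_row_sum_le _) _; apply: ler_sum => k _.
have -> : row k (J th - J th') = (vec (output_grad k th - output_grad k th'))^T.
  apply/rowP => j; rewrite [vec (_ - _)]linearB/= [LHS]mxE [LHS]mxE [X in _ + X]mxE !RJacE.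
  by rewrite [RHS]mxE [RHS]mxE [X in _ = _ + X]mxE.
by rewrite frob_tr frob_vec.
Qed.

Lemma RJac_continuous z (e : R) : M z -> 0 < e ->
  \forall th \near z, M th -> frob (J th - J z) < e.
Proof.
move=> Mz e0; pose D := (\sum_(i < N) q)%N.
have grad_near (k : 'I_D) :
    \forall th \near z, M th -> frob (output_grad k th - output_grad k z) < e / D.+1%:R.
  have /subspace_continuousP/(_ z Mz) := (hf (tagnat.sig1 k) (tagnat.sig2 k)).2.
  by move/(_ _ (nbhs_fball _ (divr_gt0 e0 (ltr0Sn R D)))); rewrite /nbhs/= /within/=.
apply: filterS (filter_forall (nbhs_filter z) grad_near) => th near_th Mth.
apply: le_lt_trans (RJac_dist_le _ _) _.
apply: (@le_lt_trans _ _ (\sum_(k < D) e / D.+1%:R)).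
  by apply: ler_sum => k _; apply: ltW; exact: near_th.
rewrite sumr_const card_ord -[X in X < _]mulr_natr -mulrA gtr_pMr//.
by rewrite mulrC ltr_pdivrMr ?ltr0n// mul1r ltr_nat.
Qed.

Lemma RJac_uniformly_continuous K (e : R) : compact K -> K `<=` M -> 0 < e ->
  exists2 r : R, 0 < r & forall th th', K th -> fball th r th' -> M th' ->
    frob (J th' - J th) <= e.
Proof.
move=> cK KM e0; have [|r r0 rP] := compact_uniform_pairs
  (P := fun th th' => M th -> M th' -> frob (J th' - J th) <= e) cK; last first.
  by exists r => // th th' Kth near_th Mth'; apply: rP => //; exact: KM.
move=> z /KM Mz; have := RJac_continuous Mz (divr_gt0 e0 (ltr0n R 2)).
move=> /nbhs_fballP[r r0 rP]; exists r => // th th' /rP Jth /rP Jth' /Jth{}Jth /Jth'{}Jth'.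
apply: le_trans (frob_dist_triangle (J z) _ _) _; rewrite (frob_distC (J z)).
by move: (lerD (ltW Jth') (ltW Jth)); rewrite -splitr.
Qed.

Lemma mu_le_kL : mu <= kL.
Proof.
have : (0 < \sum_(i < N) q)%N.
  rewrite lt0n; apply: contraTneq hs0 => D0; rewrite -leNgt /sigma0.
  by move: (J th0 *m (J th0)^T); rewrite D0 => A; rewrite lambda_min_mx0 sqrtr0.
rewrite sum_nat_const card_ord muln_gt0 => /andP[N0 q0].
by have [mu_le le_kL] := hL_hess (Ordinal N0) 0; exact: loewner_le_scalar_mx q0 mu_le le_kL.
Qed.

Lemma H_coercive th : M th -> forall v : 'cV[R]_(\sum_(i < N) q),
  mu * frob v ^+ 2 <= mxdot v (H th *m v).
Proof.
move=> Mth; apply: coercive_mxdiag => i v; have [_ _ /(_ i) <-] := hF i Mth.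
by have /loewner_leE/(_ v) := (hL_hess i (f (x i) th)).1; rewrite mxdot_scalar_mx.
Qed.

Lemma grad_loss_linearization th : M th ->
  frob (grad_loss p f x y th - H th *m error th) <= kH * res th ^+ 2.
Proof.
move=> Mth; rewrite /residual /grad_loss /outputs -mxcolB mul_mxdiag_mxcol -mxcolB.
apply: frob_mxcol_sqr_le => [|i]; first exact: ltW.
have [_ fisherE hessE] := hF i Mth.
have := gradient_taylor (hL_smooth i) (y i) (ltW hkH) (z := f (x i) th).
rewrite hL_label subr0 !hessE; apply; first by rewrite -fisherE fisher_sym.
by move=> w; rewrite -(hessE i); exact: hL_lip.
Qed.

Section direction.
Variable th : 'M[R]_(m, n).
Hypotheses (Mth : M th) (Jth : frob (J th - J th0) <= s0 / 6).

Let J_lower (w : 'cV[R]_(\sum_(i < N) q)) : 5 / 6 * s0 * frob w <= frob ((J th)^T *m w).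
Proof.
apply: le_trans (bounded_below_perturb (sqrt_lambda_min_le (J th0)) Jth w).
by rewrite ler_wpM2r ?frob_ge0//; move: hs0; rewrite -/s0; lra.
Qed.

Let s56 : 0 < 5 / 6 * s0. Proof. by rewrite mulr_gt0// divr_gt0. Qed.

Lemma RNG_directionE :
  dir th = unvec (least_norm_solution (J th) (invmx (H th) *m grad_loss p f x y th)).
Proof.
rewrite /RNG_direction /RFisher pinv_gram_mulmx//; first exact: gram_unitmx s56 J_lower.
exact: coercive_unitmx hmu (H_coercive Mth).
Qed.

Lemma RJac_RNG_direction : J th *m vec (dir th) = invmx (H th) *m grad_loss p f x y th.
Proof. by rewrite RNG_directionE unvecK least_norm_solutionP// (gram_unitmx s56). Qed.

Lemma RNG_direction_linearization :
  frob (J th *m vec (dir th) - error th) <= kH * res th ^+ 2 / mu.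
Proof.
rewrite RJac_RNG_direction; apply: le_trans (coercive_solve_dist _ _ hmu (H_coercive Mth)) _.
by rewrite ler_pM2r ?invr_gt0//; exact: grad_loss_linearization.
Qed.

Lemma frob_RNG_direction_le : frob (dir th) <= 6 / 5 / s0 * frob (J th *m vec (dir th)).
Proof.
rewrite RJac_RNG_direction RNG_directionE -(frob_vec (unvec _)) unvecK.
have -> : 6 / 5 / s0 = (5 / 6 * s0)^-1 by rewrite invfM invf_div.
exact: frob_least_norm_solution_le.
Qed.

Lemma RNG_direction_tangent : tangent M th (dir th).
Proof.
rewrite RNG_directionE /least_norm_solution; set z := invmx _ *m _.
have -> : unvec ((J th)^T *m z) = \sum_k z k 0 *: output_grad k th.
  rewrite -[RHS]vecK; congr unvec; rewrite linear_sum/=.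
  apply/colP => j; rewrite summxE mxE; apply: eq_bigr => k _.
  by rewrite linearZ/= [in LHS]mxE RJacE [RHS]mxE mulrC.
apply: (tangent_sum hM) => // k; apply: (tangentZ hM) => //.
exact: (output_gradP k Mth).1.
Qed.

End direction.

Lemma is_derive_outputs c s : geodesic M c ->
  is_derive s (1 : R) (fun u => outputs f x (c u)) (J (c s) *m vec (derive1 c s)).
Proof.
move=> gc; apply/is_derive_mxP => k j; rewrite ord1 RJac_mul_vec.
have -> : (fun u => outputs f x (c u) k 0) = output k \o c.
  by apply/funext => u; rewrite mxE.
exact: (geodesic_derive_function gc (output_gradP k (geodesic_M gc s))).
Qed.

Definition output_velocity_variation c s : R :=
  frob (J (c s) *m vec (derive1 c s) - J (c 0) *m vec (derive1 c 0)).

Lemma output_velocity_variation_le c (k : R) s : geodesic M c -> 0 <= s <= 1 ->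
  (forall u, 0 <= u <= 1 -> frob (derive1n 2 c u) <= k) ->
  output_velocity_variation c s <=
  frob (J (c s) - J (c 0)) * frob (derive1 c 0) + frob (J (c 0)) * k.
Proof.
move=> gc s01 ck; rewrite /output_velocity_variation.
have -> : J (c s) *m vec (derive1 c s) - J (c 0) *m vec (derive1 c 0) =
    (J (c s) - J (c 0)) *m vec (derive1 c s) + J (c 0) *m vec (derive1 c s - derive1 c 0).
  by rewrite [vec (_ - _)]linearB mulmxBr mulmxBl addrA subrK.
apply: le_trans (frobD _ _) _; apply: lerD; apply: le_trans (frob_mulmx _ _) _.
  by rewrite frob_vec (geodesic_speed gc).
by rewrite frob_vec ler_wpM2l ?frob_ge0// (geodesic_derive_lipschitz gc s01 ck).
Qed.

Definition step_geodesic th (t : R) c : Prop :=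
  [/\ geodesic M c, c 0 = th, derive1 c 0 = - (t *: dir th) & c 1 = E th (- (t *: dir th))].

Lemma step_geodesic_exists th (t : R) : M th -> frob (J th - J th0) <= s0 / 6 ->
  exists c, step_geodesic th t c.
Proof.
move=> Mth Jth; have Tv : tangent M th (- (t *: dir th)).
  by rewrite -scaleNr; apply: (tangentZ hM) => //; exact: RNG_direction_tangent.
by have [c [gc c0 c'0 c1]] := hE Mth Tv; exists c.
Qed.

Lemma residual_step_geodesic th (t a B : R) c : step_geodesic th t c -> 0 <= t <= 1 ->
  frob (J th *m vec (dir th) - error th) <= a ->
  (forall s, 0 <= s <= 1 -> output_velocity_variation c s <= B) ->
  res (c 1) <= (1 - t) * res th + t * a + B.
Proof.
move=> [gc c0 c'0 _] /andP[t0 t1] dir_a variation_B.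
pose w := J (c 0) *m vec (derive1 c 0).
have wE : w = - (t *: (J th *m vec (dir th))).
  by rewrite /w c'0 c0 linearN linearZ/= mulmxN -scalemxAr.
pose g (s : R) := outputs f x (c s) - (0 + s *: w).
have gD (s : R) : 0 <= s <= 1 -> is_derive s (1 : R) g (J (c s) *m vec (derive1 c s) - w).
  by move=> _; exact: (is_deriveB (is_derive_outputs s gc) (is_derive_line 0 w s)).
have g_le : frob (g 1 - g 0) <= B by exact: frob_mean_value01 gD variation_B.
have errorE : error (c 1) =
    (1 - t) *: error th - t *: (J th *m vec (dir th) - error th) + (g 1 - g 0).
  rewrite /g wE c0; move: (J th *m _) (outputs f x (c 1)) (outputs f x th) (\mxcol_i y i).
  by move=> *; mx_ring.
rewrite /residual errorE; apply: le_trans (frobD _ _) (lerD _ g_le).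
apply: le_trans (frobB _ _) _; rewrite !frobZ !ger0_norm ?subr_ge0//.
by rewrite lerD2l ler_wpM2l.
Qed.

(* The whole iteration stays within this distance: each step has length at most
   [8 / (5 s0) t] times the residual, and the residual drops by [t / 2] of itself. *)
Local Notation slope := (8 / 5 / s0).
Local Notation radius := (2 * slope * res th0).

Let slope_ge0 : 0 <= slope. Proof. by rewrite !divr_ge0 ?(ltW hs0). Qed.

Let slope2_ge0 : 0 <= 2 * slope. Proof. exact: mulr_ge0. Qed.

Let radius_ge0 : 0 <= radius. Proof. exact: mulr_ge0 (frob_ge0 _). Qed.

Definition confined_geodesic c : Prop :=
  geodesic M c /\ forall s, 0 <= s <= 1 -> reach M th0 radius (c s).

Lemma reach_RJac z : reach M th0 radius z -> frob (J z - J th0) <= s0 / 6.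
Proof.
move=> rz; have kL0 : 0 < kL by exact: lt_le_trans hmu mu_le_kL.
apply: le_trans (hJ (reach_M radius_ge0 rz) _) _.
  apply: le_trans (reach_dist radius_ge0 rz) _; rewrite ler_wpM2r ?frob_ge0//.
  rewrite invfM mulrA [leRHS]mulrA ler_wpM2r ?invr_ge0 ?(ltW hs0)//.
  by rewrite ler_pdivlMr//; have := mu_le_kL; have := hmu; lra.
rewrite [leRHS]mulrC ler_wpM2r ?(ltW hs0)// ge_min; apply/orP; right.
by rewrite ler_pdivrMr ?mulr_gt0// mulrA mulVf ?mul1r ?mu_le_kL.
Qed.

Let J_bound := frob (J th0) + s0.

Let J_bound_gt0 : 0 < J_bound. Proof. by rewrite ltr_wpDl ?frob_ge0. Qed.

Lemma reach_RJac_le z : reach M th0 radius z -> frob (J z) <= J_bound.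
Proof.
move=> rz; apply: le_trans (frob_le_distD _ (J th0)) _; rewrite lerD2l.
by apply: le_trans (reach_RJac rz) _; move: hs0; lra.
Qed.

Lemma confined_acceleration_le : exists2 k : R, 0 < k & forall c, confined_geodesic c ->
  forall s, 0 <= s <= 1 -> frob (derive1n 2 c s) <= k * frob (derive1 c 0) ^+ 2.
Proof.
have [k k0 kP] := geodesic_acceleration_compact hM
  (@closure_reach_compact _ _ _ M th0 _ radius_ge0) (hopf_rinow hM hE hth0 radius_ge0).
exists k => // c [gc rc] s s01; apply: kP => //.
by apply: subset_closure; exact: rc.
Qed.

Lemma confined_variation_small (e : R) : 0 < e -> exists2 r : R, 0 < r &
  forall c, confined_geodesic c -> frob (derive1 c 0) <= r ->
  forall s, 0 <= s <= 1 -> output_velocity_variation c s <= e * frob (derive1 c 0).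
Proof.
move=> e0; have [k k0 kP] := confined_acceleration_le.
have cK := @closure_reach_compact _ _ _ M th0 _ radius_ge0.
have [r r0 rP] := RJac_uniformly_continuous cK (hopf_rinow hM hE hth0 radius_ge0)
  (divr_gt0 e0 (ltr0n R 2)).
have Jk0 : 0 < J_bound * k by rewrite mulr_gt0.
exists (Num.min (r / 2) (e / 2 / (J_bound * k))); first by rewrite lt_min !divr_gt0.
move=> c [gc rc]; rewrite le_min => /andP[vr ve] s s01; have conf : confined_geodesic c by [].
have unit0 : 0 <= (0 : R) <= 1 by rewrite lexx ler01.
apply: le_trans (output_velocity_variation_le gc s01 (kP c conf)) _.
rewrite [X in _ <= X * _]splitr [leRHS]mulrDl; apply: lerD.
  rewrite ler_wpM2r ?frob_ge0//; apply: rP; last exact: geodesic_M gc s.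
    by apply: subset_closure; exact: rc.
  apply: le_lt_trans (geodesic_lipschitz gc _ _) _; rewrite subr0.
  have /andP[s_ge0 s_le1] := s01; rewrite ger0_norm//.
  by have := ler_piMr (frob_ge0 (derive1 c 0)) s_le1; lra.
rewrite expr2 2!mulrA ler_wpM2r ?frob_ge0//.
move: ve; rewrite ler_pdivlMr// => ve; apply: le_trans ve.
rewrite mulrC ler_wpM2l ?frob_ge0// ler_wpM2r ?(ltW k0)//; exact: reach_RJac_le (rc 0 unit0).
Qed.

Lemma confined_variation_quadratic (kJ : R) :
  (forall th th', M th -> M th' -> frob (J th - J th') <= kJ * frob (th - th')) ->
  exists2 k : R, 0 <= k & forall c, confined_geodesic c ->
    forall s, 0 <= s <= 1 -> output_velocity_variation c s <= k * frob (derive1 c 0) ^+ 2.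
Proof.
move=> lipJ; have [k k0 kP] := confined_acceleration_le.
exists (`|kJ| + J_bound * k) => [|c conf s s01]; first by rewrite addr_ge0// mulr_ge0 ?ltW.
have [gc rc] := conf; have unit0 : 0 <= (0 : R) <= 1 by rewrite lexx ler01.
apply: le_trans (output_velocity_variation_le gc s01 (kP c conf)) _.
rewrite [leRHS]mulrDl; apply: lerD.
  rewrite expr2 mulrA ler_wpM2r ?frob_ge0//.
  apply: le_trans (lipJ _ _ (geodesic_M gc _) (geodesic_M gc _)) _.
  apply: le_trans (ler_wpM2r (frob_ge0 _) (ler_norm kJ)) _; rewrite ler_wpM2l//.
  apply: le_trans (geodesic_lipschitz gc _ _) _; rewrite subr0.
  by have /andP[s_ge0 s_le1] := s01; rewrite ger0_norm// ler_piMr ?frob_ge0.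
rewrite mulrA !ler_wpM2r ?sqr_ge0 ?(ltW k0)//; exact: reach_RJac_le (rc 0 unit0).
Qed.

Section small_residual.
Hypothesis he0 : res th0 < mu / (3 * kH).

Lemma quadratic_term_le th : res th <= res th0 -> kH * res th ^+ 2 / mu <= res th / 3.
Proof.
move=> re; rewrite ler_pdivrMr//.
have := le_trans re (ltW he0); rewrite ler_pdivlMr ?mulr_gt0// => e_mu.
have e3 : 0 <= res th / 3 by rewrite divr_ge0 ?frob_ge0.
by have := ler_wpM2l e3 e_mu; move: (res th) => a; lra.
Qed.

Definition RNG_invariant th : Prop :=
  res th <= res th0 /\ reach M th0 (2 * slope * (res th0 - res th)) th.

Lemma RNG_invariant0 : RNG_invariant th0.
Proof. by split; [exact: lexx|rewrite subrr mulr0; exact: reach_refl]. Qed.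

Section step.
Variables (th : 'M[R]_(m, n)) (t : R) (c : R -> 'M[R]_(m, n)).
Hypotheses (ith : RNG_invariant th) (t0 : 0 < t) (t1 : t <= 1).

Lemma RNG_invariant_reach : reach M th0 radius th.
Proof.
have [re rt] := ith; apply: reach_le rt; first by rewrite mulr_ge0 ?slope2_ge0// subr_ge0.
by rewrite ler_wpM2l// gerBl frob_ge0.
Qed.

Let Mth : M th. Proof. exact: reach_M radius_ge0 RNG_invariant_reach. Qed.

Let Jth : frob (J th - J th0) <= s0 / 6. Proof. exact: reach_RJac RNG_invariant_reach. Qed.

Lemma RNG_step_exists : exists c, step_geodesic th t c.
Proof. exact: step_geodesic_exists. Qed.

Lemma frob_RNG_direction_le_residual : frob (dir th) <= slope * res th.
Proof.
have [re _] := ith; apply: le_trans (frob_RNG_direction_le Mth Jth) _.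
have J_dir : frob (J th *m vec (dir th)) <= 4 / 3 * res th.
  apply: le_trans (frob_le_distD _ (error th)) _.
  have := le_trans (RNG_direction_linearization Mth Jth) (quadratic_term_le re).
  by rewrite -/(res th); move: (frob (_ - _)) (res th) => a b; lra.
have -> : slope * res th = 6 / 5 / s0 * (4 / 3 * res th) by field; rewrite gt_eqF.
by rewrite ler_wpM2l// !divr_ge0// ltW.
Qed.

Hypothesis step_c : step_geodesic th t c.

Lemma RNG_step_speed : frob (derive1 c 0) <= slope * (t * res th).
Proof.
have [_ _ -> _] := step_c; rewrite frobN frobZ gtr0_norm// [leRHS]mulrCA ler_pM2l//.
exact: frob_RNG_direction_le_residual.
Qed.

Lemma RNG_step_reach s : 0 <= s <= 1 ->
  reach M th0 (2 * slope * (res th0 - res th) + slope * (t * res th)) (c s).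
Proof.
move=> /andP[s_ge0 s_le1]; have [gc c0 _ _] := step_c; have [re rt] := ith.
have dist0 : 0 <= 2 * slope * (res th0 - res th) by rewrite mulr_ge0 ?slope2_ge0// subr_ge0.
have len0 : 0 <= frob (derive1 c 0) * s by rewrite mulr_ge0 ?frob_ge0.
have := geodesic_reach gc s_ge0; rewrite c0 => reach_s.
apply: reach_le (reach_cat dist0 len0 rt reach_s); first exact: addr_ge0.
rewrite lerD2l; apply: le_trans RNG_step_speed; exact: ler_piMr (frob_ge0 _) s_le1.
Qed.

Let tres_ge0 : 0 <= t * res th. Proof. by rewrite mulr_ge0 ?frob_ge0 ?ltW. Qed.

Let step_reach_ge0 : 0 <= 2 * slope * (res th0 - res th) + slope * (t * res th).
Proof.
have [re _] := ith; rewrite addr_ge0 ?(mulr_ge0 slope_ge0)// mulr_ge0 ?slope2_ge0//.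
by rewrite subr_ge0.
Qed.

Lemma RNG_step_confined : confined_geodesic c.
Proof.
split=> [|s s01]; first by case: step_c.
apply: reach_le step_reach_ge0 _ (RNG_step_reach s01).
have tres_le : t * res th <= 2 * res th.
  by have := ler_piMl (frob_ge0 (error th)) t1; have := frob_ge0 (error th); rewrite /residual; lra.
by have := ler_wpM2l slope_ge0 tres_le; move: (res th0) (res th) (slope) => a b k; lra.
Qed.

Lemma RNG_step_invariant : res (c 1) <= (1 - t / 2) * res th -> RNG_invariant (c 1).
Proof.
move=> decrease; have [re _] := ith; have unit1 : 0 <= (1 : R) <= 1 by rewrite ler01 lexx.
split; first by move: decrease tres_ge0 re; lra.
apply: reach_le step_reach_ge0 _ (RNG_step_reach unit1).
have half : t * res th <= 2 * (res th - res (c 1)) by move: decrease; lra.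
have := ler_wpM2l slope_ge0 half.
by move: (res th0) (res th) (res (c 1)) (slope) => a b e k; lra.
Qed.

Lemma RNG_step_residual (B : R) :
  (forall s, 0 <= s <= 1 -> output_velocity_variation c s <= B) ->
  res (c 1) <= (1 - t) * res th + t * (kH * res th ^+ 2 / mu) + B.
Proof.
apply: residual_step_geodesic; first exact: step_c; first by rewrite (ltW t0).
exact: RNG_direction_linearization.
Qed.

Lemma RNG_step_contraction :
  (forall s, 0 <= s <= 1 ->
    output_velocity_variation c s <= s0 * (5 / 48) * frob (derive1 c 0)) ->
  res (c 1) <= (1 - t / 2) * res th.
Proof.
move=> /RNG_step_residual/le_trans; apply; have [re _] := ith.
have curvature : t * (kH * res th ^+ 2 / mu) <= t * (res th / 3).
  by rewrite ler_pM2l//; exact: quadratic_term_le.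
have variation : s0 * (5 / 48) * frob (derive1 c 0) <= t * res th / 6.
  have -> : t * res th / 6 = s0 * (5 / 48) * (slope * (t * res th)) by field; rewrite gt_eqF.
  by rewrite ler_wpM2l ?RNG_step_speed// mulr_ge0 ?(ltW hs0)// divr_ge0.
by move: curvature variation; lra.
Qed.

End step.

End small_residual.

Lemma exists_linear_rate :
  exists2 kR : R, 0 < kR & linear_rate M E p H_L f x y mu kL kH th0 kR.
Proof.
have s48 : 0 < s0 * (5 / 48) by rewrite mulr_gt0// divr_gt0.
have slope_gt0 : 0 < slope by rewrite !divr_gt0.
have [r r0 variation] := confined_variation_small s48.
have [kR kR0 kR_small] := step_bound_small mu kL kH s0 (frob_ge0 (error th0))
  (divr_gt0 r0 slope_gt0).
exists kR => // he0 t th t0 tb [th_0 thS].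
have t1 : t <= 1.
  by move: tb; rewrite /step_bound; case: ifP => // _; rewrite le_min => /andP[].
have step j : RNG_invariant (th j) ->
    res (th j.+1) <= (1 - t / 2) * res (th j) /\ RNG_invariant (th j.+1).
  move=> ij; have [c stepc] := RNG_step_exists t ij; have [_ _ _ c1] := stepc.
  rewrite thS -c1; suff contraction : res (c 1) <= (1 - t / 2) * res (th j).
    by split=> //; exact: (RNG_step_invariant he0 ij t0 stepc).
  apply: (RNG_step_contraction he0 ij t0 t1 stepc).
  apply: variation; first exact: (RNG_step_confined he0 ij t0 t1 stepc).
  apply: le_trans (RNG_step_speed he0 ij t0 stepc) _; rewrite mulrC -ler_pdivlMr//.
  by apply: le_trans (kR_small t t0 tb); rewrite ler_wpM2l ?(ltW t0)//; case: ij.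
have invariant j : RNG_invariant (th j).
  by elim: j => [|j /step[]//]; rewrite th_0; exact: RNG_invariant0.
by move=> j; case: (step j (invariant j)).
Qed.

Lemma quadratic_rate (kR kJ : R) :
  linear_rate M E p H_L f x y mu kL kH th0 kR -> res th0 < mu / (3 * kH) ->
  1 <= step_bound mu kL kH kR s0 (res th0) ->
  (forall th th', M th -> M th' -> frob (J th - J th') <= kJ * frob (th - th')) ->
  exists2 kq : R, 0 < kq & forall th : nat -> 'M[R]_(m, n),
    RNG_iterates M E p H_L f x y 1 th0 th ->
    forall j, res (th j.+1) <= kq * res (th j) ^+ 2.
Proof.
move=> rate he0 sb /confined_variation_quadratic[k k0 variation].
exists (kH / mu + k * slope ^+ 2); first by rewrite ltr_wpDr ?divr_gt0// mulr_ge0 ?sqr_ge0.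
move=> th iter; have decrease := rate he0 1 th ltr01 sb iter; have [th_0 thS] := iter.
have invariant j : RNG_invariant (th j).
  elim: j => [|j ij]; first by rewrite th_0; exact: RNG_invariant0.
  have [c stepc] := RNG_step_exists 1 ij; have [_ _ _ c1] := stepc.
  have := decrease j; rewrite thS -c1; exact: (RNG_step_invariant he0 ij ltr01 stepc).
move=> j; have ij := invariant j; have [c stepc] := RNG_step_exists 1 ij.
have [_ _ _ c1] := stepc; rewrite thS -c1.
have conf := RNG_step_confined he0 ij ltr01 (lexx 1) stepc.
apply: le_trans (RNG_step_residual ij ltr01 (lexx 1) stepc (variation c conf)) _.
rewrite subrr mul0r add0r mul1r [leRHS]mulrDl; apply: lerD; first by rewrite mulrAC.
rewrite -mulrA ler_wpM2l// -exprMn.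
rewrite ler_pXn2r ?nnegrE ?frob_ge0 ?(mulr_ge0 slope_ge0 (frob_ge0 _))//.
by have := RNG_step_speed he0 ij ltr01 stepc; rewrite mul1r.
Qed.

End natural_gradient.

Theorem theorem5p9 (R : realType) (m n d q N : nat) (X : Type)
    (M : set 'M[R]_(m, n))
    (E : 'M[R]_(m, n) -> 'M[R]_(m, n) -> 'M[R]_(m, n))
    (nu : {measure set (labels R q) -> \bar R})
    (p : labels R q -> 'cV[R]_q -> R)
    (f : X -> 'M[R]_(m, n) -> 'cV[R]_q)
    (x : 'I_N -> X) (y : 'I_N -> 'cV[R]_q)
    (H_L : 'cV[R]_q -> 'M[R]_q)
    (mu kL kH : R) (th0 : 'M[R]_(m, n))
    (hM : embedded_submanifold d M)
    (hE : exponential_map M E)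
    (hf : forall (i : 'I_N) (a : 'I_q),
        C1_on_manifold M (fun th => f (x i) th a 0))
    (hp : conditional_density nu p)
    (hp_pos : forall (i : 'I_N) (z : 'cV[R]_q), 0 < p (y i) z)
    (hmu : 0 < mu) (hkH : 0 < kH)
    (hL_smooth : forall i : 'I_N, smooth_on setT (fun z => loss p z (y i)))
    (hL_hess : forall (i : 'I_N) (z : 'cV[R]_q),
        loewner_le mu%:M (hessian (fun w => loss p w (y i)) z) /\
        loewner_le (hessian (fun w => loss p w (y i)) z) kL%:M)
    (hL_lip : forall (i : 'I_N) (z z' : 'cV[R]_q),
        frob (hessian (fun w => loss p w (y i)) z
              - hessian (fun w => loss p w (y i)) z') <= kH * frob (z - z'))
    (hL_label : forall i : 'I_N, gradient (fun w => loss p w (y i)) (y i) = 0)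
    (hF : forall (i : 'I_N) (th : 'M[R]_(m, n)), M th ->
        [/\ fisher_defined nu p (f (x i) th),
            fisher nu p (f (x i) th) = H_L (f (x i) th) &
            forall j : 'I_N,
              hessian (fun w => loss p w (y j)) (f (x i) th)
              = H_L (f (x i) th)])
    (hth0 : M th0)
    (hs0 : 0 < sigma0 M f x th0)
    (hJ : forall th : 'M[R]_(m, n), M th ->
        frob (th - th0)
          <= 4 * kL * (mu * sigma0 M f x th0)^-1 * residual f x y th0 ->
        frob (RJac M f x th - RJac M f x th0)
          <= Num.min (1 / 2) (mu / (6 * kL)) * sigma0 M f x th0) :
  (exists2 kR : R, 0 < kR & linear_rate M E p H_L f x y mu kL kH th0 kR)
  /\
  (forall kR kJ : R, 0 < kR ->
     linear_rate M E p H_L f x y mu kL kH th0 kR ->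
     residual f x y th0 < mu / (3 * kH) ->
     1 <= step_bound mu kL kH kR (sigma0 M f x th0) (residual f x y th0) ->
     (forall th th' : 'M[R]_(m, n), M th -> M th' ->
        frob (RJac M f x th - RJac M f x th') <= kJ * frob (th - th')) ->
     exists2 kq : R, 0 < kq &
       forall th : nat -> 'M[R]_(m, n),
         RNG_iterates M E p H_L f x y 1 th0 th ->
         forall k : nat,
           residual f x y (th k.+1) <= kq * residual f x y (th k) ^+ 2).
Proof.
split; first exact: (exists_linear_rate hM hE hf hmu hkH hL_smooth hL_hess hL_lip
  hL_label hF hth0 hs0 hJ).
move=> kR kJ _; exact: (quadratic_rate hM hE hf hmu hkH hL_smooth hL_hess hL_lip
  hL_label hF hth0 hs0 hJ).
Qed.
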